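(* For every constant $\alpha\in(0,1)$ there is a constant $c_\alpha>0$, depending only on $\alpha$, such that the following holds. Let $n\ge 1$, let $(\xi_i,\mathcal{F}_i)_{i=0,\dots,n}$ be a sequence of martingale differences, let $X_n=\sum_{i=1}^n\xi_i$, and assume that for some $\epsilon\in(0,\frac12]$ and some $\delta\in[0,\frac12]$ conditions (A1) and (A2) hold. Then for all $0\le x\le \alpha\,\epsilon^{-1}$, $$\frac{\mathbb{P}(X_n>x)}{1-\Phi(x)}\le \exp\Big\{c_\alpha\big(x^3\epsilon+x^2\delta^2\big)\Big\}\Big(1+c_\alpha(1+x)\big(\epsilon|\log\epsilon|+\delta\big)\Big)$$ and $$\frac{\mathbb{P}(X_n<-x)}{\Phi(-x)}\le \exp\Big\{c_\alpha\big(x^3\epsilon+x^2\delta^2\big)\Big\}\Big(1+c_\alpha(1+x)\big(\epsilon|\log\epsilon|+\delta\big)\Big).$$ In particular $c_\alpha$ does not depend on $(\xi_i,\mathcal{F}_i)_{i=0,\dots,n}$, $n$ and $x$.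
   Context: $(\xi_i,\mathcal{F}_i)_{i=0,\dots,n}$ is a sequence of square integrable real martingale differences on a probability space $(\Omega,\mathcal{F},\mathbb{P})$: $\xi_0=0$, $\{\emptyset,\Omega\}=\mathcal{F}_0\subseteq\dots\subseteq\mathcal{F}_n\subseteq\mathcal{F}$ are increasing $\sigma$-fields, each $\xi_i$ is $\mathcal{F}_i$-measurable and $\mathbb{E}(\xi_i|\mathcal{F}_{i-1})=0$ for $1\le i\le n$. The quadratic characteristic is $\langle X\rangle_n=\sum_{i=1}^n\mathbb{E}(\xi_i^2|\mathcal{F}_{i-1})$. (In)equalities between random variables hold $\mathbb{P}$-almost surely. $\Phi(x)=\frac{1}{\sqrt{2\pi}}\int_{-\infty}^x e^{-t^2/2}\,dt$ is the standard normal distribution function. Condition (A1), with parameter $\epsilon\in(0,\frac12]$: the moments exist and $|\mathbb{E}(\xi_i^k|\mathcal{F}_{i-1})|\le \frac12 k!\,\epsilon^{k-2}\,\mathbb{E}(\xi_i^2|\mathcal{F}_{i-1})$ for all $k\ge3$ and $1\le i\le n$. Condition (A2), with parameter $\delta\in[0,\frac12]$: $|\langle X\rangle_n-1|\le\delta^2$. *)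

(* Defs.v *)
From HB Require Import structures.
From mathcomp Require Import all_boot all_order all_algebra.
From mathcomp Require Import all_classical all_reals all_analysis.
From mathcomp Require Import measurable_realfun.

Set Implicit Arguments.
Unset Strict Implicit.
Unset Printing Implicit Defensive.

Import Order.TTheory GRing.Theory Num.Theory.
Import numFieldNormedType.Exports.

Local Open Scope classical_set_scope.
Local Open Scope ring_scope.

(* For a sigma-algebra G, the measurable sets of g_sigma_algebraType G are
   exactly the members of G (measurable_g_measurableTypeE). *)
Definition measurable_wrt d (T : measurableType d) (R : realType)
    (G : set (set T)) (X : T -> R) : Prop :=
  measurable_fun [set: g_sigma_algebraType G] (X : g_sigma_algebraType G -> R).

Definition integrable_rv d (T : measurableType d) (R : realType)
    (P : probability T R) (X : T -> R) : Prop :=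
  P.-integrable [set: T] (EFin \o X).

Definition is_cond_exp d (T : measurableType d) (R : realType)
    (P : probability T R) (G : set (set T)) (X Y : T -> R) : Prop :=
  [/\ measurable_wrt G Y, integrable_rv P Y &
      forall A, G A ->
        (\int[P]_(w in A) (Y w)%:E = \int[P]_(w in A) (X w)%:E)%E].

(* An arbitrarily chosen version of E(X | G). The default value 0 is never used
   when G is a sub-sigma-algebra and X is integrable (cond_expP); any two
   versions then agree almost surely. *)
Definition cond_exp d (T : measurableType d) (R : realType)
    (P : probability T R) (G : set (set T)) (X : T -> R) : T -> R :=
  xget (fun=> 0) [set Y | is_cond_exp P G X Y].

Section cond_exp_existence.
Context d (T : measurableType d) (R : realType) (P : probability T R).
Variables (G : set (set T)).
Hypotheses (sG : sigma_algebra setT G) (GT : G `<=` measurable).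
Local Notation TG := (g_sigma_algebraType G).

Let to_sub (w : T) : TG := w.

Let mG (A : set TG) : measurable A = G A.
Proof. by rewrite measurable_g_measurableTypeE. Qed.

Let mto_sub : measurable_fun setT to_sub.
Proof. by move=> _ A; rewrite mG setTI => /GT. Qed.

#[local] HB.instance Definition _ := isMeasurableFun.Build _ _ _ _ to_sub mto_sub.

Lemma cond_exp_exists (X : T -> R) : integrable_rv P X ->
  exists Y, is_cond_exp P G X Y.
Proof.
move=> iX.
pose mu : {finite_measure set TG -> \bar R} := distribution P to_sub.
pose nu0 : {charge set TG -> \bar R} := pushforward (induced_charge iX) to_sub.
pose nu := nu0 mto_sub.
have numu : nu `<< mu.
  apply/null_content_dominatesP => A mA muA.
  have mA' : measurable (A : set T) by apply: GT; rewrite -mG.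
  apply: null_set_integral => //.
  by apply: measurable_funS (measurable_int P iX).
have [f [fin int eqn]] : exists f : TG -> \bar R,
    [/\ forall w, f w \is a fin_num, mu.-integrable setT f &
    forall A, measurable A -> nu A = (\int[mu]_(w in A) f w)%E].
  exists (Radon_Nikodym nu mu); split.
  - by move=> w; exact: Radon_Nikodym_fin_num.
  - exact: Radon_Nikodym_integrable.
  - by move=> A; exact: Radon_Nikodym_integral.
have mf : measurable_fun setT f by exact: (measurable_int mu).
have mfT : measurable_fun [set: T] (f \o to_sub) by exact: measurableT_comp.
have intT : P.-integrable [set: T] (f \o to_sub).
  apply/integrableP; split => //.
  move/integrableP : int => [_]; apply: le_lt_trans.
  by rewrite (ge0_integral_pushforward mto_sub)//; exact: measurableT_comp.
exists (fine \o f); split.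
- exact: measurableT_comp.
- rewrite /integrable_rv (_ : _ \o _ = f \o to_sub)//.
  by apply/funext => w /=; rewrite fineK.
- move=> A GA; have mA : measurable (A : set TG) by rewrite mG.
  under eq_integral do rewrite fineK//.
  transitivity (nu A) => //; rewrite eqn// (integral_pushforward mto_sub)//.
  by apply: integrableS intT => //; exact: GT.
Qed.

Lemma cond_expP (X : T -> R) : integrable_rv P X ->
  is_cond_exp P G X (cond_exp P G X).
Proof.
move=> iX; rewrite /cond_exp; case: xgetP => [Y -> //|].
by have [Y hY] := cond_exp_exists iX; move=> /(_ Y).
Qed.

End cond_exp_existence.

(* The index of a sequence (xi_i, F_i)_{i = 0, ..., n} is a nat; values at
   indices beyond n are irrelevant. *)
Record martingale_differences d (T : measurableType d) (R : realType)
    (P : probability T R) (n : nat) (xi : nat -> T -> R)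
    (F : nat -> set (set T)) : Prop := MartingaleDifferences {
  md_sigma : forall i, (i <= n)%N -> sigma_algebra setT (F i) ;
  md_F0 : F 0%N = [set set0; setT] ;
  md_incr : forall i, (i < n)%N -> F i `<=` F i.+1 ;
  md_sub : F n `<=` measurable ;
  md_adapted : forall i, (i <= n)%N -> measurable_wrt (F i) (xi i) ;
  md_sqr_int : forall i, (i <= n)%N -> integrable_rv P (fun w => xi i w ^+ 2) ;
  md_xi0 : \forall w \ae P, xi 0%N w = 0 ;
  md_centered : forall i, (1 <= i <= n)%N ->
    \forall w \ae P, cond_exp P (F i.-1) (xi i) w = 0 }.

Definition mart_sum d (T : measurableType d) (R : realType)
    (xi : nat -> T -> R) (n : nat) (w : T) : R :=
  \sum_(1 <= i < n.+1) xi i w.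

Definition quad_char d (T : measurableType d) (R : realType)
    (P : probability T R) (xi : nat -> T -> R) (F : nat -> set (set T))
    (n : nat) (w : T) : R :=
  \sum_(1 <= i < n.+1) cond_exp P (F i.-1) (fun v => xi i v ^+ 2) w.

Definition cond_A1 d (T : measurableType d) (R : realType)
    (P : probability T R) (n : nat) (xi : nat -> T -> R)
    (F : nat -> set (set T)) (eps : R) : Prop :=
  forall k i : nat, (3 <= k)%N -> (1 <= i <= n)%N ->
    integrable_rv P (fun w => xi i w ^+ k) /\
    \forall w \ae P,
      `|cond_exp P (F i.-1) (fun v => xi i v ^+ k) w| <=
        2^-1 * k`!%:R * eps ^+ (k - 2)
          * cond_exp P (F i.-1) (fun v => xi i v ^+ 2) w.

Definition cond_A2 d (T : measurableType d) (R : realType)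
    (P : probability T R) (n : nat) (xi : nat -> T -> R)
    (F : nat -> set (set T)) (delta : R) : Prop :=
  \forall w \ae P, `|quad_char P xi F n w - 1| <= delta ^+ 2.

Definition Phi (R : realType) (x : R) : R :=
  (Num.sqrt (2 * pi))^-1 *
  \int[lebesgue_measure]_(t in `]-oo, x]) expR (- t ^+ 2 / 2).

Lemma Phi_normal_prob (R : realType) (x : R) :
  Phi x = fine (normal_prob 0 1 `]-oo, x]).
Proof.
rewrite /Phi -RintegralZl//=; last first.
  have ip := @integrable_normal_pdf R 0 1.
  have : lebesgue_measure.-integrable `]-oo, x]
      (fun t : R => ((Num.sqrt (2 * pi))%:E * (normal_pdf 0 1 t)%:E)%E).
    by apply: integrableZl => //; exact: integrableS ip.
  apply: eq_integrable => // t _ /=.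
  rewrite -EFinM normal_pdfE ?oner_eq0// /normal_peak /normal_fun.
  rewrite expr1n mul1r subr0 mulr_natl mulrA divff ?mul1r//.
  by rewrite gt_eqF// sqrtr_gt0 mulrn_wgt0// pi_gt0.
congr fine; apply: eq_integral => t _.
rewrite normal_pdfE ?oner_eq0// /normal_peak /normal_fun.
by rewrite expr1n mul1r subr0 mulr_natl.
Qed.

(* Main.v *)
From HB Require Import structures.
Require Import Defs.
From mathcomp Require Import all_boot all_order all_algebra.
From mathcomp Require Import all_classical all_reals all_analysis.
From mathcomp Require Import measurable_realfun.
From mathcomp Require Import ring lra.

Import Order.TTheory GRing.Theory Num.Theory.
Import numFieldNormedType.Exports.

Local Open Scope classical_set_scope.
Local Open Scope ring_scope.

Set Implicit Arguments.
Unset Strict Implicit.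
Unset Printing Implicit Defensive.

(** Let [X_k] be the walk, [V_k] the conditional variance still to come after step
    [k], and [u = X_k - x], [w = V_k].  For Gaussian increments [Phi (u / sqrt w)]
    would be a martingale ending at the indicator of [X_n > x], because it
    solves the heat equation (derivative in [w] equal to half the second derivative
    in [u]).  For the present increments each step has, per unit of conditional
    variance, an error of order [eps] times a third derivative.  The proof replaces
    the exact solution by a strict supersolution, the barrier

      [Phi (u / sqrt w) + (b + a ln (w / gam^2)) bump u w + (d + e w) fat x u w],

    whose surplus pays for this error.  The kernel [bump] is the Gaussian kernel,
    and [fat] has the same exponential tilt with a heavy-tailed profile, so that it
    dominates the derivatives of all three terms and still does so after a shift by
    an increment.

    The terms of the error that carry a power of [1 / sqrt w] or the factors
    [eps x^2] and [eps x^3 (b + a ln)] are paid by the heat operator ([barw_ge],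
    [error_absorbed]); the term [eps x^3 (d + e w) fat] is paid by an exponential factor
    with rate [kap] of order [x^3 eps].  Hence [exp (kap V_k) * barrier (X_k - x) V_k] is
    a supermartingale ([barrier_taylor], [barrier_step], [drift_le]).  The walk starts
    with [V_0 = 1 + delta^2 + gam^2], where [gam] is a multiple of [eps + delta], so that
    [V_n] stays between [gam^2] and [3 gam^2] and the barrier ends above the indicator
    ([barrier_final]).  Its starting value therefore bounds the tail
    ([tail_le_barrier]).

    With the tilt equal to [x], the starting value exceeds [Phi (- x)] by a quantity
    that is small compared with [exp (- x^2 / 2)], hence with [(1 + x) Phi (- x)]
    ([barrier_start_le], [expR_le_tail], [start_value_bound]); the coefficient
    [a ln (w / gam^2)] of the bump, needed where [fat] fails to be a supersolution,
    produces [eps |ln eps|].  The argument asks for [x eps <= 1/16]; beyond that,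
    [x^3 eps] exceeds a multiple of [x^2] and the claimed bound exceeds
    [1 / Phi (- x)] ([trivial_range]).

    The Bernstein condition enters through two consequences.  Its case [k = 4]
    bounds the conditional variances by [12 eps^2] ([cond_variance_le]), and its even
    cases bound the conditional mean of [xi^2 cosh (xi / (4 eps))] by a multiple of the
    conditional variance ([cosh_moment]).  Conditional statements are used in
    integrated form, against nonnegative weights measurable with respect to the past
    ([weighted_integral_le]).  Since only even moments and the centering occur, the
    lower tail follows by changing the sign of the increments. *)

(** * Mean value and Taylor estimates *)

Section taylor.
Variable R : realType.
Implicit Types (f : R -> R) (a b x B : R).

Lemma mvt f f1 a b : a <= b ->
    (forall t, a <= t <= b -> is_derive t 1 f (f1 t)) ->
  exists2 c, a <= c <= b & f b - f a = f1 c * (b - a).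
Proof.
move=> ab df; have [||c cab ->] := @MVT_segment R f f1 a b ab.
- by move=> t tab; apply: df; move: tab; rewrite in_itv/= => /andP[*]; rewrite !ltW.
- apply: derivable_within_continuous => t; rewrite in_itv/= => tab.
  by have [] := df t tab.
- by exists c => //; rewrite (itvP cab).
Qed.

Lemma mvt0 f f1 x : (forall t : R, is_derive t 1 f (f1 t)) ->
  exists2 c, `|c| <= `|x| & f x - f 0 = f1 c * x.
Proof.
move=> df; have [x0|x0] := leP 0 x.
- have [c /andP[c0 cx] E] := @mvt f f1 0 x x0 (fun t _ => df t).
  exists c; first by rewrite !ger0_norm.
  by rewrite E subr0.
- have [c /andP[xc c0] E] := @mvt f f1 x 0 (ltW x0) (fun t _ => df t).
  exists c; first by rewrite ler0_norm// ltr0_norm// lerN2.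
  by rewrite -opprB E sub0r mulrN opprK.
Qed.

Lemma taylor2_ge f f1 f2 a b B : a <= b ->
    (forall t, a <= t <= b -> is_derive t 1 f (f1 t)) ->
    (forall t, a <= t <= b -> is_derive t 1 f1 (f2 t)) ->
    (forall t, a <= t <= b -> `|f2 t| <= B) ->
  f a + f1 a * (b - a) - B * (b - a) ^+ 2 <= f b.
Proof.
move=> ab df df1 f2B.
have [c /andP[ac cb] E] := mvt ab df.
have [|e /andP[ae ec] E1] := @mvt f1 f2 a c ac.
  by move=> t /andP[at_ tc]; apply: df1; rewrite at_ (le_trans tc).
have /f2B : a <= e <= b by rewrite ae (le_trans ec).
rewrite ler_norml => /andP[Be _].
have -> : f b = f a + f1 a * (b - a) + f2 e * (c - a) * (b - a).
  by move: E E1; nra.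
rewrite lerD2l -mulNr expr2 mulrA ler_wpM2r ?subr_ge0//.
have B0 : 0 <= B by apply: le_trans (f2B a _); rewrite ?lexx.
rewrite (@le_trans _ _ (- B * (c - a)))// ?ler_wpM2r ?subr_ge0//.
by rewrite ler_wnM2l ?oppr_le0// lerD2r.
Qed.

Lemma taylor3_le f f1 f2 f3 x B :
    (forall t : R, is_derive t 1 f (f1 t)) ->
    (forall t : R, is_derive t 1 f1 (f2 t)) ->
    (forall t : R, is_derive t 1 f2 (f3 t)) ->
    (forall t, `|t| <= `|x| -> `|f3 t| <= B) ->
  f x <= f 0 + f1 0 * x + f2 0 / 2 * x ^+ 2 + B * `|x| ^+ 3.
Proof.
move=> df df1 df2 f3B.
pose g t := f t - f1 0 * t - f2 0 / 2 * t ^+ 2.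
pose g1 t := f1 t - f1 0 - f2 0 * t.
have dg (t : R) : is_derive t 1 g (g1 t).
  by apply: is_derive_eq; rewrite /g1 /GRing.scale/=; field.
have dg1 (t : R) : is_derive t 1 g1 (f2 t - f2 0).
  by apply: is_derive_eq; rewrite /GRing.scale/=; ring.
have [c cx E] := mvt0 x dg.
have [e ec E1] := mvt0 c dg1.
have [h he E2] := mvt0 e df2.
have g10 : g1 0 = 0 by rewrite /g1; ring.
move: E1; rewrite g10 subr0 => E1.
have -> : f x = f 0 + f1 0 * x + f2 0 / 2 * x ^+ 2 + f3 h * e * c * x.
  by rewrite -E2 -E1 -E /g; field.
rewrite lerD2l (le_trans (ler_norm _))// !normrM.
have hx : `|h| <= `|x| by rewrite (le_trans he)// (le_trans ec).
have := f3B h hx => hB.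
by rewrite !exprS expr0 mulr1 !mulrA !ler_pM ?mulr_ge0// (le_trans ec).
Qed.

Lemma derive_le0_le f f1 a b : a <= b ->
    (forall t, a <= t <= b -> is_derive t 1 f (f1 t)) ->
    (forall t, a <= t <= b -> f1 t <= 0) -> f b <= f a.
Proof.
move=> ab df f10; have [c /f10 c0] := mvt ab df.
by move=> E; rewrite -subr_le0 E mulr_le0_ge0// subr_ge0.
Qed.

End taylor.

(** * The normal distribution function *)

Section normal.
Variable R : realType.
Implicit Types x y z w u : R.

Definition nrm : R := (Num.sqrt (2 * pi))^-1.

Lemma nrm_gt0 : 0 < nrm.
Proof. by rewrite invr_gt0 sqrtr_gt0 mulr_gt0// pi_gt0. Qed.

Lemma nrm_le1 : nrm <= 1.
Proof.
rewrite invf_le1 ?sqrtr_gt0 ?mulr_gt0 ?pi_gt0// -[leLHS]sqrtr1 ler_sqrt.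
  by have := @pi_ge2 R; lra.
by rewrite mulr_ge0// pi_ge0.
Qed.

Let normal_pdf01 (t : R) : normal_pdf 0 1 t = nrm * expR (- t ^+ 2 / 2).
Proof.
rewrite normal_pdfE ?oner_eq0// /normal_peak /normal_fun /nrm.
by rewrite expr1n mul1r subr0 !mulr_natl.
Qed.

Lemma Phi_pdf x :
  Phi x = \int[lebesgue_measure]_(t in `]-oo, x]) normal_pdf 0 1 t.
Proof. by rewrite Phi_normal_prob. Qed.

Global Instance is_derive1_Phi x :
  is_derive x 1 (@Phi R) (nrm * expR (- x ^+ 2 / 2)).
Proof.
have [||||dF F'] := @continuous_FTC1 R (normal_pdf 0 1) -oo%O x (x + 1).
- by rewrite ltrDl.
- by apply: integrableS (@integrable_normal_pdf R 0 1).
- by rewrite ltNyr.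
- exact: (@continuous_normal_pdf R 0 1 (oner_neq0 R)).
move: F'; rewrite derive1E normal_pdf01 => F'.
have -> : @Phi R =
    fun x => \int[lebesgue_measure]_(t in `]-oo, x]) normal_pdf 0 1 t.
  by apply/funext => y; exact: Phi_pdf.
exact: DeriveDef dF F'.
Qed.

Lemma Phi_ge0 x : 0 <= Phi x.
Proof. by rewrite Phi_normal_prob fine_ge0. Qed.

Lemma Phi_le1 x : Phi x <= 1.
Proof.
rewrite Phi_normal_prob -lee_fin fineK; first exact: probability_le1.
by rewrite fin_num_measure.
Qed.

Let idR : measurableTypeR R -> R := idfun.
HB.instance Definition _ :=
  @isMeasurableFun.Build _ _ _ _ idR (@measurable_id _ _ setT).
Let X : {RV (normal_prob 0 1 : probability (measurableTypeR R) R) >-> R} := idR.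

Let PhiX : EFin \o @Phi R = cdf X.
Proof.
apply/funext => x /=; rewrite Phi_normal_prob fineK; last by rewrite fin_num_measure.
by [].
Qed.

Lemma Phi_cvgy : Phi x @[x --> +oo] --> (1 : R).
Proof. by have := @cvg_cdfy1 _ _ _ _ X; rewrite -PhiX => /fine_cvg. Qed.

Lemma Phi_cvgNy : Phi x @[x --> -oo] --> (0 : R).
Proof. by have := @cvg_cdfNy0 _ _ _ _ X; rewrite -PhiX => /fine_cvg. Qed.

(** [Phi y + Phi (- y)] has derivative [0] because the density is even, and it
    tends to [1] at infinity. *)
Lemma PhiN x : Phi (- x) = 1 - Phi x.
Proof.
pose f := fun y : R => Phi y + Phi (- y).
have df (y : R) : is_derive y 1 f 0.
  apply: is_derive_eq; rewrite sqrrN /GRing.scale/=; ring.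
have fE y : f y = f x by exact: is_derive_0_is_cst.
have cf : f y @[y --> +oo] --> (1 + 0 : R).
  apply: cvgD; first exact: Phi_cvgy.
  by have := Phi_cvgNy; rewrite cvgNy_compNP.
have /cvg_lim : f y @[y --> +oo] --> f x.
  by under eq_cvg do rewrite fE; exact: cvg_cst.
move: cf => /cvg_lim -> // /(_ (@Rhausdorff R)); rewrite /f => H.
by move: H; lra.
Qed.

Lemma Phi_increment x y : 0 <= x -> x <= y ->
  Phi y - Phi x <= (y - x) * expR (- x ^+ 2 / 2).
Proof.
move=> x0 xy.
have [c /andP[xc cy] ->] := mvt xy (fun t _ => is_derive1_Phi t).
rewrite mulrC ler_wpM2l ?subr_ge0// -[leRHS]mul1r ler_pM ?(ltW nrm_gt0) ?expR_ge0 ?nrm_le1//.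
by rewrite ler_expR ler_pM2r ?invr_gt0// lerN2 ler_pXn2r ?nnegrE// (le_trans x0).
Qed.

(** The mean value theorem on an interval of length [1/(1+x)], over which the
    density loses at most a constant factor. *)
Lemma PhiN_ge x : 0 <= x ->
  nrm * expR (- 2) * expR (- x ^+ 2 / 2) <= (1 + x) * Phi (- x).
Proof.
move=> x0; have x1 : 0 < 1 + x by lra.
have xy : x <= x + (1 + x)^-1 by rewrite lerDl invr_ge0 ltW.
have [c /andP[xc cy] E] := mvt xy (fun t _ => is_derive1_Phi t).
have {}E : Phi (x + (1 + x)^-1) - Phi x = nrm * expR (- c ^+ 2 / 2) / (1 + x).
  by rewrite E addrAC subrr add0r.
suff : nrm * expR (- 2) * expR (- x ^+ 2 / 2) / (1 + x) <= 1 - Phi x.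
  by rewrite PhiN ler_pdivrMr// [leRHS]mulrC.
apply: (@le_trans _ _ (Phi (x + (1 + x)^-1) - Phi x)).
  rewrite E ler_pM2r ?invr_gt0// -mulrA ler_pM2l ?nrm_gt0// -expRD ler_expR.
  have xx : x * (1 + x)^-1 <= 1 by rewrite ler_pdivrMr//; lra.
  have xi : (1 + x)^-1 <= 1 by rewrite invf_le1//; lra.
  have xi0 : 0 <= (1 + x)^-1 by rewrite invr_ge0 ltW.
  have : c ^+ 2 <= (x + (1 + x)^-1) ^+ 2.
    by rewrite ler_pXn2r ?nnegrE//; [exact: le_trans xc|lra].
  by nra.
by have := Phi_le1 (x + (1 + x)^-1); lra.
Qed.

Lemma PhiN_gt0 x : 0 <= x -> 0 < Phi (- x).
Proof.
move=> x0; have x1 : 0 < 1 + x by lra.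
rewrite -(pmulr_rgt0 _ x1); apply: lt_le_trans (PhiN_ge x0).
by rewrite !mulr_gt0 ?nrm_gt0 ?expR_gt0.
Qed.

Lemma expR_half_lt2 : expR (2^-1 : R) <= 2.
Proof.
have := @expR_ge1Dx R (- 2^-1); rewrite expRN.
have e0 := @expR_gt0 R (2^-1).
move=> h; have : (1 - 2^-1) * expR (2^-1 : R) <= 1.
  by rewrite -ler_pdivlMr// mul1r.
by lra.
Qed.

(** For [1 <= x] the function [Phi + 2 exp (-x^2/2)] decreases to its limit
    [1] at infinity; below [1] its second term alone exceeds [1]. *)
Lemma Phi_ge1 x : 0 <= x -> 1 <= Phi x + 2 * expR (- x ^+ 2 / 2).
Proof.
move=> x0; have [x1|x1] := leP x 1.
  apply: (@le_trans _ _ (2 * expR (- x ^+ 2 / 2))); last by rewrite lerDr Phi_ge0.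
  have : (expR 2^-1)^-1 <= expR (- x ^+ 2 / 2).
    by rewrite -expRN ler_expR; nra.
  suff : 2^-1 <= (expR 2^-1 : R)^-1 by lra.
  by rewrite lef_pV2 ?posrE ?expR_gt0// expR_half_lt2.
pose f y := Phi y + 2 * expR (- y ^+ 2 / 2).
have df (y : R) : is_derive y 1 f ((nrm - 2 * y) * expR (- y ^+ 2 / 2)).
  by apply: is_derive_eq; rewrite /GRing.scale/=; field.
suff : forall y, x <= y -> Phi y <= f x.
  move=> h; have L : lim (@Phi R y @[y --> +oo]) = 1.
    by apply/cvg_lim; [exact: Rhausdorff|exact: Phi_cvgy].
  rewrite -[leLHS]L; apply: limr_le; first by apply/cvg_ex; exists 1; exact: Phi_cvgy.
  by near=> y; apply: h; near: y; apply: nbhs_pinfty_ge; exact: num_real.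
move=> y xy; apply: (@le_trans _ _ (f y)); first by rewrite lerDl mulr_ge0 ?expR_ge0.
apply: (derive_le0_le xy (fun t _ => df t)) => t /andP[xt ty].
by rewrite mulr_le0_ge0 ?expR_ge0//; have := nrm_le1; lra.
Unshelve. all: by end_near. Qed.

End normal.

(** * The Gaussian kernel and its tilted companion *)

Section kernels.
Variable R : realType.
Implicit Types u w y t : R.

Definition rs w : R := (Num.sqrt w)^-1.

Lemma rs_gt0 w : 0 < w -> 0 < rs w.
Proof. by move=> w0; rewrite invr_gt0 sqrtr_gt0. Qed.

Lemma rs_sqr w : 0 < w -> rs w ^+ 2 = w^-1.
Proof. by move=> w0; rewrite exprVn sqr_sqrtr// ltW. Qed.

Lemma is_derive1_rs w : 0 < w -> is_derive w 1 rs (- rs w / (2 * w)).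
Proof.
move=> w0; have s0 : Num.sqrt w != 0 by rewrite gt_eqF// sqrtr_gt0.
have dV := @is_deriveV R Num.sqrt w _ 1 s0 (is_derive1_sqrt w0).
apply: (is_derive_eq dV); rewrite /GRing.scale/= /rs.
have -> : 2 * w = 2 * Num.sqrt w ^+ 2 by rewrite sqr_sqrtr// ltW.
by field.
Qed.

(** Up to the factor [sqrt (2 pi)], the heat kernel at time [w]; the polynomial
    factors of its derivatives in [u] are Hermite polynomials. *)
Definition bump u w : R := rs w * expR (- (u ^+ 2 / (2 * w))).
Definition bump1 u w : R := - (u / w) * bump u w.
Definition bump2 u w : R := ((u / w) ^+ 2 - w^-1) * bump u w.
Definition bump3 u w : R := (3 * (u / w) / w - (u / w) ^+ 3) * bump u w.
Definition bump4 u w : R :=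
  ((u / w) ^+ 4 - 6 * (u / w) ^+ 2 / w + 3 * w^-1 ^+ 2) * bump u w.

Section fixed_w.
Variables (w : R) (w0 : 0 < w).
Let wN0 : w != 0. Proof. by rewrite gt_eqF. Qed.
Let w2N0 : 2 * w != 0. Proof. by rewrite mulf_neq0// wN0. Qed.

Lemma bump_ge0 u : 0 <= bump u w.
Proof. by rewrite mulr_ge0 ?expR_ge0 ?(ltW (rs_gt0 w0)). Qed.

Lemma dbump u : is_derive u 1 (bump^~ w) (bump1 u w).
Proof. by apply: is_derive_eq; rewrite /GRing.scale/= /bump1 /bump; field. Qed.

Lemma dbump1 u : is_derive u 1 (bump1^~ w) (bump2 u w).
Proof.
have := dbump u => ?.
by apply: is_derive_eq; rewrite /GRing.scale/= /bump2 /bump1; field.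
Qed.

Lemma dbump2 u : is_derive u 1 (bump2^~ w) (bump3 u w).
Proof.
have := dbump u => ?.
by apply: is_derive_eq; rewrite /GRing.scale/= /bump3 /bump1; field.
Qed.

Lemma dPhi_rs u : is_derive u 1 (fun t => Phi (t * rs w)) (nrm R * bump u w).
Proof.
have -> : nrm R * bump u w = nrm R * expR (- (u * rs w) ^+ 2 / 2) * rs w.
  rewrite exprMn rs_sqr// /bump.
  have -> : - (u ^+ 2 / w) / 2 = - (u ^+ 2 / (2 * w)) by field.
  by ring.
apply: is_derive1_comp; apply: is_derive_eq.
by rewrite /GRing.scale/=; ring.
Qed.

Lemma dwbump u : is_derive w 1 (bump u) (bump2 u w / 2).
Proof.
have := is_derive1_rs w0 => ?.
have ? : is_derive w 1 (fun t => (2 * t)^-1) (- (2 * w ^+ 2)^-1).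
  by apply: is_derive_eq; rewrite /GRing.scale/=; field.
by apply: is_derive_eq; rewrite /GRing.scale/= /bump2 /bump; field.
Qed.

Let dinv : is_derive w 1 (fun t : R => t^-1) (- (w ^+ 2)^-1).
Proof.
apply: (is_derive_eq (@is_deriveV R id w _ 1 wN0 (is_derive_id _ _))).
by rewrite /GRing.scale/= mulr1.
Qed.

Lemma dwbump1 u : is_derive w 1 (bump1 u) (bump3 u w / 2).
Proof.
have := dwbump u; have := dinv => ? ?.
by apply: is_derive_eq; rewrite /GRing.scale/= /bump2 /bump3; field.
Qed.

Lemma dwbump2 u : is_derive w 1 (bump2 u) (bump4 u w / 2).
Proof.
have := dwbump u; have := dinv => ? ?.
by apply: is_derive_eq; rewrite /GRing.scale/= /bump2 /bump4; field.
Qed.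

Lemma dwPhi_rs u : is_derive w 1 (fun t => Phi (u * rs t)) (nrm R * bump1 u w / 2).
Proof.
have -> : nrm R * bump1 u w / 2 =
   nrm R * expR (- (u * rs w) ^+ 2 / 2) * (u * (- rs w / (2 * w))).
  rewrite exprMn rs_sqr// /bump1 /bump.
  have -> : - (u ^+ 2 / w) / 2 = - (u ^+ 2 / (2 * w)) by field.
  by field.
have := is_derive1_rs w0 => ?.
by apply: is_derive1_comp; apply: is_derive_eq.
Qed.

End fixed_w.

Variable lam : R.
Hypothesis lam0 : 0 <= lam.

(** Put [z = (u + lam w) / sqrt w].  Then [bump] and [fat] have a factor in common,
    the tilt [exp (lam u + lam^2 w / 2) / sqrt w]; the other factor is
    [exp (- z^2 / 2)] for [bump] and [1 / (1 + z^2) = w / den] for [fat].  So [fat]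
    dominates [bump] and its derivatives, up to powers of [lam] and [1 / sqrt w], and
    a shift of [u] changes its heavy profile only by a polynomial factor.  The logarithmic derivatives
    of [fat] are [ell] in [u] and [enn] in [w]. *)
Definition den u w : R := w + (u + lam * w) ^+ 2.
Definition fat u w : R :=
  expR (lam * u + lam ^+ 2 * w / 2) * rs w * (w / den u w).
Definition ell u w : R := lam - 2 * (u + lam * w) / den u w.
Definition ell1 u w : R :=
  - 2 / den u w + 4 * ((u + lam * w) / den u w) ^+ 2.
Definition ell2 u w : R :=
  12 * (u + lam * w) / den u w ^+ 2 - 16 * ((u + lam * w) / den u w) ^+ 3.
Definition fat1 u w : R := ell u w * fat u w.
Definition fat2 u w : R := (ell u w ^+ 2 + ell1 u w) * fat u w.
Definition fat3 u w : R :=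
  (ell u w ^+ 3 + 3 * ell u w * ell1 u w + ell2 u w) * fat u w.
Definition enn u w : R :=
  lam ^+ 2 / 2 + (2 * w)^-1 - (1 + 2 * lam * (u + lam * w)) / den u w.
Definition enn1 u w : R :=
  - (2 * w ^+ 2)^-1 - 2 * lam ^+ 2 / den u w
    + ((1 + 2 * lam * (u + lam * w)) / den u w) ^+ 2.
Definition fatw u w : R := enn u w * fat u w.
Definition fatww u w : R := (enn u w ^+ 2 + enn1 u w) * fat u w.
(** The cost of one derivative in [u]: [lam] for the tilt, [1 / sqrt w] for the
    width of the kernels. *)
Definition tau w : R := lam + rs w.

Section fixed_w.
Variables (w : R) (w0 : 0 < w).
Let wN0 : w != 0. Proof. by rewrite gt_eqF. Qed.
Let w2N0 : 2 * w != 0. Proof. by rewrite mulf_neq0// wN0. Qed.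

Lemma den_gt0 u : 0 < den u w.
Proof. by rewrite ltr_wpDr ?sqr_ge0. Qed.

Let denN0 u : den u w != 0. Proof. by rewrite gt_eqF ?den_gt0. Qed.

Lemma fat_gt0 u : 0 < fat u w.
Proof. by rewrite !mulr_gt0 ?expR_gt0 ?rs_gt0 ?invr_gt0 ?den_gt0. Qed.

Let ddenV u : is_derive u 1 (fun t => (den t w)^-1)
   (- 2 * (u + lam * w) / den u w ^+ 2).
Proof.
have ? : is_derive u 1 (den^~ w) (2 * (u + lam * w)).
  by apply: is_derive_eq; rewrite /GRing.scale/=; ring.
apply: (is_derive_eq (@is_deriveV R (den^~ w) u _ 1 (denN0 u) _)).
by rewrite /GRing.scale/=; field; exact: denN0.
Qed.

Lemma dfat u : is_derive u 1 (fat^~ w) (fat1 u w).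
Proof.
have := ddenV u => ?.
apply: is_derive_eq; rewrite /GRing.scale/= /fat1 /ell /fat; field.
exact: denN0.
Qed.

Lemma dell u : is_derive u 1 (ell^~ w) (ell1 u w).
Proof.
have := ddenV u => ?.
apply: is_derive_eq; rewrite /GRing.scale/= /ell1; field.
exact: denN0.
Qed.

Lemma dell1 u : is_derive u 1 (ell1^~ w) (ell2 u w).
Proof.
have := ddenV u => ?.
apply: is_derive_eq; rewrite /GRing.scale/= /ell2; field.
exact: denN0.
Qed.

Lemma dfat1 u : is_derive u 1 (fat1^~ w) (fat2 u w).
Proof.
have := dfat u; have := dell u => ? ?.
by apply: is_derive_eq; rewrite /GRing.scale/= /fat1 /fat2; ring.
Qed.

Lemma dfat2 u : is_derive u 1 (fat2^~ w) (fat3 u w).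
Proof.
have := dfat u; have := dell u; have := dell1 u => ? ? ?.
by apply: is_derive_eq; rewrite /GRing.scale/= /fat1 /fat3; ring.
Qed.

Let dwdenV u : is_derive w 1 (fun t => (den u t)^-1)
   (- (1 + 2 * lam * (u + lam * w)) / den u w ^+ 2).
Proof.
have ? : is_derive w 1 (den u) (1 + 2 * lam * (u + lam * w)).
  by apply: is_derive_eq; rewrite /GRing.scale/=; ring.
apply: (is_derive_eq (is_deriveV (denN0 u) _)).
by rewrite /GRing.scale/=; field; exact: denN0.
Qed.

Lemma dwfat u : is_derive w 1 (fat u) (fatw u w).
Proof.
have := dwdenV u; have := is_derive1_rs w0 => ? ?.
apply: is_derive_eq; rewrite /GRing.scale/= /fatw /enn /fat; field.
by rewrite wN0 denN0.
Qed.

Lemma denn u : is_derive w 1 (enn u) (enn1 u w).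
Proof.
have := dwdenV u => ?.
have ? : is_derive w 1 (fun t => (2 * t)^-1) (- (2 * w ^+ 2)^-1).
  by apply: is_derive_eq; rewrite /GRing.scale/=; field.
apply: is_derive_eq; rewrite /GRing.scale/= /enn1; field.
by rewrite wN0 denN0.
Qed.

Lemma dwfatw u : is_derive w 1 (fatw u) (fatww u w).
Proof.
have := dwfat u; have := denn u => ? ?.
by apply: is_derive_eq; rewrite /GRing.scale/= /fatw /fatww; ring.
Qed.

(** The defect of [fat] in the heat equation is
    [(1/2 - 4 z^2 / (1 + z^2)^2) fat / w]: a source, except for [|z|] of order one. *)
Lemma fat_heat u : fatw u w =
  fat2 u w / 2 + ((2 * w)^-1 - 4 * ((u + lam * w) / den u w) ^+ 2) * fat u w.
Proof.
suff E : enn u w = (ell u w ^+ 2 + ell1 u w) / 2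
    + ((2 * w)^-1 - 4 * ((u + lam * w) / den u w) ^+ 2).
  by rewrite /fatw E /fat2; ring.
have := denN0 u; rewrite /enn /ell /ell1 /den => d0; field.
by rewrite d0 wN0.
Qed.

End fixed_w.
End kernels.

(** * Bounds on the kernels *)

Section norm_bounds.
Variable R : realDomainType.
Implicit Types a b A B : R.

Lemma normM_le a b A B : `|a| <= A -> `|b| <= B -> `|a * b| <= A * B.
Proof. by move=> aA bB; rewrite normrM ler_pM. Qed.

Lemma normD_le a b A B : `|a| <= A -> `|b| <= B -> `|a + b| <= A + B.
Proof. by move=> aA bB; rewrite (le_trans (ler_normD _ _))// lerD. Qed.

Lemma normB_le a b A B : `|a| <= A -> `|b| <= B -> `|a - b| <= A + B.
Proof. by move=> aA bB; rewrite (le_trans (ler_normB _ _))// lerD. Qed.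

Lemma normX_le a A n : `|a| <= A -> `|a ^+ n| <= A ^+ n.
Proof. by move=> aA; rewrite normrX lerXn2r// nnegrE// (le_trans _ aA). Qed.

End norm_bounds.

Section kernel_bounds.
Variable R : realType.
Implicit Types u w y t : R.
Variable lam : R.
Hypothesis lam0 : 0 <= lam.

Section fixed_w.
Variables (w : R) (w0 : 0 < w).
Let wN0 : w != 0. Proof. by rewrite gt_eqF. Qed.
Let r := rs w.
Let r0 : 0 < r. Proof. exact: rs_gt0. Qed.
Let wr : w * r ^+ 2 = 1. Proof. by rewrite rs_sqr// divff. Qed.
Let d u := den lam u w.
Let d0 u : 0 < d u. Proof. exact: den_gt0. Qed.
Let t := tau lam w.

Lemma tau_gt0 : 0 < t.
Proof. by rewrite ltr_wpDl. Qed.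

Let rt : r <= t. Proof. by rewrite /t /tau lerDr. Qed.
Let lt : lam <= t. Proof. by rewrite /t /tau lerDl ltW. Qed.

Let rXt n : r ^+ n <= t ^+ n.
Proof. by rewrite lerXn2r// ?nnegrE ltW// tau_gt0. Qed.

Lemma invw_le_tau : w^-1 <= t ^+ 2.
Proof. by rewrite -rs_sqr. Qed.


(** In terms of [z], this is [2 |z| <= 1 + z^2]. *)
Lemma y_den_le u : `|(u + lam * w) / d u| <= r / 2.
Proof.
set y := u + lam * w.
rewrite normrM normfV [`|d u|]gtr0_norm// ler_pdivrMr//.
rewrite -(ler_pM2l r0) /d /den -/y.
have -> : r * (r / 2 * (w + y ^+ 2)) = (w * r ^+ 2 + (r * y) ^+ 2) / 2 by field.
rewrite wr -[in leLHS](gtr0_norm r0) -normrM.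
have : `|r * y| ^+ 2 = (r * y) ^+ 2 by rewrite -normrX ger0_norm// sqr_ge0.
by have := sqr_ge0 (`|r * y| - 1); nra.
Qed.

Let di u : `|(d u)^-1| <= r ^+ 2.
Proof.
rewrite ger0_norm ?invr_ge0 ?(ltW (d0 u))// rs_sqr// lef_pV2 ?posrE//.
by rewrite /d /den lerDl sqr_ge0.
Qed.

Lemma ell_le u : `|ell lam u w| <= t.
Proof.
rewrite /ell -mulrA; apply: le_trans (normB_le (A := lam) (B := 2 * (r / 2)) _ _) _.
- by rewrite ger0_norm.
- by apply: normM_le (y_den_le u); rewrite normr_nat.
- by rewrite /t /tau -/r; lra.
Qed.

Lemma ell1_le u : `|ell1 lam u w| <= 3 * t ^+ 2.
Proof.
apply: le_trans (normD_le (A := 2 * r ^+ 2) (B := 4 * (r / 2) ^+ 2) _ _) _.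
- by apply: normM_le (di u); rewrite normrN normr_nat.
- by apply: normM_le; [rewrite normr_nat|apply: normX_le; exact: y_den_le].
- by have := rXt 2; nra.
Qed.

Lemma ell2_le u : `|ell2 lam u w| <= 8 * t ^+ 3.
Proof.
rewrite /ell2; have -> : 12 * (u + lam * w) / den lam u w ^+ 2 =
  12 * ((u + lam * w) / d u) * (d u)^-1.
  by rewrite /d; field; rewrite gt_eqF//; exact: d0.
apply: le_trans (normB_le (A := 12 * (r / 2) * r ^+ 2) (B := 16 * (r / 2) ^+ 3) _ _) _.
- by apply: normM_le (di u); apply: normM_le; [rewrite normr_nat|exact: y_den_le].
- by apply: normM_le; [rewrite normr_nat|apply: normX_le; exact: y_den_le].
- apply: le_trans (_ : 8 * r ^+ 3 <= _); last by rewrite ler_pM2l.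
  by have -> : 12 * (r / 2) * r ^+ 2 + 16 * (r / 2) ^+ 3 = 8 * r ^+ 3 by field.
Qed.

Let fatn u : `|fat lam u w| <= fat lam u w.
Proof. by rewrite ger0_norm// ltW// fat_gt0. Qed.

Let t0 := ltW tau_gt0.

Lemma fat1_le u : `|fat1 lam u w| <= t * fat lam u w.
Proof. exact: normM_le (ell_le u) (fatn u). Qed.

Lemma fat2_le u : `|fat2 lam u w| <= 4 * t ^+ 2 * fat lam u w.
Proof.
apply: normM_le (fatn u).
have -> : 4 * t ^+ 2 = t ^+ 2 + 3 * t ^+ 2 by ring.
exact: normD_le (normX_le _ (ell_le u)) (ell1_le u).
Qed.

Lemma fat3_le u : `|fat3 lam u w| <= 18 * t ^+ 3 * fat lam u w.
Proof.
apply: normM_le (fatn u).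
have -> : 18 * t ^+ 3 = t ^+ 3 + 3 * t * (3 * t ^+ 2) + 8 * t ^+ 3 by ring.
apply: normD_le (ell2_le u); apply: normD_le (normX_le _ (ell_le u)) _.
apply: normM_le (ell1_le u); apply: normM_le (ell_le u).
by rewrite normr_nat.
Qed.

Lemma enn_le u : `|enn lam u w| <= 2 * t ^+ 2.
Proof.
rewrite /enn; have -> : (1 + 2 * lam * (u + lam * w)) / den lam u w =
  (d u)^-1 + 2 * lam * ((u + lam * w) / d u).
  by rewrite /d; field; rewrite gt_eqF//; exact: d0.
have -> : (2 * w)^-1 = r ^+ 2 / 2 by rewrite rs_sqr//; field.
apply: le_trans (normB_le (A := lam ^+ 2 / 2 + r ^+ 2 / 2)
  (B := r ^+ 2 + 2 * lam * (r / 2)) _ _) _.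
- by rewrite ger0_norm// addr_ge0// divr_ge0// sqr_ge0.
- apply: normD_le (di u) _; apply: normM_le (y_den_le u).
  by rewrite ger0_norm// mulr_ge0.
- by rewrite /t /tau -/r; have := mulr_ge0 lam0 (ltW r0); nra.
Qed.

Lemma enn1_le u : `|enn1 lam u w| <= 4 * t ^+ 4.
Proof.
rewrite /enn1; have -> : (1 + 2 * lam * (u + lam * w)) / den lam u w =
  (d u)^-1 + 2 * lam * ((u + lam * w) / d u).
  by rewrite /d; field; rewrite gt_eqF//; exact: d0.
have -> : (2 * w ^+ 2)^-1 = (r ^+ 2) ^+ 2 / 2 by rewrite rs_sqr//; field.
apply: le_trans (normD_le (A := (r ^+ 2) ^+ 2 / 2 + 2 * lam ^+ 2 * r ^+ 2)
  (B := (r ^+ 2 + 2 * lam * (r / 2)) ^+ 2) _ _) _.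
- apply: normB_le; first by rewrite normrN ger0_norm// divr_ge0// sqr_ge0.
  by apply: normM_le (di u); rewrite ger0_norm// mulr_ge0// sqr_ge0.
- apply: normX_le; apply: normD_le (di u) _; apply: normM_le (y_den_le u).
  by rewrite ger0_norm// mulr_ge0.
- rewrite /t /tau -/r -subr_ge0.
  have -> : 4 * (lam + r) ^+ 4 - ((r ^+ 2) ^+ 2 / 2 + 2 * lam ^+ 2 * r ^+ 2
     + (r ^+ 2 + 2 * lam * (r / 2)) ^+ 2) =
     4 * lam ^+ 4 + 16 * lam ^+ 3 * r + 21 * lam ^+ 2 * r ^+ 2
     + 14 * lam * r ^+ 3 + 5 / 2 * r ^+ 4 by field.
  by rewrite !addr_ge0 ?mulr_ge0 ?exprn_ge0 ?(ltW r0).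
Qed.

Lemma fatw_le u : `|fatw lam u w| <= 2 * t ^+ 2 * fat lam u w.
Proof. exact: normM_le (enn_le u) (fatn u). Qed.

Lemma fatww_le u : `|fatww lam u w| <= 8 * t ^+ 4 * fat lam u w.
Proof.
apply: normM_le (fatn u).
have -> : 8 * t ^+ 4 = (2 * t ^+ 2) ^+ 2 + 4 * t ^+ 4 by ring.
exact: normD_le (normX_le _ (enn_le u)) (enn1_le u).
Qed.

Let zz u := (u + lam * w) * r.

(** Completing the square brings out the tilt of the Gaussian kernel. *)
Lemma bump_tilt u : bump u w =
  expR (lam * u + lam ^+ 2 * w / 2) * r * expR (- (zz u ^+ 2 / 2)).
Proof.
rewrite /bump -/r [LHS]mulrC [RHS]mulrAC -expRD; congr (expR _ * _).
by rewrite /zz exprMn rs_sqr//; field.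
Qed.

Lemma fat_bump u : (1 + zz u ^+ 2) * expR (- (zz u ^+ 2 / 2)) * fat lam u w = bump u w.
Proof.
have E : (1 + zz u ^+ 2) * (w / den lam u w) = 1.
  have := d0 u; rewrite /d /zz exprMn rs_sqr// /den => d0'.
  by field; rewrite wN0 gt_eqF.
rewrite bump_tilt /fat -/r; move: E; move: (w / den lam u w) => q E.
set A := expR (lam * _ + _); set B := expR (- _).
transitivity ((1 + zz u ^+ 2) * q * (A * r * B)); last by rewrite E mul1r.
by move: (zz u) => z; ring.
Qed.

(** The power [4] pays for four derivatives of [bump], each of which brings a factor
    of order [1 + |z|].  The constant is [4 * 6^3 * 2], from [1 + y <= 6 exp (y / 6)]
    cubed and [exp (1/2) <= 2]. *)
Lemma poly_gauss_le (z : R) :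
  (1 + `|z|) ^+ 4 * ((1 + z ^+ 2) * expR (- (z ^+ 2 / 2))) <= 1728.
Proof.
have h1 : (1 + `|z|) ^+ 4 <= 4 * (1 + z ^+ 2) ^+ 2.
  have -> : 4 * (1 + z ^+ 2) ^+ 2 = (2 * (1 + z ^+ 2)) ^+ 2 by ring.
  rewrite -[4%N]/(2 * 2)%N exprM lerXn2r ?nnegrE ?sqr_ge0//.
    by rewrite mulr_ge0// addr_ge0// sqr_ge0.
  rewrite -[z ^+ 2]ger0_norm ?sqr_ge0// normrX.
  by have := sqr_ge0 (1 - `|z|); nra.
have zp : 0 <= 1 + z ^+ 2 by rewrite addr_ge0// sqr_ge0.
apply: (@le_trans _ _ (4 * (1 + z ^+ 2) ^+ 3 * expR (- (z ^+ 2 / 2)))).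
  have -> : 4 * (1 + z ^+ 2) ^+ 3 * expR (- (z ^+ 2 / 2)) =
    4 * (1 + z ^+ 2) ^+ 2 * ((1 + z ^+ 2) * expR (- (z ^+ 2 / 2))) by ring.
  by rewrite ler_wpM2r// mulr_ge0 ?expR_ge0.
have h2 : 1 + z ^+ 2 <= 6 * expR ((1 + z ^+ 2) / 6).
  by have := expR_ge1Dx ((1 + z ^+ 2) / 6); lra.
have h3 : (1 + z ^+ 2) ^+ 3 <= 216 * expR ((1 + z ^+ 2) / 2).
  apply: le_trans (lerXn2r 3 _ _ h2) _; rewrite ?nnegrE ?mulr_ge0 ?expR_ge0//.
  rewrite exprMn -expRM_natl; apply: ler_pM; rewrite ?expR_ge0 ?exprn_ge0//; first lra.
  by rewrite ler_expR; lra.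
apply: (@le_trans _ _ (4 * (216 * expR ((1 + z ^+ 2) / 2)) * expR (- (z ^+ 2 / 2)))).
  by rewrite ler_wpM2r ?expR_ge0// ler_wpM2l.
set a := expR _; set b := expR _.
have -> : 4 * (216 * a) * b = 864 * (a * b) by ring.
rewrite /a /b -expRD.
have -> : (1 + z ^+ 2) / 2 + - (z ^+ 2 / 2) = 2^-1 :> R by field.
by have := @expR_half_lt2 R; lra.
Qed.

Let bumpz u : (1 + `|zz u|) ^+ 4 * bump u w <= 1728 * fat lam u w.
Proof.
rewrite -fat_bump mulrA ler_wpM2r ?(ltW (fat_gt0 _ _ _))//.
exact: poly_gauss_le.
Qed.

Let Z u := 1 + `|zz u|.
Let Z1 u : 1 <= Z u. Proof. by rewrite lerDl. Qed.

Let uw_le u : `|u / w| <= t * Z u.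
Proof.
have -> : u / w = zz u * r - lam.
  by rewrite /zz -mulrA -expr2 rs_sqr//; field.
apply: le_trans (normB_le (A := `|zz u| * r) (B := lam) _ _) _.
- by rewrite normrM (gtr0_norm r0).
- by rewrite ger0_norm.
- rewrite mulrDr mulr1 /t /tau -/r.
  by have := mulr_ge0 lam0 (normr_ge0 (zz u)); have := r0; nra.
Qed.

Let poly_bump u k p C : (k <= 4)%N -> 0 <= C -> `|p| <= C * t ^+ k * Z u ^+ 4 ->
  `|p * bump u w| <= 1728 * C * t ^+ k * fat lam u w.
Proof.
move=> k4 C0 pC; rewrite normrM (ger0_norm (bump_ge0 w0 u)).
apply: le_trans (ler_wpM2r (bump_ge0 w0 u) pC) _.
have -> : 1728 * C * t ^+ k * fat lam u w = C * t ^+ k * (1728 * fat lam u w).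
  by ring.
by rewrite -[leLHS]mulrA ler_wpM2l ?mulr_ge0 ?exprn_ge0//; exact: bumpz.
Qed.

Let ZX u k : (k <= 4)%N -> Z u ^+ k <= Z u ^+ 4.
Proof. by move=> k4; rewrite ler_weXn2l. Qed.

Let ZX1 u : 1 <= Z u ^+ 4.
Proof. by rewrite exprn_ege1. Qed.

Let mono u i j : (i + j <= 4)%N ->
  `|(u / w) ^+ i * (r ^+ j)| <= t ^+ (i + j) * Z u ^+ 4.
Proof.
move=> ij; apply: (le_trans (normM_le (normX_le i (uw_le u)) (lexx _))).
rewrite (ger0_norm (exprn_ge0 _ (ltW r0))).
have Zi : Z u ^+ i <= Z u ^+ 4 by apply: ZX; exact: leq_trans (leq_addr _ _) ij.
rewrite exprMn exprD mulrAC; apply: ler_pM => //.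
- by rewrite mulr_ge0 ?exprn_ge0// ltW.
- by rewrite exprn_ge0// (le_trans _ (Z1 u)).
- by rewrite ler_wpM2l// exprn_ge0.
Qed.

Lemma bump_le u : bump u w <= 1728 * fat lam u w.
Proof.
apply: le_trans (bumpz u); rewrite ler_peMl ?bump_ge0//; exact: ZX1.
Qed.

Lemma bump1_le u : `|bump1 u w| <= 1728 * t * fat lam u w.
Proof.
have := @poly_bump u 1 (- (u / w)) 1 isT ler01; rewrite mulr1 expr1; apply.
by rewrite normrN mul1r; have := @mono u 1 0 isT; rewrite expr1 mulr1 addn0.
Qed.

Lemma bump2_le u : `|bump2 u w| <= 3456 * t ^+ 2 * fat lam u w.
Proof.
have -> : 3456 = 1728 * (1 + 1) :> R by ring.
apply: poly_bump => //; rewrite !mulrDl !mul1r; apply: normB_le.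
  by have := @mono u 2 0 isT; rewrite mulr1 addn0.
by have := @mono u 0 2 isT; rewrite mul1r add0n rs_sqr.
Qed.

Lemma bump3_le u : `|bump3 u w| <= 6912 * t ^+ 3 * fat lam u w.
Proof.
have -> : 6912 = 1728 * (3 + 1) :> R by ring.
apply: poly_bump => //.
have -> : (3 + 1) * t ^+ 3 * Z u ^+ 4 = 3 * (t ^+ 3 * Z u ^+ 4) + t ^+ 3 * Z u ^+ 4.
  by ring.
rewrite -[3 * _ / w]mulrA; apply: normB_le.
  apply: normM_le; first by rewrite normr_nat.
  by have := @mono u 1 2 isT; rewrite rs_sqr// expr1.
by have := @mono u 3 0 isT; rewrite mulr1 addn0.
Qed.

Lemma bump4_le u : `|bump4 u w| <= 17280 * t ^+ 4 * fat lam u w.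
Proof.
have -> : 17280 = 1728 * (1 + 6 + 3) :> R by ring.
apply: poly_bump => //.
have -> : (1 + 6 + 3) * t ^+ 4 * Z u ^+ 4 = t ^+ 4 * Z u ^+ 4
  + 6 * (t ^+ 4 * Z u ^+ 4) + 3 * (t ^+ 4 * Z u ^+ 4) by ring.
rewrite -[6 * _ / w]mulrA; apply: normD_le; first apply: normB_le.
- by have := @mono u 4 0 isT; rewrite mulr1 addn0.
- apply: normM_le; first by rewrite normr_nat.
  by have := @mono u 2 2 isT; rewrite rs_sqr.
- apply: normM_le; first by rewrite normr_nat.
  by have := @mono u 0 4 isT; rewrite mul1r add0n -[4%N]/(2 * 2)%N exprM rs_sqr.
Qed.

(** Beyond [z^2 = 15] the fat kernel is itself a strict supersolution; within
    that range the Gaussian kernel is comparable to it. *)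
Lemma bump_fat_source u :
  (4 * ((u + lam * w) / den lam u w) ^+ 2 - (4 * w)^-1) * fat lam u w
    <= w^-1 * (expR 8 * bump u w).
Proof.
rewrite -fat_bump.
have -> : w^-1 * (expR 8 * ((1 + zz u ^+ 2) * expR (- (zz u ^+ 2 / 2)) * fat lam u w))
   = w^-1 * (expR 8 * ((1 + zz u ^+ 2) * expR (- (zz u ^+ 2 / 2)))) * fat lam u w.
  by move: (zz u) => z; ring.
rewrite ler_wpM2r ?(ltW (fat_gt0 _ _ _))//.
set z2 := zz u ^+ 2.
have z20 : 0 <= z2 by exact: sqr_ge0.
have -> : ((u + lam * w) / den lam u w) ^+ 2 = w^-1 * (z2 / (1 + z2) ^+ 2).
  have -> : z2 = (u + lam * w) ^+ 2 / w by rewrite /z2 /zz exprMn rs_sqr.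
  have := d0 u; rewrite /d /den => d0'.
  field; rewrite wN0 gt_eqF//= gt_eqF//.
have -> : (4 * w)^-1 = w^-1 * 4^-1 by field.
have -> : 4 * (w^-1 * (z2 / (1 + z2) ^+ 2)) - w^-1 * 4^-1 =
  w^-1 * (4 * (z2 / (1 + z2) ^+ 2) - 4^-1) by ring.
move: z2 z20 => z2 z20; rewrite ler_wpM2l ?invr_ge0 ?(ltW w0)//.
have [z15|z15] := leP 15 z2.
  apply: (@le_trans _ _ 0); last by rewrite !mulr_ge0 ?expR_ge0// addr_ge0.
  rewrite subr_le0 mulrA ler_pdivrMr; last by rewrite exprn_gt0//; lra.
  by nra.
apply: (@le_trans _ _ 1).
  have : z2 / (1 + z2) ^+ 2 <= 4^-1.
    rewrite ler_pdivrMr; last by rewrite exprn_gt0//; lra.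
    by have := sqr_ge0 (1 - z2); nra.
  by lra.
rewrite mulrCA -expRD -[leLHS]mulr1 ler_pM//; first lra.
rewrite -[leLHS]expR0 ler_expR; lra.
Qed.

(** A Gaussian profile would lose a factor [exp (|z e| / sqrt w)], unbounded in [u];
    the profile of [fat] loses, beyond the tilt, only a polynomial in [e].  This is why the errors are
    measured by [fat] and not by [bump]. *)
Lemma fat_shift u e : fat lam (u + e) w <=
  2 * (1 + e ^+ 2 / w) * expR (lam * `|e|) * fat lam u w.
Proof.
have := d0 u; have := d0 (u + e); rewrite /d /fat => d1 d2.
have -> : 2 * (1 + e ^+ 2 / w) * expR (lam * `|e|) *
    (expR (lam * u + lam ^+ 2 * w / 2) * rs w * (w / den lam u w)) =
  expR (lam * `|e|) * expR (lam * u + lam ^+ 2 * w / 2) * rs w *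
    (2 * (1 + e ^+ 2 / w) * (w / den lam u w)) by ring.
apply: ler_pM.
- by rewrite mulr_ge0 ?expR_ge0// ltW.
- by rewrite divr_ge0 ?ltW.
- rewrite ler_wpM2r ?(ltW r0)// -expRD ler_expR.
  have : lam * e <= lam * `|e| by rewrite ler_wpM2l// ler_norm.
  by lra.
- rewrite mulrCA ler_wpM2l ?(ltW w0)// ler_pdivlMr// mulrC ler_pdivrMr//.
  have -> : 2 * (1 + e ^+ 2 / w) * den lam (u + e) w =
     2 * den lam (u + e) w + 2 * e ^+ 2
     + 2 * (e ^+ 2 / w) * (u + e + lam * w) ^+ 2 by rewrite /den; field.
  have : 0 <= 2 * (e ^+ 2 / w) * (u + e + lam * w) ^+ 2.
    by rewrite mulr_ge0 ?sqr_ge0// mulr_ge0// divr_ge0 ?sqr_ge0// ltW.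
  rewrite /den; have := sqr_ge0 (u + lam * w + 2 * e); have := w0; nra.
Qed.

Lemma fat_le_expR u : fat lam u w <= expR (lam * u + lam ^+ 2 * w / 2) * rs w.
Proof.
rewrite /fat ler_piMr ?mulr_ge0 ?expR_ge0 ?(ltW r0)//.
by rewrite ler_pdivrMr ?den_gt0// mul1r /den lerDl sqr_ge0.
Qed.

End fixed_w.

Lemma tau_le w w' : 0 < w -> w <= w' -> tau lam w' <= tau lam w.
Proof.
move=> w0 ww; rewrite lerD2l lef_pV2 ?posrE ?sqrtr_gt0 ?(lt_le_trans w0)//.
by rewrite ler_wsqrtr.
Qed.

(** The logarithmic derivative of [fat] in [w] is at most [2 tau^2]. *)
Lemma fat_compar u w w' : 0 < w -> w <= w' -> (w' - w) * tau lam w ^+ 2 <= 2^-1 ->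
  fat lam u w' <= 4 * fat lam u w /\ fat lam u w <= 4 * fat lam u w'.
Proof.
move=> w0 ww H.
have pos t : w <= t <= w' -> 0 < t by move=> /andP[+ _]; exact: lt_le_trans.
pose c := 2 * tau lam w ^+ 2.
have cE t : w <= t <= w' -> `|enn lam u t| <= c.
  move=> tw; have h := enn_le (pos t tw) u; apply: (le_trans h).
  rewrite ler_pM2l// lerXn2r ?nnegrE//.
  - by apply/ltW/tau_gt0/pos.
  - exact/ltW/tau_gt0.
  - by apply: tau_le => //; case/andP: tw.
have e1 : expR (c * (w' - w)) <= 4.
  apply: (@le_trans _ _ (expR 1)); last first.
    have -> : expR 1 = expR (2^-1) * expR (2^-1) :> R.
      by rewrite -expRD; congr expR; field.
    by have := @expR_half_lt2 R; have := @expR_ge0 R 2^-1; nra.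
  by rewrite ler_expR /c; lra.
(* with c bounding that derivative, fat exp (- c t) decreases in t (s = 1) and
   fat exp (c t) increases (s = -1) *)
have key (s : R) : s = 1 \/ s = -1 ->
    fat lam u w' * expR (- c * w' * s) * s <= fat lam u w * expR (- c * w * s) * s.
  move=> s1.
  pose f t := fat lam u t * expR (- c * t * s) * s.
  pose f' t := (enn lam u t - c * s) * s * (fat lam u t * expR (- c * t * s)).
  rewrite -/(f w') -/(f w); apply: (@derive_le0_le R f f' w w' ww).
    move=> t tw; have := dwfat lam (pos t tw) u => ?.
    by apply: is_derive_eq; rewrite /GRing.scale/= /fatw /f'; ring.
  move=> t tw; rewrite /f'; apply: mulr_le0_ge0; last first.
    by rewrite mulr_ge0 ?expR_ge0// ltW// fat_gt0// pos.
  have := cE t tw; rewrite ler_norml => /andP[? ?].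
  by case: s1 => ->; lra.
have := key 1 (or_introl erefl); have := key (-1) (or_intror erefl).
rewrite !mulrN !mulr1 !mulNr !opprK lerN2 => k1 k2.
have E : expR (c * (w' - w)) * expR (c * w) = expR (c * w').
  by rewrite -expRD; congr expR; ring.
have ew := expR_gt0 (c * w); have ew' := expR_gt0 (c * w').
split.
- move: k2; rewrite !expRN ler_pdivrMr// mulrAC ler_pdivlMr// -E.
  have := fat_gt0 lam w0 u; have f' := fat_gt0 lam (lt_le_trans w0 ww) u => f.
  rewrite mulrA ler_pM2r// => h; apply: (le_trans h).
  by rewrite mulrC ler_wpM2r// ltW.
- move: k1; rewrite -E mulrA ler_pM2r// => h; apply: (le_trans h).
  by rewrite mulrC ler_wpM2r// ltW// fat_gt0// (lt_le_trans w0).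
Qed.

End kernel_bounds.

(** * The barrier *)

Section barrier.
Variable R : realType.
Implicit Types u w s t x : R.
Variables lam gam a b d e : R.
Hypotheses (lam0 : 0 <= lam) (gam0 : 0 < gam).
Hypotheses (a0 : 0 <= a) (b0 : 0 <= b) (d0 : 0 <= d) (e0 : 0 <= e).

Variable C : R.
Hypothesis C6912 : 6912 <= C.

Definition gco w : R := b + a * ln (w / gam ^+ 2).
Definition fco w : R := d + e * w.
(** The first term solves the heat equation [barw = bar2 / 2] exactly.  The other two
    turn it into a strict supersolution: the slope [e] of [fco] gains [e * fat], and
    the logarithm in [gco] gains [(a / w) * bump]. *)
Definition bar u w : R :=
  Phi (u * rs w) + gco w * bump u w + fco w * fat lam u w.
Definition bar1 u w : R :=
  nrm R * bump u w + gco w * bump1 u w + fco w * fat1 lam u w.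
Definition bar2 u w : R :=
  nrm R * bump1 u w + gco w * bump2 u w + fco w * fat2 lam u w.
Definition bar3 u w : R :=
  nrm R * bump2 u w + gco w * bump3 u w + fco w * fat3 lam u w.
Definition barw u w : R :=
  nrm R * bump1 u w / 2 + (a / w * bump u w + gco w * bump2 u w / 2)
  + (e * fat lam u w + fco w * fatw lam u w).
Definition barww u w : R :=
  nrm R * bump3 u w / 4
  + (a / w * bump2 u w - a / w ^+ 2 * bump u w + gco w * bump4 u w / 4)
  + (2 * e * fatw lam u w + fco w * fatww lam u w).

(** In units of [fat], the size of the third derivative in [u]: the derivatives
    cost [tau] each.  The summand [a] makes room for the derivative of [gco] in [w],
    so that [tau * errw] bounds the second derivative in [w] as well. *)
Definition errw w : R :=
  tau lam w ^+ 2 + (gco w + a) * tau lam w ^+ 3 + fco w * tau lam w ^+ 3.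

Section fixed_w.
Variables (w : R) (w0 : 0 < w).
Let wN0 : w != 0. Proof. by rewrite gt_eqF. Qed.

Lemma dbar u : is_derive u 1 (bar^~ w) (bar1 u w).
Proof.
have := dPhi_rs w0 u; have := dbump w0 u; have := dfat lam w0 u => ? ? ?.
by apply: is_derive_eq; rewrite /GRing.scale/= /bar1; ring.
Qed.

Lemma dbar1 u : is_derive u 1 (bar1^~ w) (bar2 u w).
Proof.
have := dbump1 w0 u; have := dbump w0 u; have := dfat1 lam w0 u => ? ? ?.
by apply: is_derive_eq; rewrite /GRing.scale/= /bar2; ring.
Qed.

Lemma dbar2 u : is_derive u 1 (bar2^~ w) (bar3 u w).
Proof.
have := dbump2 w0 u; have := dbump1 w0 u; have := dfat2 lam w0 u => ? ? ?.
by apply: is_derive_eq; rewrite /GRing.scale/= /bar3; ring.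
Qed.

Lemma dgco : is_derive w 1 gco (a / w).
Proof.
have g2 : 0 < gam ^+ 2 by rewrite exprn_gt0.
have ? : is_derive w 1 (fun t => ln (t / gam ^+ 2)) w^-1.
  have -> : w^-1 = (w / gam ^+ 2)^-1 * (gam ^+ 2)^-1.
    by field; rewrite wN0 gt_eqF.
  apply: is_derive1_comp; first by apply: is_derive1_ln; rewrite divr_gt0.
  by apply: is_derive_eq; rewrite /GRing.scale/=; ring.
by apply: is_derive_eq; rewrite /GRing.scale/=; ring.
Qed.

Lemma dwbar u : is_derive w 1 (bar u) (barw u w).
Proof.
have := dwPhi_rs w0 u; have := dwbump w0 u; have := dwfat lam w0 u => ? ? ?.
have := dgco => ?.
by apply: is_derive_eq; rewrite /GRing.scale/= /barw; field.
Qed.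

Lemma dwbarw u : is_derive w 1 (barw u) (barww u w).
Proof.
have := dwbump w0 u; have := dwbump1 w0 u; have := dwbump2 w0 u => ? ? ?.
have := dwfat lam w0 u; have := dwfatw lam w0 u => ? ?.
have := dgco => ?.
have ? : is_derive w 1 (fun t : R => t^-1) (- (w ^+ 2)^-1).
  apply: (is_derive_eq (@is_deriveV R id w _ 1 wN0 (is_derive_id _ _))).
  by rewrite /GRing.scale/= mulr1.
by apply: is_derive_eq; rewrite /GRing.scale/= /barww; field.
Qed.

Hypothesis wgam : gam ^+ 2 <= w.
Let f0 : 0 <= fco w.
Proof. by rewrite addr_ge0// mulr_ge0// ltW. Qed.
Let t0 : 0 <= tau lam w. Proof. exact/ltW/tau_gt0. Qed.
Let F0 u : 0 <= fat lam u w. Proof. exact/ltW/fat_gt0. Qed.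

Lemma gco_ge : b <= gco w.
Proof.
rewrite lerDl mulr_ge0// ln_ge0// ler_pdivlMr ?mul1r//.
by rewrite exprn_gt0.
Qed.

Lemma gco_ge0 : 0 <= gco w.
Proof. exact: le_trans gco_ge. Qed.

Lemma errw_ge0 : 0 <= errw w.
Proof.
rewrite /errw; apply: addr_ge0; last by apply: mulr_ge0 => //; exact: exprn_ge0.
apply: addr_ge0; first exact: sqr_ge0.
by apply: mulr_ge0; [rewrite addr_ge0// gco_ge0|exact: exprn_ge0].
Qed.

Let norm_nrm : `|nrm R| <= 1.
Proof. by rewrite ger0_norm ?nrm_le1// ltW// nrm_gt0. Qed.

Lemma bar3_le u : `|bar3 u w| <= C * errw w * fat lam u w.
Proof.
have gn : `|gco w| <= gco w by rewrite ger0_norm// gco_ge0.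
have fn : `|fco w| <= fco w by rewrite ger0_norm.
apply: le_trans (normD_le (normD_le (normM_le norm_nrm (bump2_le lam0 w0 u))
  (normM_le gn (bump3_le lam0 w0 u))) (normM_le fn (fat3_le lam0 w0 u))) _.
have -> : 1 * (3456 * tau lam w ^+ 2 * fat lam u w) +
  gco w * (6912 * tau lam w ^+ 3 * fat lam u w) +
  fco w * (18 * tau lam w ^+ 3 * fat lam u w) =
  (3456 * tau lam w ^+ 2 + 6912 * (gco w * tau lam w ^+ 3)
   + 18 * (fco w * tau lam w ^+ 3)) * fat lam u w by ring.
rewrite ler_wpM2r//; apply: (@le_trans _ _ (6912 * errw w)); last first.
  by rewrite ler_wpM2r// errw_ge0.
rewrite /errw.
have := sqr_ge0 (tau lam w); have : 0 <= a * tau lam w ^+ 3.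
  by rewrite mulr_ge0 ?exprn_ge0.
have : 0 <= fco w * tau lam w ^+ 3 by rewrite mulr_ge0 ?exprn_ge0.
rewrite mulrDl; lra.
Qed.

Lemma barww_le u : `|barww u w| <= C * (tau lam w * errw w) * fat lam u w.
Proof.
have gn : `|gco w| <= gco w by rewrite ger0_norm// gco_ge0.
have fn : `|fco w| <= fco w by rewrite ger0_norm.
set t := tau lam w; set F := fat lam u w.
have wt : w^-1 <= t ^+ 2 by exact: invw_le_tau.
have aw : `|a / w| <= a * t ^+ 2.
  by rewrite ger0_norm ?divr_ge0 ?(ltW w0)// ler_wpM2l.
have aw2 : `|a / w ^+ 2| <= a * t ^+ 4.
  rewrite ger0_norm ?divr_ge0 ?exprn_ge0 ?(ltW w0)// ler_wpM2l// -exprVn.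
  by rewrite -[4%N]/(2 * 2)%N exprM lerXn2r// nnegrE ?invr_ge0 ?sqr_ge0// ltW.
have ef : `|2 * e| <= 2 * (fco w * t ^+ 2).
  rewrite ger0_norm ?mulr_ge0// ler_pM2l//.
  apply: (@le_trans _ _ (fco w * w^-1)); last by rewrite ler_wpM2l.
  by rewrite /fco mulrDl -mulrA divff// mulr1 lerDr divr_ge0// ltW.
have bn : `|bump u w| <= 1728 * F by rewrite ger0_norm ?bump_ge0// bump_le.
have half (c : R) : `|c^-1| <= `|c|^-1 by rewrite normfV.
rewrite /barww.
apply: le_trans (normD_le (normD_le
  (normM_le (normM_le norm_nrm (bump3_le lam0 w0 u)) (half 4))
  (normD_le (normB_le (normM_le aw (bump2_le lam0 w0 u)) (normM_le aw2 bn))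
  (normM_le (normM_le gn (bump4_le lam0 w0 u)) (half 4))))
  (normD_le (normM_le ef (fatw_le lam0 w0 u)) (normM_le fn (fatww_le lam0 w0 u)))) _.
rewrite normr_nat -/t -/F.
have -> : 1 * (6912 * t ^+ 3 * F) / 4 +
  (a * t ^+ 2 * (3456 * t ^+ 2 * F) + a * t ^+ 4 * (1728 * F) +
   gco w * (17280 * t ^+ 4 * F) / 4) +
  (2 * (fco w * t ^+ 2) * (2 * t ^+ 2 * F) + fco w * (8 * t ^+ 4 * F)) =
  (1728 * t ^+ 3 + 5184 * (a * t ^+ 4) + 4320 * (gco w * t ^+ 4)
   + 12 * (fco w * t ^+ 4)) * F by field.
rewrite ler_wpM2r ?F0//; apply: (@le_trans _ _ (6912 * (t * errw w))); last first.
  by rewrite ler_wpM2r// mulr_ge0// errw_ge0.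
rewrite /errw -/t.
have -> : t * (t ^+ 2 + (gco w + a) * t ^+ 3 + fco w * t ^+ 3) =
  t ^+ 3 + gco w * t ^+ 4 + a * t ^+ 4 + fco w * t ^+ 4 by ring.
have : 0 <= a * t ^+ 4 by rewrite mulr_ge0 ?exprn_ge0.
have : 0 <= fco w * t ^+ 4 by rewrite mulr_ge0 ?exprn_ge0.
have : 0 <= gco w * t ^+ 4 by rewrite mulr_ge0 ?exprn_ge0// gco_ge0.
have : 0 <= t ^+ 3 by rewrite ?exprn_ge0.
lra.
Qed.

Hypothesis ad : expR 8 * d <= a.

(** Where [fat] is a sink, the gain [e * fat] outweighs the sink of [e * w * fat], and
    the gain [(a / w) * bump] that of [d * fat]. *)
Lemma barw_ge u :
  bar2 u w / 2 + (e / 2 + d / (4 * w)) * fat lam u w <= barw u w.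
Proof.
set q := (u + lam * w) / den lam u w.
rewrite /barw fat_heat// -/q -subr_ge0.
have -> : nrm R * bump1 u w / 2 + (a / w * bump u w + gco w * bump2 u w / 2) +
  (e * fat lam u w + fco w * (fat2 lam u w / 2 +
    ((2 * w)^-1 - 4 * q ^+ 2) * fat lam u w))
  - (bar2 u w / 2 + (e / 2 + d / (4 * w)) * fat lam u w) =
  (w^-1 * (a - expR 8 * d)) * bump u w
  + d * (w^-1 * (expR 8 * bump u w) - (4 * q ^+ 2 - (4 * w)^-1) * fat lam u w)
  + e * w * (w^-1 - 4 * q ^+ 2) * fat lam u w.
  by rewrite /bar2 /fco; field.
rewrite !addr_ge0//.
- by rewrite mulr_ge0 ?bump_ge0// mulr_ge0 ?subr_ge0// invr_ge0 ltW.
- by rewrite mulr_ge0// subr_ge0 bump_fat_source.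
- apply: mulr_ge0 => //; apply: mulr_ge0; first by rewrite mulr_ge0// ltW.
  have qr : `|q| <= rs w / 2 by exact: y_den_le.
  have := normX_le 2 qr; rewrite ger0_norm ?sqr_ge0//.
  have -> : (rs w / 2) ^+ 2 = w^-1 / 4 by rewrite expr_div_n rs_sqr//; field.
  by lra.
Qed.

Lemma bar_ge_fat u : fco w * fat lam u w <= bar u w.
Proof.
by rewrite lerDr addr_ge0 ?Phi_ge0// mulr_ge0 ?gco_ge0 ?bump_ge0.
Qed.

End fixed_w.

Lemma gco_ler w w' : 0 < w -> w <= w' -> gco w' <= gco w + a * ((w' - w) / w).
Proof.
move=> w0 ww; have w'0 := lt_le_trans w0 ww.
have g2 : 0 < gam ^+ 2 by rewrite exprn_gt0.
rewrite /gco; have -> : w' / gam ^+ 2 = (w / gam ^+ 2) * (w' / w).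
  by field; rewrite !gt_eqF.
rewrite lnM ?posrE ?divr_gt0// mulrDr addrA lerD2l ler_wpM2l//.
have -> : w' / w = 1 + (w' - w) / w by field; rewrite gt_eqF.
apply: le_ln1Dx; apply: (@lt_le_trans _ _ 0); first by rewrite ltrN10.
by rewrite divr_ge0 ?subr_ge0// ltW.
Qed.

End barrier.

(** * Expansion of the barrier over one step *)

Section growth.
Variable R : realType.
Implicit Types x T : R.

Definition cosh2 (x : R) : R := expR x + expR (- x).

Lemma expR_norm_le_cosh2 x : expR `|x| <= cosh2 x.
Proof.
rewrite /cosh2; have [x0|x0] := leP 0 x.
  by rewrite ger0_norm// lerDl expR_ge0.
by rewrite ltr0_norm// lerDr expR_ge0.
Qed.

Lemma cosh2_ge0 x : 0 <= cosh2 x.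
Proof. by rewrite addr_ge0// expR_ge0. Qed.

(** With [T = |x| / eps], the exponent [T / 4] of the available moment pays [T / 16]
    for the tilt and [3 T / 16] for the cubic factor. *)
Lemma poly_expR_le T : 0 <= T ->
  T * (1 + T ^+ 2) * expR (T / 16) <= (2 * 16 ^+ 3) * expR (T / 4).
Proof.
move=> T0.
have h1 : T <= 16 * expR (T / 16) by have := expR_ge1Dx (T / 16); lra.
have h3 : T ^+ 3 <= 16 ^+ 3 * expR (T / 16) ^+ 3.
  have -> : 16 ^+ 3 * expR (T / 16) ^+ 3 = (16 * expR (T / 16)) ^+ 3 by ring.
  by rewrite lerXn2r ?nnegrE// mulr_ge0// expR_ge0.
have -> : expR (T / 4) = expR (T / 16) ^+ 3 * expR (T / 16).
  by rewrite -exprSr -expRM_natl; congr expR; field.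
rewrite mulrA ler_wpM2r ?expR_ge0//.
have e1 : 1 <= expR (T / 16) by rewrite -expR0 ler_expR divr_ge0.
have e3 : expR (T / 16) <= expR (T / 16) ^+ 3 by rewrite ler_eXnr.
rewrite mulrDr mulr1 -exprS; lra.
Qed.

Lemma increment_growth lam eps w x : 0 <= lam -> 0 < eps ->
    lam * eps <= 16^-1 -> eps ^+ 2 <= w ->
  (1 + x ^+ 2 / w) * expR (lam * `|x|) * `|x| ^+ 3 <=
  eps * x ^+ 2 * (2 * 16 ^+ 3 * cosh2 (x / (4 * eps))).
Proof.
move=> lam0 eps0 epslam epsw.
have w0 : 0 < w by apply: lt_le_trans epsw; rewrite exprn_gt0.
pose T := `|x| / eps.
have T0 : 0 <= T by rewrite divr_ge0// ltW.
have xT : `|x| = eps * T by rewrite /T mulrC divfK// gt_eqF.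
have xT2 : x ^+ 2 = eps ^+ 2 * T ^+ 2.
  by rewrite -[LHS]ger0_norm ?sqr_ge0// normrX xT exprMn.
apply: (@le_trans _ _ ((1 + T ^+ 2) * expR (T / 16) * `|x| ^+ 3)).
  rewrite ler_wpM2r ?exprn_ge0//; apply: ler_pM; rewrite ?expR_ge0//.
  - by rewrite addr_ge0// divr_ge0 ?sqr_ge0// ltW.
  - by rewrite lerD2l ler_pdivrMr// xT2 mulrC ler_wpM2l ?sqr_ge0.
  - by rewrite ler_expR xT mulrA [T / _]mulrC ler_wpM2r.
have -> : (1 + T ^+ 2) * expR (T / 16) * `|x| ^+ 3 =
   eps * x ^+ 2 * (T * (1 + T ^+ 2) * expR (T / 16)).
  by rewrite xT2 xT; ring.
apply: ler_wpM2l; first by apply: mulr_ge0; [exact: ltW|exact: sqr_ge0].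
apply: le_trans (poly_expR_le T0) _; rewrite ler_pM2l ?mulr_gt0//.
apply: le_trans (expR_norm_le_cosh2 _); rewrite ler_expR normrM.
rewrite [`|_^-1|]ger0_norm ?invr_ge0 ?mulr_ge0 ?(ltW eps0)// xT.
have -> : eps * T / (4 * eps) = T / 4 by field; rewrite gt_eqF.
by [].
Qed.

End growth.

Section step.
Variable R : realType.
Implicit Types u w s x : R.
Variables lam gam eps a b d e : R.
Hypotheses (lam0 : 0 <= lam) (gam0 : 0 < gam) (eps0 : 0 < eps).
Hypotheses (a0 : 0 <= a) (b0 : 0 <= b) (d0 : 0 <= d) (e0 : 0 <= e).
Hypotheses (ad : expR 8 * d <= a).
Hypotheses (epslam : lam * eps <= 16^-1) (epsgam : 16 * eps <= gam).

Let B := bar lam gam a b d e.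
Let E w := errw lam gam a b d e w.

Variable C : R.
Hypothesis C6912 : 6912 <= C.
Let C0 : 0 <= C. Proof. by apply: le_trans C6912; rewrite ler0n. Qed.
Definition Ctaylor : R := C * 2 * (2 * 16 ^+ 3).

(** The third derivative is evaluated within [|x|] of [u]; [fat_shift] brings it
    back to [u], and [increment_growth] turns the loss into an exponential weight
    on [x^2]. *)
Lemma bar_taylor u w x : gam ^+ 2 <= w ->
  B (u + x) w <= B u w + bar1 lam gam a b d e u w * x
    + bar2 lam gam a b d e u w / 2 * x ^+ 2
    + Ctaylor * eps * E w * fat lam u w * (x ^+ 2 * cosh2 (x / (4 * eps))).
Proof.
move=> wg; have w0 : 0 < w by apply: lt_le_trans wg; rewrite exprn_gt0.
have E0 : 0 <= E w by exact: errw_ge0.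
pose Q := C * E w * (2 * (1 + x ^+ 2 / w) * expR (lam * `|x|) * fat lam u w).
have shift (f f' : R -> R) t : is_derive (u + t) 1 f (f' (u + t)) ->
    is_derive t 1 (fun t => f (u + t)) (f' (u + t)).
  move=> df; rewrite -[f' _]mulr1; apply: is_derive1_comp.
  by apply: is_derive_eq; rewrite add0r.
pose f0 t := bar lam gam a b d e t w.
pose f1 t := bar1 lam gam a b d e t w.
pose f2 t := bar2 lam gam a b d e t w.
pose f3 t := bar3 lam gam a b d e t w.
have := @taylor3_le R (fun t => f0 (u + t)) (fun t => f1 (u + t))
  (fun t => f2 (u + t)) (fun t => f3 (u + t)) x Q.
rewrite !addr0 => /(_ (fun t => shift f0 f1 t (dbar lam gam a b d e w0 _))).
move=> /(_ (fun t => shift f1 f2 t (dbar1 lam gam a b d e w0 _))).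
move=> /(_ (fun t => shift f2 f3 t (dbar2 lam gam a b d e w0 _))) H.
apply: (le_trans (H _)) => {H}.
  move=> t tx; apply: le_trans (bar3_le lam0 gam0 a0 b0 d0 e0 C6912 w0 wg _) _.
  apply: ler_wpM2l; first by apply: mulr_ge0.
  apply: le_trans (fat_shift lam0 w0 _ _) _.
  apply: ler_wpM2r; first by apply/ltW/fat_gt0.
  have tx2 : t ^+ 2 <= x ^+ 2.
    rewrite -[t ^+ 2]ger0_norm ?sqr_ge0// -[x ^+ 2]ger0_norm ?sqr_ge0//.
    by rewrite !normrX lerXn2r ?nnegrE.
  apply: ler_pM; rewrite ?expR_ge0//.
  - by rewrite mulr_ge0// addr_ge0// divr_ge0 ?sqr_ge0// ltW.
  - by rewrite ler_pM2l// lerD2l ler_pM2r ?invr_gt0.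
  - by rewrite ler_expR ler_wpM2l.
rewrite lerD2l /Q /Ctaylor.
have -> : C * E w * (2 * (1 + x ^+ 2 / w) * expR (lam * `|x|) * fat lam u w) *
    `|x| ^+ 3 = (C * E w * 2 * fat lam u w) *
    ((1 + x ^+ 2 / w) * expR (lam * `|x|) * `|x| ^+ 3) by ring.
have -> : C * 2 * (2 * 16 ^+ 3) * eps * E w * fat lam u w *
   (x ^+ 2 * cosh2 (x / (4 * eps))) = (C * E w * 2 * fat lam u w) *
   (eps * x ^+ 2 * ((2 * 16 ^+ 3) * cosh2 (x / (4 * eps)))) by ring.
have F0 := ltW (fat_gt0 lam w0 u).
move: (fat lam u w) F0 (E w) E0 => F F0 E' E0.
rewrite ler_wpM2l//; first by apply: mulr_ge0 => //; rewrite !mulr_ge0.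
apply: increment_growth => //.
apply: le_trans wg; rewrite lerXn2r ?nnegrE ?(ltW eps0) ?(ltW gam0)//.
by apply: le_trans epsgam; rewrite ler_peMl ?(ltW eps0)// ler1n.
Qed.

Definition Ctime : R := C * 96.

(** First order in [s] is [barw_ge]; in the error of second order, one factor [s] is
    at most [12 eps^2], and [eps * tau] is bounded, so that it has the size of the
    error of [bar_taylor]. *)
Lemma bar_time u w s : gam ^+ 2 <= w -> 0 <= s <= 12 * eps ^+ 2 ->
  B u w + s * (bar2 lam gam a b d e u w / 2 + (e / 2 + d / (4 * w)) * fat lam u w)
   - s * (Ctime * eps * E w * fat lam u w) <= B u (w + s)
  /\ fat lam u w <= 4 * fat lam u (w + s).
Proof.
move=> wg /andP[s0 s12].
have w0 : 0 < w by apply: lt_le_trans wg; rewrite exprn_gt0.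
have ws : w <= w + s by rewrite lerDl.
set t := tau lam w; have t0 : 0 < t by exact: tau_gt0.
have epst : eps * t <= 8^-1.
  have r1 : rs w <= gam^-1.
    rewrite lef_pV2 ?posrE// ?sqrtr_gt0//.
    by rewrite -[leLHS](ger0_norm (ltW gam0)) -sqrtr_sqr ler_wsqrtr.
  have : eps * rs w <= 16^-1.
    apply: (@le_trans _ _ (eps / gam)); first by rewrite ler_pM2l.
    by rewrite ler_pdivrMr//; have := epsgam; lra.
  by rewrite /t /tau mulrDr [eps * lam]mulrC; have := epslam; lra.
have st2 : s * t ^+ 2 <= 2^-1.
  apply: (@le_trans _ _ (12 * (eps * t) ^+ 2)).
    by rewrite exprMn [leRHS]mulrA ler_wpM2r ?sqr_ge0.
  have : (eps * t) ^+ 2 <= 8^-1 ^+ 2.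
    by rewrite lerXn2r ?nnegrE// mulr_ge0// ltW.
  by lra.
have s_w : s / w <= 1.
  rewrite ler_pdivrMr// mul1r; apply: (le_trans s12).
  apply: (@le_trans _ _ ((16 * eps) ^+ 2)).
    by rewrite exprMn ler_wpM2r ?sqr_ge0//; lra.
  apply: le_trans wg; rewrite lerXn2r ?nnegrE ?(ltW gam0)//.
  by rewrite mulr_ge0// ltW.
have compar w' : w <= w' <= w + s ->
    fat lam u w' <= 4 * fat lam u w /\ fat lam u w <= 4 * fat lam u w'.
  move=> /andP[ww' w's]; apply: fat_compar => //.
  by apply: le_trans st2; rewrite ler_wpM2r ?sqr_ge0//; lra.
split; last by apply: (compar _ _).2; rewrite ws lexx.
have E0 : 0 <= E w by exact: errw_ge0.
have F0 := fat_gt0 lam w0 u.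
pose Q := C * 8 * (t * E w) * fat lam u w.
have := @taylor2_ge R (B u) (barw lam gam a b d e u) (barww lam gam a b d e u)
  w (w + s) Q ws.
rewrite [w + s - w]addrAC subrr add0r => H.
have pos w' : w <= w' <= w + s -> 0 < w'.
  by move=> /andP[+ _]; exact: lt_le_trans.
apply: le_trans (H _ _ _); first last.
- move=> w' ww'; have w'0 := pos _ ww'; have /andP[ww1 ww2] := ww'.
  have wg' : gam ^+ 2 <= w' := le_trans wg ww1.
  have t't : tau lam w' <= t by exact: tau_le.
  have t'0 : 0 <= tau lam w' by exact/ltW/tau_gt0.
  apply: le_trans (barww_le lam0 gam0 a0 b0 d0 e0 C6912 w'0 wg' u) _.
  have g' : gco gam a b w' + a <= 2 * (gco gam a b w + a).
    have : gco gam a b w' <= gco gam a b w + a * ((w' - w) / w) by exact: gco_ler.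
    have : a * ((w' - w) / w) <= a.
      rewrite ler_piMr// (le_trans _ s_w)// ler_wpM2r ?invr_ge0 ?(ltW w0)//; lra.
    by have := gco_ge0 gam0 a0 b0 wg; lra.
  have f' : fco d e w' <= 2 * fco d e w.
    rewrite /fco; have : e * w' <= e * (2 * w).
      rewrite ler_wpM2l// (le_trans ww2)//.
      by move: s_w; rewrite ler_pdivrMr// mul1r; lra.
    by have := d0; lra.
  have f0 : 0 <= fco d e w by rewrite addr_ge0// mulr_ge0// ltW.
  have f'0 : 0 <= fco d e w' by rewrite addr_ge0// mulr_ge0// ltW.
  have g0 : 0 <= gco gam a b w + a by rewrite addr_ge0// (gco_ge0 gam0 a0 b0 wg).
  have g'0 : 0 <= gco gam a b w' + a.
    by rewrite addr_ge0// (gco_ge0 gam0 a0 b0 wg').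
  have E' : errw lam gam a b d e w' <= 2 * E w.
    rewrite /E /errw -/t !mulrDr; apply: lerD; first apply: lerD.
    + apply: (@le_trans _ _ (t ^+ 2)); first by rewrite lerXn2r ?nnegrE// ltW.
      by have := sqr_ge0 t; lra.
    + rewrite mulrA; apply: ler_pM; rewrite ?exprn_ge0//.
      by rewrite lerXn2r ?nnegrE// ltW.
    + rewrite mulrA; apply: ler_pM; rewrite ?exprn_ge0//.
      by rewrite lerXn2r ?nnegrE// ltW.
  rewrite /Q; have -> : C * 8 * (t * E w) * fat lam u w =
    C * (t * (2 * E w)) * (4 * fat lam u w) by ring.
  have E'0 : 0 <= errw lam gam a b d e w' by exact: errw_ge0.
  apply: ler_pM; last exact: (compar _ ww').1.
  - by apply: mulr_ge0 => //; exact: mulr_ge0.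
  - exact/ltW/fat_gt0.
  - by apply: ler_wpM2l => //; apply: ler_pM.
- by move=> w' ww'; apply: dwbarw => //; exact: pos ww'.
- by move=> w' ww'; apply: dwbar => //; exact: pos ww'.
rewrite -/(B u w); apply: lerB.
  rewrite lerD2l mulrC ler_wpM2r//.
  exact: barw_ge.
rewrite /Q /Ctime expr2.
have -> : C * 8 * (t * E w) * fat lam u w * (s * s) =
  s * (C * 8 * E w * fat lam u w * (t * s)) by ring.
have -> : s * (C * 96 * eps * E w * fat lam u w) =
  s * (C * 8 * E w * fat lam u w * (12 * eps)) by ring.
apply: ler_wpM2l => //; apply: ler_wpM2l.
  by rewrite mulr_ge0 ?(ltW F0)// !mulr_ge0.
apply: (@le_trans _ _ (t * (12 * eps ^+ 2))); first by rewrite ler_pM2l.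
have -> : t * (12 * eps ^+ 2) = (eps * t) * (12 * eps) by ring.
by rewrite ler_piMl ?mulr_ge0 ?(ltW eps0)//; lra.
Qed.

End step.

(** * The barrier is a supersolution *)

Section supersolution.
Variable R : realType.

Let combine (CT Ct eps E F e q k f B B2 B' s : R) :
  s * ((CT * 8 + Ct) * eps * E * F) <= s * ((e / 2 + q + k * f) * F) ->
  s * (k * (f * F)) <= s * (k * (4 * B')) ->
  B + s * (B2 / 2 + (e / 2 + q) * F) - s * (Ct * eps * E * F) <= B' ->
  B + s * (B2 / 2) + 8 * s * (CT * eps * E * F) <= (1 + 4 * k * s) * B'.
Proof. by lra. Qed.

Let parts_le_sum (x y z v : R) : 0 <= x -> 0 <= y -> 0 <= z -> 0 <= v ->
  [/\ x <= x + y + z + v, y <= x + y + z + v, z <= x + y + z + v &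
      v <= x + y + z + v].
Proof. by move=> *; split; lra. Qed.

Let sum_errors (L r2 X G3 Rg kf Rf T1 Tg Tf e dr : R) :
  0 <= L -> 0 <= r2 -> 0 <= X -> T1 <= 2 * L + 2 * r2 ->
  Tg <= 4 * G3 + 4 * Rg -> Tf <= 4 * (kf / 4) + 4 * Rf ->
  e = 32 * L + 32 * X -> dr = 512 * r2 -> G3 <= X -> Rg <= dr / 64 ->
  Rf <= (dr + e) / 256 ->
  T1 + Tg + Tf <= e / 2 + dr / 4 + kf.
Proof. by lra. Qed.

Implicit Types u w s x : R.
Variables lam gam eps C Lmax : R.
Hypotheses (lam0 : 0 <= lam) (gam0 : 0 < gam) (eps0 : 0 < eps).
Hypothesis C6912 : 6912 <= C.
Hypothesis Lmax0 : 0 <= Lmax.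

(** The factor [8] anticipates the conditional moment of [x^2 cosh2 (x / (4 eps))],
    which is at most [8 s]. *)
Definition Cerr : R := Ctaylor C * 8 + Ctime C.
(** The error of a step is, per unit of variance,
    [Cerr eps (tau^2 + (gco + a) tau^3 + fco tau^3) fat] with [tau = lam + 1 / sqrt w].
    Its terms in powers of [1 / sqrt w] are paid by [dpar / (4 w)], those in
    [lam^2] and [lam^3 (gco + a)] by [epar / 2], and the last one, [lam^3 fco], by
    the growth rate [kpar].  The value of [bpar] is the one that [barrier_final]
    needs, and that of [apar] the one that [barw_ge] needs. *)
Definition dpar : R := 512 * Cerr * eps.
Definition apar : R := expR 8 * dpar.
Definition bpar : R := 4 * gam.
Definition epar : R :=
  32 * Cerr * eps * (lam ^+ 2 + lam ^+ 3 * (bpar + apar * (1 + Lmax))).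
Definition kpar : R := 4 * Cerr * eps * lam ^+ 3.
Definition Kpar : R := 256 * Cerr * expR 8.

Lemma C_ge0 : 0 <= C.
Proof. by apply: le_trans C6912; rewrite ler0n. Qed.

Lemma Ctaylor_ge0 : 0 <= Ctaylor C.
Proof. by rewrite /Ctaylor !mulr_ge0// C_ge0. Qed.

Lemma Cerr_ge1 : 1 <= Cerr.
Proof.
have C1 : 1 <= C by apply: le_trans C6912; rewrite ler1n.
have C0 := C_ge0.
rewrite /Cerr /Ctime /Ctaylor; have : 0 <= C * 2 * (2 * 16 ^+ 3) * 8.
  by rewrite !mulr_ge0.
by lra.
Qed.

Let c1 := Cerr_ge1.
Let c0 : 0 < Cerr. Proof. exact: lt_le_trans c1. Qed.
Let cn0 n : 0 <= n%:R * Cerr * eps.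
Proof. by apply: mulr_ge0; [apply: mulr_ge0; [exact: ler0n|exact: ltW]|exact: ltW]. Qed.
Let d0 : 0 <= dpar. Proof. exact: cn0. Qed.
Let a0 : 0 <= apar. Proof. exact: mulr_ge0 (expR_ge0 _) d0. Qed.
Let b0 : 0 <= bpar. Proof. exact: mulr_ge0 (ler0n _ 4) (ltW gam0). Qed.
Let G0 : 0 <= bpar + apar * (1 + Lmax).
Proof. exact: addr_ge0 b0 (mulr_ge0 a0 (addr_ge0 ler01 Lmax0)). Qed.
Let e0 : 0 <= epar.
Proof.
apply: mulr_ge0; first exact: cn0.
by apply: addr_ge0; [exact: sqr_ge0|apply: mulr_ge0 => //; exact: exprn_ge0].
Qed.
Lemma kpar_ge0 : 0 <= kpar.
Proof. exact: mulr_ge0 (cn0 4) (exprn_ge0 3 lam0). Qed.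

Lemma Kpar_ge : 256 <= Kpar.
Proof.
have e8 : 1 <= expR 8 :> R by rewrite -expR0 ler_expR.
have h : 1 <= Cerr * expR 8 by rewrite -[leLHS]mulr1 ler_pM.
by rewrite /Kpar -mulrA; have := ler_wpM2l (ler0n R 256) h; rewrite mulr1.
Qed.

Definition barrier u w : R := bar lam gam apar bpar dpar epar u w.
Definition barrier1 u w : R := bar1 lam gam apar bpar dpar epar u w.
Definition barrier2 u w : R := bar2 lam gam apar bpar dpar epar u w.
Definition barrier_err u w : R :=
  Ctaylor C * eps * errw lam gam apar bpar dpar epar w * fat lam u w.

Hypothesis epslam : lam * eps <= 16^-1.
Hypothesis epsgam : Kpar * eps <= gam.

Let epsgam16 : 16 * eps <= gam.
Proof.
apply: le_trans epsgam; rewrite ler_wpM2r ?(ltW eps0)//.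
by apply: le_trans Kpar_ge; rewrite ler_nat.
Qed.

Section fixed_w.
Variable w : R.
Hypothesis wg : gam ^+ 2 <= w.
Hypothesis wL : ln (w / gam ^+ 2) <= Lmax.
Let w0 : 0 < w. Proof. by apply: lt_le_trans wg; rewrite exprn_gt0. Qed.
Let r0 := rs_gt0 w0.
Let g2 : 0 < gam ^+ 2. Proof. by rewrite exprn_gt0. Qed.

Lemma gam_rs_le1 : gam * rs w <= 1.
Proof.
rewrite -(@ler_pXn2r _ 2)// ?nnegrE ?mulr_ge0 ?(ltW gam0) ?(ltW r0)//.
by rewrite exprMn rs_sqr// expr1n ler_pdivrMr// mul1r.
Qed.

(** With [y = gam / sqrt w], this is [y (1 - 2 ln y) <= 2] on [[0, 1]]. *)
Lemma gam_rs_ln : gam * rs w * (1 + ln (w / gam ^+ 2)) <= 2.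
Proof.
have p0 : 0 < gam * rs w by rewrite mulr_gt0.
have -> : w / gam ^+ 2 = (gam * rs w)^-1 ^+ 2.
  have h : (gam * rs w) ^+ 2 = gam ^+ 2 / w by rewrite exprMn rs_sqr.
  by rewrite exprVn h invf_div.
have i0 : 0 < (gam * rs w)^-1 by rewrite invr_gt0.
rewrite lnXn//.
have : ln (gam * rs w)^-1 <= (gam * rs w)^-1 - 1.
  rewrite -[X in ln X](addrNK 1) [X in ln X]addrC; apply: le_ln1Dx.
  by rewrite ltrBrDl subrr.
rewrite -(ler_pM2l p0) mulrBr divff ?gt_eqF// mulr1 => h.
rewrite mulr2n !mulrDr mulr1; have := ltW p0; move: h; lra.
Qed.

Let tau2 : tau lam w ^+ 2 <= 2 * (lam ^+ 2 + rs w ^+ 2).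
Proof. by rewrite /tau; have := sqr_ge0 (lam - rs w); lra. Qed.

Let tau3 : tau lam w ^+ 3 <= 4 * (lam ^+ 3 + rs w ^+ 3).
Proof.
rewrite -subr_ge0 /tau.
have -> : 4 * (lam ^+ 3 + rs w ^+ 3) - (lam + rs w) ^+ 3 =
   3 * ((lam + rs w) * (lam - rs w) ^+ 2) by ring.
by rewrite mulr_ge0// mulr_ge0 ?sqr_ge0// addr_ge0// ltW.
Qed.

Let eps_rs : Kpar * (eps * rs w) <= 1.
Proof.
rewrite mulrA; apply: le_trans gam_rs_le1.
by rewrite ler_wpM2r// ltW.
Qed.

(** By [gam_rs_ln] the logarithm in [gco] costs no more than [sqrt w / gam], and [gam] is
    at least [Kpar * eps]. *)
Lemma error_absorbed :
  Cerr * eps * errw lam gam apar bpar dpar epar w <=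
  epar / 2 + dpar / (4 * w) + kpar * fco dpar epar w.
Proof.
set r := rs w; set c := Cerr; set d := dpar; set e := epar; set a := apar.
set g := gco gam a bpar w; set f := fco d e w.
have ri : w^-1 = r ^+ 2 by rewrite /r rs_sqr.
have -> : d / (4 * w) = d * r ^+ 2 / 4 by rewrite -ri; field; rewrite gt_eqF.
have g0 : 0 <= g by exact: gco_ge0.
have f0 : 0 <= f by apply: addr_ge0 => //; apply: mulr_ge0 => //; exact: ltW.
have ce : 0 <= c * eps by apply: mulr_ge0; exact: ltW.
have l3 : 0 <= lam ^+ 3 by exact: exprn_ge0.
have r3 : 0 <= r ^+ 3 by rewrite exprn_ge0// ltW.
have r2 : 0 <= r ^+ 2 by exact: sqr_ge0.
have gG : g + a <= bpar + a * (1 + Lmax).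
  rewrite /g /gco -addrA mulrDr mulr1 lerD2l [leRHS]addrC lerD2r.
  by rewrite ler_wpM2l.
have T1 : c * eps * tau lam w ^+ 2 <=
    2 * (c * eps * lam ^+ 2) + 2 * (c * eps * r ^+ 2).
  by have := ler_wpM2l ce tau2; rewrite -/r; lra.
have eE : e = 32 * (c * eps * lam ^+ 2)
    + 32 * (c * eps * (lam ^+ 3 * (bpar + a * (1 + Lmax)))).
  by rewrite /e /epar -/c -/a; ring.
have dE : d * r ^+ 2 = 512 * (c * eps * r ^+ 2) by rewrite /d /dpar -/c; ring.
have h1 : 0 <= c * eps * lam ^+ 2 by rewrite mulr_ge0// sqr_ge0.
have h2 : 0 <= c * eps * r ^+ 2 by rewrite mulr_ge0.
have G3 : c * eps * (lam ^+ 3 * (g + a)) <=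
    c * eps * (lam ^+ 3 * (bpar + a * (1 + Lmax))).
  by rewrite ler_wpM2l// ler_wpM2l.
have R3 : c * eps * (r ^+ 3 * (g + a)) <= d * r ^+ 2 / 64.
  have -> : c * eps * (r ^+ 3 * (g + a)) = (c * (eps * r * (g + a))) * r ^+ 2 by ring.
  rewrite [leRHS]mulrAC ler_wpM2r//.
  have -> : g + a = bpar + a * (1 + ln (w / gam ^+ 2)) by rewrite /g /gco; ring.
  have -> : eps * r * (bpar + a * (1 + ln (w / gam ^+ 2))) =
    4 * eps * (gam * r) + a * (eps * r * (1 + ln (w / gam ^+ 2))).
    by rewrite /bpar; ring.
  have i1 : 4 * eps * (gam * r) <= 4 * eps.
    by rewrite ler_piMr ?mulr_ge0 ?(ltW eps0)//; exact: gam_rs_le1.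
  have L0 : 0 <= 1 + ln (w / gam ^+ 2).
    by rewrite addr_ge0// ln_ge0// ler_pdivlMr ?mul1r.
  have i2 : Kpar * (eps * r * (1 + ln (w / gam ^+ 2))) <= 2.
    apply: le_trans gam_rs_ln; rewrite 2!mulrA ler_wpM2r//.
    by rewrite ler_wpM2r// ltW.
  have aK : a * 512 * c = 2 * Kpar * d.
    by rewrite /a /apar /Kpar -/d -/c; ring.
  have i3 : c * (a * (eps * r * (1 + ln (w / gam ^+ 2)))) <= d / 128.
    have -> : c * (a * (eps * r * (1 + ln (w / gam ^+ 2)))) =
      (a * 512 * c) * (eps * r * (1 + ln (w / gam ^+ 2))) / 512 by field.
    rewrite aK.
    have -> : 2 * Kpar * d * (eps * r * (1 + ln (w / gam ^+ 2))) / 512 =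
      d * (Kpar * (eps * r * (1 + ln (w / gam ^+ 2)))) / 256 by field.
    by have := ler_wpM2l d0 i2; rewrite -/d; lra.
  have i4 : c * (4 * eps * (gam * r)) <= d / 128.
    have := ler_wpM2l (ltW c0) i1; rewrite -/c => h; apply: (le_trans h).
    by rewrite /d /dpar -/c; lra.
  by rewrite mulrDr; lra.
have K3 : c * eps * (lam ^+ 3 * f) = kpar * f / 4.
  by rewrite /kpar -/c; field.
have F3 : c * eps * (r ^+ 3 * f) <= (d * r ^+ 2 + e) / 256.
  have -> : c * eps * (r ^+ 3 * f) = c * (eps * r) * (r ^+ 2 * f) by ring.
  have -> : r ^+ 2 * f = d * r ^+ 2 + e.
    by rewrite -ri /f /fco; field; rewrite gt_eqF.
  have de0 : 0 <= d * r ^+ 2 + e by rewrite addr_ge0// mulr_ge0.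
  rewrite [leRHS]mulrC ler_wpM2r//.
  have : 256 * (c * (eps * r)) <= Kpar * (eps * r).
    have er0 : 0 <= eps * r by apply: mulr_ge0; exact: ltW.
    have e8 : 1 <= expR 8 :> R by rewrite -expR0 ler_expR.
    have cer0 : 0 <= 256 * (c * (eps * r)).
      by apply: mulr_ge0; [exact: ler0n|apply: mulr_ge0 => //; exact: ltW].
    have := ler_wpM2l cer0 e8; rewrite mulr1 /Kpar -/c.
    by have -> : 256 * (c * (eps * r)) * expR 8 = 256 * c * expR 8 * (eps * r) by ring.
  by have := eps_rs; rewrite -/r; lra.
have T3 (y : R) : 0 <= y -> c * eps * (y * tau lam w ^+ 3) <=
   4 * (c * eps * (lam ^+ 3 * y)) + 4 * (c * eps * (r ^+ 3 * y)).
  move=> y0; have := ler_wpM2l ce (ler_wpM2l y0 tau3); rewrite -/r; lra.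
have ga0 : 0 <= g + a by rewrite addr_ge0.
have Tg := T3 _ ga0.
have Tf := T3 _ f0.
have kf0 : 0 <= kpar * f by rewrite mulr_ge0// kpar_ge0.
have -> : c * eps * errw lam gam a bpar d e w = c * eps * tau lam w ^+ 2
  + c * eps * ((g + a) * tau lam w ^+ 3) + c * eps * (f * tau lam w ^+ 3).
  by rewrite /errw -/g -/f; ring.
have h3 : 0 <= c * eps * (lam ^+ 3 * (bpar + a * (1 + Lmax))).
  by apply: mulr_ge0 => //; exact: mulr_ge0.
rewrite K3 in Tf.
exact: sum_errors h1 h2 h3 T1 Tg Tf eE dE G3 R3 F3.
Qed.

Lemma barrier_err_ge0 u : 0 <= barrier_err u w.
Proof.
apply: mulr_ge0; last exact/ltW/fat_gt0.
apply: mulr_ge0; last exact: errw_ge0.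
exact: mulr_ge0 Ctaylor_ge0 (ltW eps0).
Qed.

Lemma barrier_taylor u x : barrier (u + x) w <= barrier u w
  + barrier1 u w * x + barrier2 u w / 2 * x ^+ 2
  + barrier_err u w * (x ^+ 2 * cosh2 (x / (4 * eps))).
Proof. exact: bar_taylor. Qed.

(** The heat operator in [bar_time] pays for the second-order term of
    [barrier_taylor], and its surplus for the error, by [error_absorbed]; what is
    left over is a growth of rate [4 * kpar]. *)
Lemma barrier_step u s : 0 <= s <= 12 * eps ^+ 2 ->
  barrier u w + s * (barrier2 u w / 2) + 8 * s * barrier_err u w
    <= expR (4 * kpar * s) * barrier u (w + s).
Proof.
move=> /andP[s0 s12].
have [] := @bar_time R lam gam eps apar bpar dpar epar lam0 gam0 eps0 a0 b0 d0 e0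
  (lexx _) epslam epsgam16 C C6912 u w s wg.
  by rewrite s0.
rewrite -!/(barrier _ _) -/(barrier2 _ _).
have F0 := ltW (fat_gt0 lam w0 u).
have ws0 : 0 < w + s by rewrite ltr_wpDr.
have F'0 := ltW (fat_gt0 lam ws0 u).
have abs := ler_wpM2r F0 error_absorbed.
have wgs : gam ^+ 2 <= w + s by rewrite (le_trans wg)// lerDl.
have barF := bar_ge_fat lam dpar epar gam0 a0 b0 ws0 wgs u.
rewrite -/(barrier _ _) in barF.
rewrite /barrier_err.
set E := errw _ _ _ _ _ _ _ in abs *; set F := fat lam u w in abs F0 *.
set F' := fat lam u (w + s) in barF F'0 *.
set f := fco dpar epar w in abs *; set f' := fco dpar epar (w + s) in barF.
have f0 : 0 <= f by apply: addr_ge0 => //; apply: mulr_ge0 => //; exact: ltW.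
have ff' : f <= f' by rewrite lerD2l ler_wpM2l// lerDl.
move=> h FF'.
have fF : f * F <= 4 * barrier u (w + s).
  apply: (@le_trans _ _ (f' * (4 * F'))); first by apply: ler_pM.
  by rewrite mulrCA ler_pM2l.
have k0 := kpar_ge0.
have kfF := ler_wpM2l k0 fF.
have B0 : 0 <= barrier u (w + s).
  by apply: le_trans barF; rewrite mulr_ge0// (le_trans f0).
apply: (@le_trans _ _ ((1 + 4 * kpar * s) * barrier u (w + s))); last first.
  by rewrite ler_wpM2r// expR_ge1Dx.
have abs' := ler_wpM2l s0 abs; have kfF' := ler_wpM2l s0 kfF.
exact: combine abs' kfF' h.
Qed.

Let fco_fat_ge0 u : 0 <= fco dpar epar w * fat lam u w.
Proof.
apply: mulr_ge0; last exact/ltW/fat_gt0.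
by apply: addr_ge0 => //; apply: mulr_ge0 => //; exact: ltW.
Qed.

Lemma barrier_ge0 u : 0 <= barrier u w.
Proof.
apply: le_trans (bar_ge_fat lam dpar epar gam0 a0 b0 w0 wg u).
exact: fco_fat_ge0.
Qed.

(** At the final time [Phi (u / sqrt w)] is a smoothed indicator of [u > 0]; the bump,
    whose height [bpar / sqrt w] is at least [2], fills the gap below [1]. *)
Lemma barrier_final u : w <= 3 * gam ^+ 2 -> 0 <= u -> 1 <= barrier u w.
Proof.
move=> w3 u0.
have z0 : 0 <= u * rs w by rewrite mulr_ge0// ltW.
apply: le_trans (Phi_ge1 z0) _.
rewrite /barrier /bar -addrA lerD2l.
apply: (@le_trans _ _ (bpar * bump u w)); last first.
  rewrite -[leLHS]addr0; apply: lerD; last exact: fco_fat_ge0.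
  by apply: ler_wpM2r; [exact: bump_ge0|exact: gco_ge].
have -> : - (u * rs w) ^+ 2 / 2 = - (u ^+ 2 / (2 * w)).
  by rewrite exprMn rs_sqr//; field; rewrite gt_eqF.
rewrite /bump mulrA ler_wpM2r ?expR_ge0// /bpar -mulrA.
have : 2^-1 <= gam * rs w; last by lra.
rewrite -(@ler_pXn2r _ 2)// ?nnegrE ?invr_ge0 ?mulr_ge0 ?(ltW gam0) ?(ltW r0)//.
have -> : 2^-1 ^+ 2 = 4^-1 :> R by field.
rewrite exprMn rs_sqr// ler_pdivlMr//; move: w3 (ltW g2); lra.
Qed.

End fixed_w.

(** Crude bounds, from which the integrals over the walk are seen to be finite. *)
Lemma barrier_bounded W : 1 <= W ->
  exists2 K, 0 <= K & forall u w, gam ^+ 2 <= w <= W ->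
  [/\ barrier u w <= 1 + K * expR (lam * u),
      `|barrier1 u w| <= K * expR (lam * u),
      `|barrier2 u w| <= K * expR (lam * u) &
      barrier_err u w <= K * expR (lam * u)].
Proof.
move=> W1; have W0 : 0 < W by exact: lt_le_trans W1.
have g2 : 0 < gam ^+ 2 by rewrite exprn_gt0.
pose t := lam + gam^-1.
pose g := bpar + apar * ln (W / gam ^+ 2).
pose f := dpar + epar * W.
pose M := expR (lam ^+ 2 * W / 2) / gam.
have t0 : 0 <= t by rewrite addr_ge0// invr_ge0 ltW.
have M0 : 0 <= M by rewrite divr_ge0 ?expR_ge0// ltW.
have f0 : 0 <= f by apply: addr_ge0 => //; apply: mulr_ge0 => //; exact: ltW.
have CT0 : 0 <= Ctaylor C * eps by apply: mulr_ge0 (Ctaylor_ge0) (ltW eps0).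
pose Gp := `|g|.
have C0 := C_ge0.
have C1728 : 1728 <= C by apply: le_trans C6912; rewrite ler_nat.
have C3456 : 3456 <= C by apply: le_trans C6912; rewrite ler_nat.
have C4 : 4 <= C by apply: le_trans C6912; rewrite ler_nat.
pose k0 := Gp * C + f.
pose k1 := C + Gp * (C * t) + f * t.
pose k2 := C * t + Gp * (C * t ^+ 2) + f * (C * t ^+ 2).
pose k3 := Ctaylor C * eps * (t ^+ 2 + (Gp + apar) * t ^+ 3 + f * t ^+ 3).
have Gp0 : 0 <= Gp by exact: normr_ge0.
have tt0 n : 0 <= t ^+ n by exact: exprn_ge0.
have k00 : 0 <= k0 by rewrite /k0 addr_ge0// mulr_ge0.
have k10 : 0 <= k1 by rewrite /k1 !addr_ge0// !mulr_ge0.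
have k20 : 0 <= k2 by rewrite /k2 !addr_ge0 ?mulr_ge0.
have k30 : 0 <= k3.
  apply: mulr_ge0 => //; apply: addr_ge0; last exact: mulr_ge0.
  by apply: addr_ge0 => //; apply: mulr_ge0 => //; exact: addr_ge0.
exists ((k0 + k1 + k2 + k3) * M).
  apply: mulr_ge0 => //; apply: addr_ge0 => //; apply: addr_ge0 => //.
  exact: addr_ge0.
move=> u w /andP[wg wW].
have w0 : 0 < w by exact: lt_le_trans wg.
have r0 := rs_gt0 w0.
have rg : rs w <= gam^-1.
  rewrite lef_pV2 ?posrE// ?sqrtr_gt0//.
  by rewrite -[leLHS](ger0_norm (ltW gam0)) -sqrtr_sqr ler_wsqrtr.
have tt : tau lam w <= t by rewrite lerD2l.
have tw0 : 0 <= tau lam w by exact/ltW/tau_gt0.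
have gc0 : 0 <= gco gam apar bpar w by exact: gco_ge0.
have gg : gco gam apar bpar w <= Gp.
  apply: le_trans (ler_norm _); rewrite lerD2l ler_wpM2l//.
  by rewrite ler_ln ?posrE ?divr_gt0// ler_pM2r ?invr_gt0.
have fc0 : 0 <= fco dpar epar w.
  by apply: addr_ge0 => //; apply: mulr_ge0 => //; exact: ltW.
have ff : fco dpar epar w <= f by rewrite lerD2l ler_wpM2l.
have F0 := ltW (fat_gt0 lam w0 u).
have FM : fat lam u w <= M * expR (lam * u).
  apply: le_trans (fat_le_expR lam w0 u) _.
  rewrite expRD /M mulrAC [leRHS]mulrC mulrA -mulrA -[leRHS]mulrA.
  rewrite ler_wpM2l ?expR_ge0// mulrC ler_pM ?expR_ge0 ?(ltW r0)//.
  by rewrite ler_expR ler_pM2r// ler_wpM2l// sqr_ge0.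
have tX n : tau lam w ^+ n <= t ^+ n by rewrite lerXn2r ?nnegrE.
have tX0 n : 0 <= tau lam w ^+ n by exact: exprn_ge0.
have fin k : 0 <= k -> k <= k0 + k1 + k2 + k3 ->
    k * fat lam u w <= (k0 + k1 + k2 + k3) * M * expR (lam * u).
  by move=> kk0 kk; rewrite -mulrA; apply: ler_pM.
have nn : `|nrm R| <= 1 by rewrite ger0_norm ?nrm_le1// ltW// nrm_gt0.
have gn : `|gco gam apar bpar w| <= Gp by rewrite ger0_norm.
have fn : `|fco dpar epar w| <= f by rewrite ger0_norm.
have b0' := bump_ge0 w0 u.
have tau_n n : 0 <= tau lam w ^+ n * fat lam u w by exact: mulr_ge0.
have tFt n : tau lam w ^+ n * fat lam u w <= t ^+ n * fat lam u w.
  by rewrite ler_wpM2r.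
have b0n : bump u w <= C * fat lam u w.
  have h : bump u w <= 1728 * fat lam u w by exact: bump_le.
  by apply: (le_trans h); rewrite ler_wpM2r.
have bn : `|bump u w| <= C * fat lam u w by rewrite ger0_norm.
have b1n : `|bump1 u w| <= C * t * fat lam u w.
  apply: le_trans (bump1_le lam0 w0 u) _; rewrite -!mulrA.
  by apply: ler_pM; [exact: ler0n|exact: (tau_n 1%N)|exact: C1728|exact: (tFt 1%N)].
have b2n : `|bump2 u w| <= C * t ^+ 2 * fat lam u w.
  apply: le_trans (bump2_le lam0 w0 u) _; rewrite -[leLHS]mulrA -[leRHS]mulrA.
  by apply: ler_pM; [exact: ler0n|exact: tau_n|exact: C3456|exact: tFt].
have f1n : `|fat1 lam u w| <= t * fat lam u w.
  by apply: le_trans (fat1_le lam0 w0 u) _; exact: (tFt 1%N).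
have f2n : `|fat2 lam u w| <= C * t ^+ 2 * fat lam u w.
  apply: le_trans (fat2_le lam0 w0 u) _; rewrite -[leLHS]mulrA -[leRHS]mulrA.
  by apply: ler_pM; [exact: ler0n|exact: tau_n|exact: C4|exact: tFt].
have [s0 s1 s2 s3] := parts_le_sum k00 k10 k20 k30.
split.
- rewrite /barrier /bar -addrA; apply: lerD; first exact: Phi_le1.
  apply: le_trans (fin k0 k00 s0).
  have -> : k0 * fat lam u w = Gp * (C * fat lam u w) + f * fat lam u w.
    by rewrite /k0; ring.
  by apply: lerD; [exact: ler_pM|exact: ler_wpM2r].
- apply: le_trans (fin k1 k10 s1).
  apply: le_trans (normD_le (normD_le (normM_le nn bn) (normM_le gn b1n))
    (normM_le fn f1n)) _.
  suff -> : k1 * fat lam u w = 1 * (C * fat lam u w) + Gp * (C * t * fat lam u w)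
    + f * (t * fat lam u w) by [].
  by rewrite /k1; ring.
- apply: le_trans (fin k2 k20 s2).
  apply: le_trans (normD_le (normD_le (normM_le nn b1n) (normM_le gn b2n))
    (normM_le fn f2n)) _.
  suff -> : k2 * fat lam u w = 1 * (C * t * fat lam u w)
    + Gp * (C * t ^+ 2 * fat lam u w) + f * (C * t ^+ 2 * fat lam u w) by [].
  by rewrite /k2; ring.
- apply: le_trans (fin k3 k30 s3).
  rewrite /barrier_err /k3; apply: ler_wpM2r => //; apply: ler_wpM2l => //.
  rewrite /errw; apply: lerD; first apply: lerD => //.
  + by apply: ler_pM; [exact: addr_ge0|exact: tX0|rewrite lerD2r|exact: tX].
  + by apply: ler_pM; [exact: fc0|exact: tX0|exact: ff|exact: tX].
Qed.

End supersolution.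

(** * Conditional inequalities in integrated form *)

Import HBNNSimple.

Section pull_out.
Context d (T : measurableType d) (R : realType) (P : probability T R).
Variable G : set (set T).
Hypotheses (sG : sigma_algebra setT G) (GT : G `<=` measurable).
Local Notation TG := (g_sigma_algebraType G).

Lemma sub_measurable (A : set T) : measurable (A : set TG) -> G A.
Proof. by rewrite measurable_g_measurableTypeE. Qed.

Lemma measurable_wrt_fun (W : T -> R) :
  measurable_wrt G W -> measurable_fun [set: T] W.
Proof.
move=> mW _ B mB; rewrite setTI; apply: GT; apply: sub_measurable.
by have := mW measurableT B mB; rewrite setTI.
Qed.

Let simple_integral (phi : {nnsfun TG >-> R}) (X : T -> R) :
    (forall w, 0 <= X w) -> measurable_fun [set: T] X ->
  (\int[P]_w (phi w * X w)%:E = \sum_(y \in range phi)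
    y%:E * \int[P]_(w in phi @^-1` [set y]) (X w)%:E)%E.
Proof.
move=> X0 mX.
have mpre y : measurable (phi @^-1` [set y] : set T).
  by apply: GT; apply: sub_measurable; exact: measurable_funPTI.
have ind0 y w : 0 <= y * (\1_(phi @^-1` [set y]) w : R).
  by have := nnfun_muleindic_ge0 phi y w; rewrite -EFinM lee_fin.
transitivity (\int[P]_w \sum_(y \in range phi)
    (y * (\1_(phi @^-1` [set y]) w : R) * X w)%:E)%E.
  apply: eq_integral => w _; rewrite fsumEFin//.
  by rewrite -mulr_fsuml -fimfunE.
rewrite ge0_integral_fsum//; last first.
- by move=> y w _; rewrite lee_fin mulr_ge0.
- move=> y; apply/measurable_EFinP; apply: measurable_funM => //.
  by apply: measurable_funM => //; exact: measurable_indic.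
apply: eq_fsbigr => y; rewrite inE => -[w0 _ <-].
have y0 : 0 <= phi w0 by [].
under eq_integral do rewrite -mulrA EFinM.
rewrite ge0_integralZl_EFin//; first last.
- apply/measurable_EFinP; apply: measurable_funM => //; exact: measurable_indic.
- by move=> w _; rewrite lee_fin mulr_ge0.
congr (_ * _)%E; rewrite [RHS]integral_mkcond; apply: eq_integral => w _.
rewrite patchE indicE; case: ifPn => _; first by rewrite mul1r.
by rewrite mul0r.
Qed.

(** Nonnegative measurable functions are increasing limits of simple ones, so an
    inequality between integrals over the events of [G] passes to nonnegative
    [G]-measurable weights. *)
Lemma weighted_integral_le (W X1 X2 : T -> R) :
    measurable_wrt G W -> (forall w, 0 <= W w) ->
    measurable_fun [set: T] X1 -> measurable_fun [set: T] X2 ->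
    (forall w, 0 <= X1 w) -> (forall w, 0 <= X2 w) ->
    (forall A, G A -> (\int[P]_(w in A) (X1 w)%:E <= \int[P]_(w in A) (X2 w)%:E)%E) ->
  (\int[P]_w (W w * X1 w)%:E <= \int[P]_w (W w * X2 w)%:E)%E.
Proof.
move=> mW W0 mX1 mX2 X10 X20 leX.
have mWE : measurable_fun [set: TG] (EFin \o (W : TG -> R)).
  exact/measurable_EFinP.
have W0E (w : TG) : [set: TG] w -> (0 <= (EFin \o (W : TG -> R)) w)%E.
  by rewrite lee_fin.
pose phi := nnsfun_approx measurableT mWE.
have mphi n : measurable_fun [set: T] (phi n : T -> R).
  by apply: measurable_wrt_fun; exact: measurable_funP.
have lim (X : T -> R) : (forall w, 0 <= X w) -> measurable_fun [set: T] X ->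
    (\int[P]_w (phi n w * X w)%:E)%E @[n --> \oo] --> (\int[P]_w (W w * X w)%:E)%E.
  move=> X0 mX.
  have -> : (\int[P]_w (W w * X w)%:E =
             \int[P]_w limn (fun n => (phi n w * X w)%:E))%E.
    apply: eq_integral => w _; apply/esym/cvg_lim => //.
    under eq_fun do rewrite EFinM; rewrite EFinM.
    apply: cvgeZr => //.
    exact: (cvg_nnsfun_approx measurableT mWE W0E).
  apply: (@cvg_monotone_convergence _ T R P setT measurableT
    (fun n w => (phi n w * X w)%:E)).
  - by move=> n; apply/measurable_EFinP/measurable_funM.
  - by move=> n w _; rewrite lee_fin mulr_ge0.
  - move=> w _ m n mn; rewrite lee_fin ler_wpM2r//.
    by have /lefP := nd_nnsfun_approx measurableT mWE mn; apply.
have L1 := lim _ X10 mX1; have L2 := lim _ X20 mX2.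
rewrite -(cvg_lim _ L1)// -(cvg_lim _ L2)//.
apply: lee_lim; [by apply/cvg_ex; eexists; exact: L1|by apply/cvg_ex; eexists; exact: L2|].
apply: nearW => n; rewrite !simple_integral//; apply: lee_fsum => //.
move=> _ [w _ <-]; rewrite lee_wpmul2l ?lee_fin//.
by apply: leX; apply: sub_measurable; exact: measurable_funPTI.
Qed.

Lemma weighted_integral_eq (W X1 X2 : T -> R) :
    measurable_wrt G W ->
    measurable_fun [set: T] X1 -> measurable_fun [set: T] X2 ->
    (forall w, 0 <= X1 w) -> (forall w, 0 <= X2 w) ->
    (forall A, G A -> (\int[P]_(w in A) (X1 w)%:E = \int[P]_(w in A) (X2 w)%:E)%E) ->
  (\int[P]_w (W w * X1 w)%:E = \int[P]_w (W w * X2 w)%:E)%E.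
Proof.
move=> mW mX1 mX2 X10 X20 eqX.
have eq0 V : measurable_wrt G V -> (forall w, 0 <= V w) ->
    (\int[P]_w (V w * X1 w)%:E = \int[P]_w (V w * X2 w)%:E)%E.
  move=> mV V0; apply/eqP; rewrite eq_le !weighted_integral_le//.
    by move=> A GA; rewrite eqX.
  by move=> A GA; rewrite eqX.
have parts X : (forall w, 0 <= X w) -> (\int[P]_w (W w * X w)%:E =
    \int[P]_w (Num.max (W w) 0 * X w)%:E - \int[P]_w (Num.max (- W w) 0 * X w)%:E)%E.
  move=> X0; rewrite integralE; congr (_ - _)%E; apply: eq_integral => w _.
    by rewrite funeposE -EFin_max maxr_pMl// mul0r.
  by rewrite funenegE -EFinN -EFin_max maxr_pMl// mul0r mulNr.
rewrite !parts// !eq0//.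
- by apply: measurable_maxr => //; exact: measurable_funN.
- by move=> w; rewrite le_max lexx orbT.
- exact: measurable_maxr.
- by move=> w; rewrite le_max lexx orbT.
Qed.

End pull_out.

(** * One step of the walk in conditional mean *)

Section cosh_series.
Variable R : realType.
Implicit Types y : R.

Definition cosh2_term y k : R := (y ^+ k + (- y) ^+ k) / k`!%:R.

Lemma cosh2_termE y k : cosh2_term y k = if odd k then 0 else 2 * y ^+ k / k`!%:R.
Proof.
rewrite /cosh2_term exprNn -signr_odd; case: odd => /=.
  by rewrite expr1 mulN1r subrr mul0r.
by rewrite expr0 mul1r -mulr2n mulr_natl.
Qed.

Lemma cosh2_term_ge0 y k : 0 <= cosh2_term y k.
Proof.
rewrite cosh2_termE; case: ifPn => // ek.
by rewrite divr_ge0// mulr_ge0// exprn_even_ge0.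
Qed.

Lemma cvg_cosh2 y : series (cosh2_term y) n @[n --> \oo] --> cosh2 y.
Proof.
have -> : (fun n => series (cosh2_term y) n) =
    (series (exp_coeff y) \+ series (exp_coeff (- y))).
  apply/funext => n /=; rewrite /series/= -big_split/=.
  by apply: eq_bigr => k _; rewrite /cosh2_term mulrDl.
by apply: cvgD; exact: is_cvg_series_exp_coeff.
Qed.

(** [(k+1)(k+2)] is the excess of the factorial in the moment of order [k + 2] over the
    one in the series of [cosh2], and [4] comes from the scale [4 eps]. *)
Lemma binom_geometric k : (k.+1 * k.+2)%:R / 4 ^+ k <= 2 * (3 / 4) ^+ k :> R.
Proof.
rewrite expr_div_n mulrA ler_pM2r ?invr_gt0 ?exprn_gt0//.
rewrite -natrX -natrM ler_nat.
elim: k => // k IH; rewrite expnS mulnCA.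
apply: leq_trans (_ : 3 * (k.+1 * k.+2) <= _)%N; last by rewrite leq_mul2l IH.
rewrite mulnA [(k.+2 * _)%N]mulnC leq_mul2r; apply/orP; right.
by rewrite mulnS -(addn3 k) addnC leq_add2l leq_pmull.
Qed.

Lemma geometric_le n : \sum_(0 <= k < n) 2 * (3 / 4) ^+ k <= 8 :> R.
Proof.
suff -> : \sum_(0 <= k < n) 2 * (3 / 4) ^+ k = 8 - 8 * (3 / 4) ^+ n :> R.
  by rewrite gerBl mulr_ge0// exprn_ge0// divr_ge0.
elim: n => [|n IH]; first by rewrite big_geq// expr0 mulr1 subrr.
by rewrite big_nat_recr//= IH exprS; field.
Qed.

Lemma cosh2_le y : cosh2 y <= 8 + y ^+ 2 * cosh2 y.
Proof.
have c0 := cosh2_ge0 y.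
have [y1|y1] := leP 1 (y ^+ 2).
  by rewrite -[leLHS]add0r lerD// ler_peMl.
have y1' : `|y| <= 1.
  by rewrite -(@ler_pXn2r _ 2)// ?nnegrE// expr1n -normrX ger0_norm ?sqr_ge0// ltW.
have e4 : expR 1 <= 4 :> R.
  have -> : expR 1 = expR (2^-1) * expR (2^-1) :> R.
    by rewrite -expRD; congr expR; field.
  by have := @expR_half_lt2 R; have := @expR_ge0 R 2^-1; nra.
have e1 : expR y <= expR 1 by rewrite ler_expR (le_trans (ler_norm _)).
have e2 : expR (- y) <= expR 1.
  by rewrite ler_expR (le_trans (ler_norm _))// normrN.
have : 0 <= y ^+ 2 * cosh2 y by rewrite mulr_ge0// sqr_ge0.
rewrite {2}/cosh2; lra.
Qed.

End cosh_series.

Lemma max_parts (R : realDomainType) (x : R) :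
  x = Num.max x 0 - Num.max (- x) 0.
Proof. by rewrite /Order.max; case: ltP => ?; case: ltP => ?; lra. Qed.

Section one_step.
Context d (T : measurableType d) (R : realType) (P : probability T R).
Variable G : set (set T).
Hypotheses (sG : sigma_algebra setT G) (GT : G `<=` measurable).
Variables (xi s : T -> R) (eps : R).
Hypotheses (eps0 : 0 < eps) (mxi : measurable_fun [set: T] xi).
Hypotheses (ms : measurable_wrt G s) (s0 : forall w, 0 <= s w).
Hypothesis s12 : forall w, s w <= 12 * eps ^+ 2.

Local Open Scope ereal_scope.
Hypothesis centered : forall A, G A ->
  \int[P]_(w in A) (Num.max (xi w) 0)%:E = \int[P]_(w in A) (Num.max (- xi w) 0)%:E.
Hypothesis second_moment : forall A, G A ->
  \int[P]_(w in A) (xi w ^+ 2)%:E = \int[P]_(w in A) (s w)%:E.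
Hypothesis even_moments : forall A j, G A ->
  \int[P]_(w in A) (xi w ^+ (2 * j).+2)%:E <=
    (2^-1 * (2 * j).+2`!%:R * eps ^+ (2 * j))%:E * \int[P]_(w in A) (s w)%:E.

Let msT : measurable_fun [set: T] s. Proof. exact: measurable_wrt_fun ms. Qed.

Let mG A : G A -> measurable A. Proof. exact: GT. Qed.

Let mcosh : measurable_fun [set: T] (fun w => cosh2 (xi w / (4 * eps))).
Proof.
apply: measurable_funD; apply: measurableT_comp => //; first exact: measurable_funM.
by apply: measurable_funN; exact: measurable_funM.
Qed.

(** Only even powers survive in the expansion of [cosh2], and the Bernstein
    factorials cancel those of the series, leaving a geometric sum. *)
Lemma cosh_moment A : G A ->
  \int[P]_(w in A) (xi w ^+ 2 * cosh2 (xi w / (4 * eps)))%:E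
    <= \int[P]_(w in A) (8 * s w)%:E.
Proof.
move=> GA; have mA := mG GA.
have msA : measurable_fun A s by exact: measurable_funTS.
have mxiA : measurable_fun A xi by exact: measurable_funTS.
have Is0 : 0 <= \int[P]_(w in A) (s w)%:E.
  by apply: integral_ge0 => w _; rewrite lee_fin.
rewrite [leRHS](_ : _ = 8%:E * \int[P]_(w in A) (s w)%:E); last first.
  rewrite -ge0_integralZl_EFin//; first by move=> w _; rewrite lee_fin.
  exact/measurable_EFinP.
pose g n w := (xi w ^+ 2 * series (cosh2_term (xi w / (4 * eps))) n)%:E.
have mterm k : measurable_fun A
    (fun w => (xi w ^+ 2 * cosh2_term (xi w / (4 * eps)) k)%R).
  apply: measurable_funM; first exact: measurable_funX.
  apply: measurable_funM => //; apply: measurable_funD; apply: measurable_funX.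
    exact: measurable_funM.
  by apply: measurable_funN; exact: measurable_funM.
have gE n w : g n w = \sum_(0 <= k < n) (xi w ^+ 2 * cosh2_term (xi w / (4 * eps)) k)%:E.
  by rewrite /g /series/= mulr_sumr sumEFin.
have term0 k w : 0 <= (xi w ^+ 2 * cosh2_term (xi w / (4 * eps)) k)%:E.
  by rewrite lee_fin mulr_ge0 ?sqr_ge0 ?cosh2_term_ge0.
have lim : \int[P]_(w in A) g n w @[n --> \oo] -->
    \int[P]_(w in A) (xi w ^+ 2 * cosh2 (xi w / (4 * eps)))%:E.
  have -> : \int[P]_(w in A) (xi w ^+ 2 * cosh2 (xi w / (4 * eps)))%:E =
    \int[P]_(w in A) limn (g^~ w).
    apply: eq_integral => w _; apply/esym/cvg_lim => //.
    apply: cvg_EFin; first exact: nearW.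
    by apply: cvgMr; exact: cvg_cosh2.
  apply: cvg_monotone_convergence => //.
  - move=> n; rewrite (_ : g n = fun w =>
      \sum_(0 <= k < n) (xi w ^+ 2 * cosh2_term (xi w / (4 * eps)) k)%:E).
      by apply: emeasurable_sum => k; exact/measurable_EFinP.
    by apply/funext => w; exact: gE.
  - by move=> n w _; rewrite gE sume_ge0.
  - move=> w _ m n mn; rewrite !gE; exact: lee_sum_nneg_natr.
rewrite -(cvg_lim _ lim)//; apply: lime_le; first by apply/cvg_ex; eexists; exact: lim.
apply: nearW => n; under eq_integral do rewrite gE.
rewrite ge0_integral_sum//; last by move=> k; exact/measurable_EFinP.
apply: (@le_trans _ _ (\sum_(0 <= k < n) (2 * (3 / 4) ^+ k)%:E * \int[P]_(w in A) (s w)%:E)).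
  apply: lee_sum => k _.
  have [ok|ek] := boolP (odd k).
    rewrite integral0_eq; first by rewrite mule_ge0// lee_fin mulr_ge0// exprn_ge0// divr_ge0.
    by move=> w _; rewrite cosh2_termE ok mulr0.
  have kE : k = (2 * k./2)%N by rewrite mul2n -[LHS]odd_double_half (negbTE ek).
  have ck0 : (0 <= 2 / (k`!%:R * (4 * eps) ^+ k))%R.
    by rewrite divr_ge0// mulr_ge0// exprn_ge0// mulr_ge0// ltW.
  under eq_integral => w _.
    have -> : (xi w ^+ 2 * cosh2_term (xi w / (4 * eps)) k =
       2 / (k`!%:R * (4 * eps) ^+ k) * xi w ^+ k.+2)%R.
      rewrite cosh2_termE (negbTE ek) expr_div_n -[k.+2]addn2 exprD invfM.
      by move: ((4 * eps) ^+ k)^-1%R (xi w ^+ k)%R (k`!%:R : R)^-1%R => p q r; ring.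
    rewrite EFinM; over.
  rewrite ge0_integralZl_EFin//; last 2 first.
  - by move=> w _; rewrite lee_fin exprn_even_ge0//= negbK.
  - by apply/measurable_EFinP; exact: measurable_funX.
  have := even_moments k./2 GA; rewrite -kE => em.
  apply: le_trans (lee_wpmul2l _ em) _; first by rewrite lee_fin.
  rewrite muleA -EFinM; apply: lee_wpmul2r => //; rewrite lee_fin.
  apply: le_trans (binom_geometric R k).
  rewrite !factS !natrM exprMn.
  have f0 : ((k`!%:R : R) != 0)%R by rewrite pnatr_eq0 -lt0n fact_gt0.
  have e0 : (eps ^+ k != 0)%R by rewrite expf_neq0// gt_eqF.
  have p0 : ((4 ^+ k : R) != 0)%R by rewrite expf_neq0.
  rewrite le_eqVlt; apply/orP; left; apply/eqP; field.
  by rewrite f0 e0 p0.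
rewrite -ge0_sume_distrl; last by move=> k _; rewrite lee_fin mulr_ge0// exprn_ge0// divr_ge0.
apply: lee_wpmul2r => //; rewrite sumEFin lee_fin; exact: geometric_le.
Qed.

Section weights.
Variable W : T -> R.
Hypotheses (mW : measurable_wrt G W) (W0 : forall w, (0 <= W w)%R).
Hypothesis intW : \int[P]_w (W w)%:E < +oo.

Let mWT : measurable_fun [set: T] W. Proof. exact: measurable_wrt_fun mW. Qed.

Lemma weighted_second_moment :
  \int[P]_w (W w * xi w ^+ 2)%:E = \int[P]_w (W w * s w)%:E.
Proof.
apply: (weighted_integral_eq sG GT) => //; first exact: measurable_funX.
by move=> w; exact: sqr_ge0.
Qed.

Lemma weighted_cosh_moment :
  \int[P]_w (W w * (xi w ^+ 2 * cosh2 (xi w / (4 * eps))))%:E <=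
  \int[P]_w (W w * (8 * s w))%:E.
Proof.
apply: (weighted_integral_le sG GT) => //.
- by apply: measurable_funM => //; exact: measurable_funX.
- exact: measurable_funM.
- by move=> w; rewrite mulr_ge0 ?sqr_ge0 ?cosh2_ge0.
- by move=> w; rewrite mulr_ge0.
- exact: cosh_moment.
Qed.

Lemma weighted_s_lty : \int[P]_w (W w * s w)%:E < +oo.
Proof.
apply: (@le_lt_trans _ _ (\int[P]_w ((12 * eps ^+ 2)%:E * (W w)%:E))).
  apply: ge0_le_integral => //.
  - by move=> w _; rewrite lee_fin mulr_ge0.
  - exact/measurable_EFinP/measurable_funM.
  - by apply: measurable_funeM; exact/measurable_EFinP.
  - by move=> w _; rewrite -EFinM lee_fin mulrC ler_wpM2r.
rewrite ge0_integralZl_EFin//.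
- by apply: lte_mul_pinfty => //; rewrite lee_fin mulr_ge0// sqr_ge0.
- by move=> w _; rewrite lee_fin.
- exact/measurable_EFinP.
- by rewrite mulr_ge0// sqr_ge0.
Qed.

Lemma weighted_cosh_lty :
  \int[P]_w (W w * (xi w ^+ 2 * cosh2 (xi w / (4 * eps))))%:E < +oo.
Proof.
apply: (le_lt_trans weighted_cosh_moment).
under eq_integral do rewrite mulrCA EFinM.
rewrite ge0_integralZl_EFin//.
- by apply: lte_mul_pinfty => //; exact: weighted_s_lty.
- by move=> w _; rewrite lee_fin mulr_ge0.
- exact/measurable_EFinP/measurable_funM.
Qed.

(** Exponential moments propagate, which keeps all the weights integrable. *)
Lemma weighted_exp_lty lam : (0 <= lam)%R -> (lam * eps <= 4^-1)%R ->
  \int[P]_w (W w * expR (lam * xi w))%:E < +oo.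
Proof.
move=> lam0 le4.
apply: (@le_lt_trans _ _ (\int[P]_w (8%:E * (W w)%:E + ((4 * eps) ^- 2)%:E *
    (W w * (xi w ^+ 2 * cosh2 (xi w / (4 * eps))))%:E))).
  apply: ge0_le_integral => //.
  - by move=> w _; rewrite lee_fin mulr_ge0// expR_ge0.
  - apply/measurable_EFinP/measurable_funM => //.
    by apply: measurableT_comp => //; exact: measurable_funM.
  - apply: emeasurable_funD; apply: measurable_funeM; apply/measurable_EFinP => //.
    apply: measurable_funM => //; apply: measurable_funM => //.
    exact: measurable_funX.
  - move=> w _; rewrite -!EFinM -EFinD lee_fin.
    have -> : (8 * W w + (4 * eps) ^- 2 * (W w * (xi w ^+ 2 * cosh2 (xi w / (4 * eps)))) =
      W w * (8 + (xi w / (4 * eps)) ^+ 2 * cosh2 (xi w / (4 * eps))))%R.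
      by rewrite expr_div_n; ring.
    rewrite ler_wpM2l// (le_trans _ (cosh2_le _))//.
    apply: le_trans (expR_norm_le_cosh2 _); rewrite ler_expR.
    rewrite (le_trans (ler_norm _))// !normrM (ger0_norm lam0) mulrC.
    rewrite ler_wpM2l// ger0_norm ?invr_ge0 ?mulr_ge0 ?(ltW eps0)//.
    rewrite invfM ler_pdivlMr//.
rewrite ge0_integralD//; first last.
- apply/measurable_EFinP; apply: measurable_funM => //.
  by apply: measurable_funM => //; apply: measurable_funM => //; exact: measurable_funX.
- move=> w _; rewrite -EFinM lee_fin mulr_ge0//; first by rewrite invr_ge0 sqr_ge0.
  by rewrite mulr_ge0// mulr_ge0 ?sqr_ge0 ?cosh2_ge0.
- by apply/measurable_EFinP; exact: measurable_funM.
- by move=> w _; rewrite -EFinM lee_fin mulr_ge0.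
rewrite !ge0_integralZl_EFin//; first last.
- exact/measurable_EFinP.
- by move=> w _; rewrite lee_fin.
- by rewrite invr_ge0 sqr_ge0.
- apply/measurable_EFinP/measurable_funM => //.
  by apply: measurable_funM => //; exact: measurable_funX.
- by move=> w _; rewrite lee_fin mulr_ge0// mulr_ge0 ?sqr_ge0 ?cosh2_ge0.
apply: lte_add_pinfty; apply: lte_mul_pinfty => //.
- by rewrite lee_fin invr_ge0 sqr_ge0.
- exact: weighted_cosh_lty.
Qed.

Let integrable_weight (V X : T -> R) : measurable_fun [set: T] V ->
    measurable_fun [set: T] X -> (forall w, `|V w| <= W w)%R ->
    \int[P]_w (W w * `|X w|)%:E < +oo -> integrable_rv P (fun w => V w * X w)%R.
Proof.
move=> mV mX VW fin; apply/integrableP; split.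
  exact/measurable_EFinP/measurable_funM.
apply: le_lt_trans fin; apply: ge0_le_integral => //.
- apply: measurableT_comp => //; exact/measurable_EFinP/measurable_funM.
- by apply/measurable_EFinP; apply: measurable_funM => //; exact: measurableT_comp.
- by move=> w _; rewrite lee_fin normrM ler_wpM2r.
Qed.

(** The linear term of the expansion averages out, the quadratic one becomes the
    conditional variance, and [cosh_moment] bounds the remainder. *)
Lemma drift_le (Y a0 a1 a2 a3 : T -> R) :
    measurable_fun [set: T] Y -> (forall w, 0 <= Y w)%R ->
    measurable_wrt G a0 -> measurable_wrt G a1 ->
    measurable_wrt G a2 -> measurable_wrt G a3 ->
    (forall w, `|a0 w| <= W w)%R -> (forall w, `|a1 w| <= W w)%R ->
    (forall w, `|a2 w| <= W w)%R -> (forall w, 0 <= a3 w <= W w)%R ->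
    (forall w, Y w <= a0 w + a1 w * xi w + a2 w * xi w ^+ 2
      + a3 w * (xi w ^+ 2 * cosh2 (xi w / (4 * eps))))%R ->
  \int[P]_w (Y w)%:E <= \int[P]_w (a0 w + a2 w * s w + a3 w * (8 * s w))%:E.
Proof.
move=> mY Y0 ma0 ma1 ma2 ma3 a0W a1W a2W a3W YE.
have ma0T := measurable_wrt_fun sG GT ma0; have ma1T := measurable_wrt_fun sG GT ma1.
have ma2T := measurable_wrt_fun sG GT ma2; have ma3T := measurable_wrt_fun sG GT ma3.
have mX2 : measurable_fun [set: T] (fun w => xi w ^+ 2)%R by exact: measurable_funX.
have mX2c : measurable_fun [set: T] (fun w => xi w ^+ 2 * cosh2 (xi w / (4 * eps)))%R.
  exact: measurable_funM.
have X2c0 w : (0 <= xi w ^+ 2 * cosh2 (xi w / (4 * eps)))%R.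
  by rewrite mulr_ge0 ?sqr_ge0 ?cosh2_ge0.
have finX2 : \int[P]_w (W w * xi w ^+ 2)%:E < +oo.
  by rewrite weighted_second_moment weighted_s_lty.
have i0 : integrable_rv P a0.
  apply/integrableP; split; first exact/measurable_EFinP.
  apply: le_lt_trans intW; apply: ge0_le_integral => //.
  - by apply: measurableT_comp => //; exact/measurable_EFinP.
  - exact/measurable_EFinP.
  - by move=> w _; rewrite lee_fin.
have abs_fin : \int[P]_w (W w * `|xi w|)%:E < +oo.
  apply: (@le_lt_trans _ _ (\int[P]_w ((W w)%:E + (W w * xi w ^+ 2)%:E))).
    apply: ge0_le_integral => //.
    - by move=> w _; rewrite lee_fin mulr_ge0.
    - by apply/measurable_EFinP; apply: measurable_funM => //; exact: measurableT_comp.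
    - by apply: emeasurable_funD; apply/measurable_EFinP => //; exact: measurable_funM.
    - move=> w _; rewrite -EFinD lee_fin -{2}[W w]mulr1 -mulrDr ler_wpM2l//.
      have -> : (xi w ^+ 2 = `|xi w| ^+ 2)%R by rewrite -normrX ger0_norm// sqr_ge0.
      by have := sqr_ge0 (`|xi w| - 1)%R; have := normr_ge0 (xi w); nra.
  rewrite ge0_integralD//.
  - exact: lte_add_pinfty.
  - by move=> w _; rewrite lee_fin.
  - exact/measurable_EFinP.
  - by move=> w _; rewrite lee_fin mulr_ge0 ?sqr_ge0.
  - by apply/measurable_EFinP; exact: measurable_funM.
have i1 : integrable_rv P (fun w => a1 w * xi w)%R.
  exact: integrable_weight.
have i2 : integrable_rv P (fun w => a2 w * xi w ^+ 2)%R.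
  apply: integrable_weight => //.
  by under eq_integral do rewrite ger0_norm ?sqr_ge0//.
have i2s : integrable_rv P (fun w => a2 w * s w)%R.
  apply: integrable_weight => //.
  by under eq_integral do rewrite ger0_norm//; exact: weighted_s_lty.
have a30 w : (0 <= a3 w)%R by case/andP: (a3W w).
have a3W' w : (`|a3 w| <= W w)%R by rewrite ger0_norm//; case/andP: (a3W w).
have i3 : integrable_rv P (fun w => a3 w * (xi w ^+ 2 * cosh2 (xi w / (4 * eps))))%R.
  apply: integrable_weight => //.
  by under eq_integral do rewrite ger0_norm//; exact: weighted_cosh_lty.
have i3s : integrable_rv P (fun w => a3 w * (8 * s w))%R.
  apply: integrable_weight => //; first exact: measurable_funM.
  under eq_integral do rewrite ger0_norm ?mulr_ge0// mulrCA EFinM.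
  rewrite ge0_integralZl_EFin//.
  - by apply: lte_mul_pinfty => //; exact: weighted_s_lty.
  - by move=> w _; rewrite lee_fin mulr_ge0.
  - exact/measurable_EFinP/measurable_funM.
have E1 : \int[P]_w (a1 w * xi w)%:E = 0.
  have mp : measurable_fun [set: T] (fun w => Num.max (xi w) 0)%R.
    exact: measurable_maxr.
  have mn : measurable_fun [set: T] (fun w => Num.max (- xi w) 0)%R.
    by apply: measurable_maxr => //; exact: measurable_funN.
  have p0 w : (0 <= Num.max (xi w) 0)%R by rewrite le_max lexx orbT.
  have n0 w : (0 <= Num.max (- xi w) 0)%R by rewrite le_max lexx orbT.
  have le_abs X : (forall w, (0 <= X w <= `|xi w|)%R) -> measurable_fun [set: T] X ->
      integrable_rv P (fun w => a1 w * X w)%R.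
    move=> X0 mX; apply: integrable_weight => //; apply: le_lt_trans abs_fin.
    apply: ge0_le_integral => //.
    - by move=> w _; rewrite lee_fin mulr_ge0.
    - by apply/measurable_EFinP; apply: measurable_funM => //; exact: measurableT_comp.
    - by apply/measurable_EFinP; apply: measurable_funM => //; exact: measurableT_comp.
    - move=> w _; rewrite lee_fin ler_wpM2l//.
      by have /andP[x0 xx] := X0 w; rewrite ger0_norm.
  have ip : integrable_rv P (fun w => a1 w * Num.max (xi w) 0)%R.
    by apply: le_abs => // w; rewrite p0 ge_max ler_norm normr_ge0.
  have in_ : integrable_rv P (fun w => a1 w * Num.max (- xi w) 0)%R.
    by apply: le_abs => // w; rewrite n0 ge_max -normrN ler_norm normr_ge0.
  transitivity (\int[P]_w ((a1 w * Num.max (xi w) 0)%:E - (a1 w * Num.max (- xi w) 0)%:E)).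
    apply: eq_integral => w _; rewrite -EFinB -mulrBr; congr (_ * _)%:E.
    exact: max_parts.
  rewrite integralB//; rewrite (weighted_integral_eq sG GT ma1 mp mn)//.
  by rewrite subee// integrable_fin_num.
have E2 : \int[P]_w (a2 w * xi w ^+ 2)%:E = \int[P]_w (a2 w * s w)%:E.
  apply: (weighted_integral_eq sG GT) => //.
  by move=> w; exact: sqr_ge0.
have E3 : \int[P]_w (a3 w * (xi w ^+ 2 * cosh2 (xi w / (4 * eps))))%:E <=
    \int[P]_w (a3 w * (8 * s w))%:E.
  apply: (weighted_integral_le sG GT) => //.
  - exact: measurable_funM.
  - by move=> w; rewrite mulr_ge0.
  - exact: cosh_moment.
have i01 := integrableD measurableT i0 i1.
have i012 := integrableD measurableT i01 i2.
have i02s := integrableD measurableT i0 i2s.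
apply: (@le_trans _ _ (\int[P]_w ((a0 w)%:E + (a1 w * xi w)%:E + (a2 w * xi w ^+ 2)%:E
   + (a3 w * (xi w ^+ 2 * cosh2 (xi w / (4 * eps))))%:E))).
  apply: ge0_le_integral => //.
  - by move=> w _; rewrite lee_fin.
  - exact/measurable_EFinP.
  - exact: (measurable_int P (integrableD measurableT i012 i3)).
  - by move=> w _; rewrite -!EFinD lee_fin.
rewrite integralD// integralD// integralD// E1 adde0 E2.
have -> : \int[P]_w (a0 w + a2 w * s w + a3 w * (8 * s w))%:E =
  \int[P]_w ((a0 w)%:E + (a2 w * s w)%:E + (a3 w * (8 * s w))%:E).
  by apply: eq_integral => w _; rewrite -!EFinD.
by rewrite integralD// integralD// leeD2lE// fin_numD !integrable_fin_num.
Qed.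

End weights.

End one_step.

(** * The supermartingale *)

Section composition.
Context d (T : measurableType d) (R : realType).
Implicit Types U V : T -> R.

Lemma measurable_invr : measurable_fun [set: R] (fun x : R => x^-1).
Proof.
rewrite -(setvU [set 0 : R]); apply/measurable_funU => //.
  by apply: measurableC.
split; last exact: measurable_fun_set1.
apply: open_continuous_measurable_fun.
  by apply: closed_openC; exact: closed_eq.
by move=> x /set_mem/eqP x0; exact: inv_continuous.
Qed.

Let mV U : measurable_fun [set: T] U -> measurable_fun [set: T] (fun t => (U t)^-1).
Proof. exact: (measurableT_comp measurable_invr). Qed.

Let mE U : measurable_fun [set: T] U -> measurable_fun [set: T] (fun t => expR (U t)).
Proof. exact: (measurableT_comp (@measurable_expR R)). Qed.

Let mS (f g : T -> R) : measurable_fun [set: T] f -> measurable_fun [set: T] g ->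
  measurable_fun [set: T] (fun t => f t + g t).
Proof. exact: measurable_funD. Qed.

Let mM (f g : T -> R) : measurable_fun [set: T] f -> measurable_fun [set: T] g ->
  measurable_fun [set: T] (fun t => f t * g t).
Proof. exact: measurable_funM. Qed.

Let mN (f : T -> R) : measurable_fun [set: T] f ->
  measurable_fun [set: T] (fun t => - f t).
Proof. exact: measurable_funN. Qed.

Let mX n (f : T -> R) : measurable_fun [set: T] f ->
  measurable_fun [set: T] (fun t => f t ^+ n).
Proof. exact: measurable_funX. Qed.

Let mC (c : R) : measurable_fun [set: T] (fun _ : T => c).
Proof. exact: measurable_cst. Qed.

Variables U V : T -> R.
Hypotheses (mU : measurable_fun [set: T] U) (mVV : measurable_fun [set: T] V).

Let mrs : measurable_fun [set: T] (fun t => rs (V t)).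
Proof.
apply: mV; apply: (measurableT_comp _ mVV).
exact: (continuous_measurable_fun (@sqrt_continuous R)).
Qed.

Let mPhi : measurable_fun [set: T] (fun t => Phi (U t * rs (V t))).
Proof.
apply: measurableT_comp; last exact: mM.
apply: continuous_measurable_fun => x; apply: differentiable_continuous.
by apply/derivable1_diffP; case: (is_derive1_Phi x).
Qed.

Variables lam gam eps C Lmax : R.

Let mden : measurable_fun [set: T] (fun t => den lam (U t) (V t)).
Proof. by apply: mS => //; apply: mX; apply: mS => //; exact: mM. Qed.

Let mfat : measurable_fun [set: T] (fun t => fat lam (U t) (V t)).
Proof.
apply: mM; last by apply: mM => //; exact: mV.
apply: mM => //; apply: mE; apply: mS; first exact: mM.
by apply: mM => //; exact: mM.
Qed.

Let mell : measurable_fun [set: T] (fun t => ell lam (U t) (V t)).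
Proof.
apply: mS => //; apply: mN; apply: mM; last exact: mV.
by apply: mM => //; apply: mS => //; exact: mM.
Qed.

Let mell1 : measurable_fun [set: T] (fun t => ell1 lam (U t) (V t)).
Proof.
apply: mS; first by apply: mM => //; exact: mV.
apply: mM => //; apply: mX; apply: mM; last exact: mV.
by apply: mS => //; exact: mM.
Qed.

Let mbump : measurable_fun [set: T] (fun t => bump (U t) (V t)).
Proof.
apply: mM => //; apply: mE; apply: mN; apply: mM; first exact: mX.
by apply: mV; exact: mM.
Qed.

Let muv : measurable_fun [set: T] (fun t => U t / V t).
Proof. by apply: mM => //; exact: mV. Qed.

Let mgco a b : measurable_fun [set: T] (fun t => gco gam a b (V t)).
Proof.
apply: mS => //; apply: mM => //; apply: measurableT_comp => //.
exact: mM.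
Qed.

Let mfco p q : measurable_fun [set: T] (fun t => fco p q (V t)).
Proof. by apply: mS => //; exact: mM. Qed.

Let mtau : measurable_fun [set: T] (fun t => tau lam (V t)).
Proof. exact: mS. Qed.

Lemma measurable_barrier :
  measurable_fun [set: T] (fun t => barrier lam gam eps C Lmax (U t) (V t)).
Proof. by apply: mS; [apply: mS => //|]; apply: mM. Qed.

Lemma measurable_barrier1 :
  measurable_fun [set: T] (fun t => barrier1 lam gam eps C Lmax (U t) (V t)).
Proof.
apply: mS; [apply: mS; first exact: mM|]; apply: mM => //.
- by apply: mM => //; exact: mN.
- exact: mM.
Qed.

Lemma measurable_barrier2 :
  measurable_fun [set: T] (fun t => barrier2 lam gam eps C Lmax (U t) (V t)).
Proof.
apply: mS; [apply: mS|]; apply: mM => //.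
- by apply: mM => //; exact: mN.
- by apply: mM => //; apply: mS; [exact: mX|apply: mN; exact: mV].
- by apply: mM => //; apply: mS => //; exact: mX.
Qed.

Lemma measurable_barrier_err :
  measurable_fun [set: T] (fun t => barrier_err lam gam eps C Lmax (U t) (V t)).
Proof.
apply: mM => //; apply: mM => //; apply: mS; first apply: mS.
- exact: mX.
- by apply: mM; [exact: mS|exact: mX].
- by apply: mM => //; exact: mX.
Qed.

End composition.

Lemma le_integral_ge0 d (T : measurableType d) (R : realType)
    (mu : {measure set T -> \bar R}) (f g : T -> R) :
    measurable_fun [set: T] f -> measurable_fun [set: T] g ->
    (forall w, 0 <= g w) -> (forall w, f w <= g w) ->
  (\int[mu]_w (f w)%:E <= \int[mu]_w (g w)%:E)%E.
Proof.
move=> mf mg g0 fg; rewrite integralE.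
apply: (@le_trans _ _ (\int[mu]_w (fun w => (f w)%:E)^\+ w)%E).
  by rewrite -[leRHS]sube0 leeB// integral_ge0.
apply: ge0_le_integral => //.
- by apply: measurable_funepos; exact/measurable_EFinP.
- exact/measurable_EFinP.
- by move=> w _; rewrite funeposE ge_max !lee_fin fg g0.
Qed.

(** Here [s i] is the conditional variance of [xi i], under bounds that hold at every
    sample point, and [V k] the variance still to come after step [k]. *)
Section supermartingale.
Context d (T : measurableType d) (R : realType) (P : probability T R).
Variables (n : nat) (xi s : nat -> T -> R) (F : nat -> set (set T)).
Variables (lam gam eps C Lmax W0 : R).
Hypotheses (lam0 : 0 <= lam) (gam0 : 0 < gam) (eps0 : 0 < eps).
Hypothesis C6912 : 6912 <= C.
Hypothesis Lmax0 : 0 <= Lmax.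
Hypothesis epslam : lam * eps <= 16^-1.
Hypothesis epsgam : Kpar C * eps <= gam.
Hypotheses (W01 : 1 <= W0) (WL : ln (W0 / gam ^+ 2) <= Lmax).

Hypothesis sF : forall i, (i <= n)%N -> sigma_algebra setT (F i).
Hypothesis FT : forall i, (i <= n)%N -> F i `<=` measurable.
Hypothesis FF : forall i, (i < n)%N -> F i `<=` F i.+1.
Hypothesis mxi : forall i, (0 < i <= n)%N -> measurable_wrt (F i) (xi i).
Hypothesis ms : forall i, (i < n)%N -> measurable_wrt (F i) (s i.+1).
Hypothesis s0 : forall i w, 0 <= s i w.
Hypothesis s12 : forall i w, s i w <= 12 * eps ^+ 2.
Let V k w : R := W0 - \sum_(1 <= i < k.+1) s i w.
Hypothesis Vgam : forall k w, (k <= n)%N -> gam ^+ 2 <= V k w.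

Hypothesis centered : forall i A, (i < n)%N -> F i A ->
  (\int[P]_(w in A) (Num.max (xi i.+1 w) 0)%:E =
   \int[P]_(w in A) (Num.max (- xi i.+1 w) 0)%:E)%E.
Hypothesis second_moment : forall i A, (i < n)%N -> F i A ->
  (\int[P]_(w in A) (xi i.+1 w ^+ 2)%:E = \int[P]_(w in A) (s i.+1 w)%:E)%E.
Hypothesis even_moments : forall i A j, (i < n)%N -> F i A ->
  (\int[P]_(w in A) (xi i.+1 w ^+ (2 * j).+2)%:E <=
    (2^-1 * (2 * j).+2`!%:R * eps ^+ (2 * j))%:E * \int[P]_(w in A) (s i.+1 w)%:E)%E.

Let X k w : R := mart_sum xi k w.

Let XS k w : X k.+1 w = X k w + xi k.+1 w.
Proof. by rewrite /X /mart_sum big_nat_recr. Qed.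

Let VS k w : V k w = V k.+1 w + s k.+1 w.
Proof. by rewrite /V [in RHS]big_nat_recr//= opprD addrA subrK. Qed.

Let X0 w : X 0%N w = 0.
Proof. by rewrite /X /mart_sum big_geq. Qed.

Let V0 w : V 0%N w = W0.
Proof. by rewrite /V big_geq// subr0. Qed.

Let VW k w : V k w <= W0.
Proof. by rewrite /V gerBl sumr_ge0. Qed.

Let wrtS i (Y : T -> R) : (i < n)%N -> measurable_wrt (F i) Y ->
  measurable_wrt (F i.+1) Y.
Proof.
move=> ni mY _ B mB; rewrite setTI.
have := mY measurableT B mB; rewrite setTI.
move=> /(sub_measurable (sF (ltnW ni))) /(FF ni) h.
by rewrite measurable_g_measurableTypeE//; exact: sF.
Qed.

Let mX k : (k <= n)%N -> measurable_wrt (F k) (X k).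
Proof.
elim: k => [_|k IH kn].
  rewrite (_ : X 0%N = cst 0); first exact: measurable_cst.
  by apply/funext => w; exact: X0.
rewrite (_ : X k.+1 = X k \+ xi k.+1); last by apply/funext => w; exact: XS.
apply: measurable_funD; last exact: mxi.
by apply: wrtS => //; apply: IH; exact: ltnW.
Qed.

Let mVk k : (k < n)%N -> measurable_wrt (F k) (V k.+1).
Proof.
elim: k => [n0|k IH kn].
  rewrite (_ : V 1%N = cst W0 \- s 1%N).
    by apply: measurable_funB; [exact: measurable_cst|exact: ms].
  by apply/funext => w; rewrite /V big_nat1.
rewrite (_ : V k.+2 = V k.+1 \- s k.+2).
  apply: measurable_funB; last exact: ms.
  by apply: wrtS; [exact: ltnW|apply: IH; exact: ltnW].
by apply/funext => w /=; rewrite -[V k.+1 w]/(V k.+1 w) (VS k.+1 w) addrK.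
Qed.

Let exp_lty k : (k <= n)%N -> (\int[P]_w (expR (lam * X k w))%:E < +oo)%E.
Proof.
elim: k => [_|k IH kn].
  under eq_integral do rewrite X0 mulr0 expR0.
  by rewrite integral_cst//= probability_setT mule1 ltry.
have kn' := ltnW kn.
under eq_integral do rewrite XS mulrDr expRD.
apply: (weighted_exp_lty (sF kn') (FT kn') eps0 _ (ms kn) (s0 _) (s12 _) _ _ _ _ lam0).
- by apply: (measurable_wrt_fun (sF kn) (FT kn)); exact: mxi.
- by move=> A j FA; exact: even_moments.
- apply: measurableT_comp => //; apply: measurable_funM => //.
  exact: mX.
- by move=> w; exact: expR_ge0.
- exact: IH.
- by apply: (le_trans epslam); rewrite lef_pV2 ?posrE// ler_nat.
Qed.

Let Bar := barrier lam gam eps C Lmax.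
Let kap : R := 4 * kpar lam eps C.

Let potential x k : \bar R :=
  (\int[P]_w (expR (kap * V k w) * Bar (X k w - x) (V k w))%:E)%E.

Let lnV k w : (k <= n)%N -> ln (V k w / gam ^+ 2) <= Lmax.
Proof.
move=> kn; apply: le_trans WL; have g2 : 0 < gam ^+ 2 by rewrite exprn_gt0.
have V0' : 0 < V k w by exact: lt_le_trans (Vgam _ kn).
rewrite ler_ln ?posrE ?divr_gt0//; last exact: lt_le_trans (VW k w).
by rewrite ler_pM2r ?invr_gt0.
Qed.

Let kap0 : 0 <= kap.
Proof. exact: mulr_ge0 (ler0n _ 4) (kpar_ge0 lam0 eps0 C6912). Qed.

(** [drift_le], with the barrier of the variance to come after the step, followed by
    [barrier_step], which restores the variance to come before it. *)
Let potential_step x k : (k < n)%N -> (potential x k.+1 <= potential x k)%E.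
Proof.
move=> kn; have kn' := ltnW kn.
have [K K0 bdd] := barrier_bounded lam0 gam0 eps0 C6912 Lmax0 W01.
pose u w := X k w - x.
pose v w := V k.+1 w.
pose E w := expR (kap * v w).
pose b0 w := E w * Bar (u w) (v w).
pose b1 w := E w * barrier1 lam gam eps C Lmax (u w) (v w).
pose b2 w := E w * (barrier2 lam gam eps C Lmax (u w) (v w) / 2).
pose b3 w := E w * barrier_err lam gam eps C Lmax (u w) (v w).
pose EM := expR (kap * W0).
pose W w := EM * (1 + K * expR (- lam * x) * expR (lam * X k w)).
have mu : measurable_wrt (F k) u.
  by apply: measurable_funB; [exact: mX|exact: measurable_cst].
have mv : measurable_wrt (F k) v by exact: mVk.
have mE : measurable_wrt (F k) E.
  by apply: measurableT_comp => //; apply: measurable_funM => //.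
have vg w : gam ^+ 2 <= v w by exact: Vgam.
have vW w : v w <= W0 by exact: VW.
have EEM w : E w <= EM by rewrite ler_expR ler_wpM2l.
have E0 w : 0 <= E w by exact: expR_ge0.
have EM0 : 0 <= EM by exact: expR_ge0.
have KE w : K * expR (lam * u w) = K * expR (- lam * x) * expR (lam * X k w).
  by rewrite -mulrA -expRD; congr (_ * expR _); rewrite /u; ring.
have KE0 w : 0 <= K * expR (lam * u w) by rewrite mulr_ge0// expR_ge0.
have bd w := bdd (u w) (v w) (introT andP (conj (vg w) (vW w))).
have leW w y : 0 <= y -> y <= 1 + K * expR (lam * u w) -> E w * y <= W w.
  by move=> y0 yK; rewrite /W -KE; apply: ler_pM.
have Ku w : K * expR (lam * u w) <= 1 + K * expR (lam * u w) by rewrite lerDr.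
have B0 w : 0 <= Bar (u w) (v w) by exact: barrier_ge0.
have err0 w : 0 <= barrier_err lam gam eps C Lmax (u w) (v w).
  exact: barrier_err_ge0.
have mW : measurable_wrt (F k) W.
  apply: measurable_funM; first exact: measurable_cst.
  apply: measurable_funD; first exact: measurable_cst.
  apply: measurable_funM; first exact: measurable_cst.
  by apply: measurableT_comp => //; apply: measurable_funM => //; exact: mX.
have W0' w : 0 <= W w by rewrite /W -KE mulr_ge0// addr_ge0.
have mexp : measurable_fun [set: T] (fun w => expR (lam * X k w)).
  apply: measurableT_comp => //; apply: measurable_funM => //.
  by apply: (measurable_wrt_fun (sF kn') (FT kn')); exact: mX.
have intW : (\int[P]_w (W w)%:E < +oo)%E.
  rewrite /W; under eq_integral do rewrite EFinM EFinD EFinM.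
  have Kx0 : 0 <= K * expR (- lam * x) by rewrite mulr_ge0// expR_ge0.
  rewrite ge0_integralZl_EFin//; last 2 first.
  - move=> w _; rewrite -EFinM -EFinD lee_fin addr_ge0// mulr_ge0// expR_ge0.
  - by apply: emeasurable_funD => //; apply: measurable_funeM; exact/measurable_EFinP.
  rewrite ge0_integralD//; last 2 first.
  - by move=> w _; rewrite -EFinM lee_fin mulr_ge0// expR_ge0.
  - by apply: measurable_funeM; exact/measurable_EFinP.
  rewrite ge0_integralZl_EFin//; last exact/measurable_EFinP.
  rewrite integral_cst//= probability_setT mule1.
  apply: lte_mul_pinfty => //; apply: lte_add_pinfty; first exact: ltry.
  by apply: lte_mul_pinfty => //; exact: exp_lty.
have mXS : measurable_fun [set: T] (X k.+1).
  by apply: (measurable_wrt_fun (sF kn) (FT kn)); exact: mX.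
have mvT : measurable_fun [set: T] v by exact: (measurable_wrt_fun (sF kn') (FT kn')).
pose Y w := E w * Bar (X k.+1 w - x) (v w).
have h := @drift_le _ T R P (F k) (sF kn') (FT kn') (xi k.+1) (s k.+1) eps eps0
  _ (ms kn) (s0 _) (s12 _) _ _ _ W mW W0' intW Y b0 b1 b2 b3.
have {}h : (\int[P]_w (Y w)%:E <=
    \int[P]_w (b0 w + b2 w * s k.+1 w + b3 w * (8 * s k.+1 w))%:E)%E.
  apply: h.
  - by apply: (measurable_wrt_fun (sF kn) (FT kn)); exact: mxi.
  - by move=> A FA; exact: centered.
  - by move=> A FA; exact: second_moment.
  - by move=> A j FA; exact: even_moments.
  - apply: measurable_funM; first exact: (measurable_wrt_fun (sF kn') (FT kn')).
    by apply: measurable_barrier => //; exact: measurable_funB.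
  - by move=> w; rewrite mulr_ge0//; exact: barrier_ge0.
  - by apply: measurable_funM => //; exact: measurable_barrier.
  - by apply: measurable_funM => //; exact: measurable_barrier1.
  - apply: measurable_funM => //; apply: measurable_funM; last exact: measurable_cst.
    exact: measurable_barrier2.
  - by apply: measurable_funM => //; exact: measurable_barrier_err.
  - move=> w; rewrite ger0_norm ?mulr_ge0//; apply: leW => //.
    by have [] := bd w.
  - move=> w; rewrite normrM (ger0_norm (E0 w)); apply: leW => //.
    by have [_ le1 _ _] := bd w; exact: le_trans (Ku w).
  - move=> w; rewrite normrM (ger0_norm (E0 w)); apply: leW => //.
    have [_ _ le2 _] := bd w; apply: le_trans (Ku w).
    by rewrite normrM (le_trans _ le2)// ler_piMr// ger0_norm// invf_le1// ler1n.
  - move=> w; rewrite mulr_ge0//=; apply: leW => //.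
    by have [_ _ _ le3] := bd w; exact: le_trans (Ku w).
  - move=> w; rewrite /Y /b0 /b1 /b2 /b3 /Bar.
    have -> : X k.+1 w - x = u w + xi k.+1 w by rewrite XS /u addrAC.
    have := @barrier_taylor R lam gam eps C Lmax lam0 gam0 eps0 C6912 Lmax0 epslam
      epsgam (v w) (vg w) (u w) (xi k.+1 w).
    move=> /(ler_wpM2l (E0 w)).
    move: (barrier lam gam eps C Lmax (u w + xi k.+1 w) (v w))
      (barrier lam gam eps C Lmax (u w) (v w))
      (barrier1 lam gam eps C Lmax (u w) (v w))
      (barrier2 lam gam eps C Lmax (u w) (v w))
      (barrier_err lam gam eps C Lmax (u w) (v w))
      (cosh2 (xi k.+1 w / (4 * eps))) (xi k.+1 w) (E w) => B' B B1 B2 B3 c y e.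
    by rewrite !mulrDr !mulrA.
apply: (le_trans h).
have mET := measurable_wrt_fun (sF kn') (FT kn') mE.
have msT := measurable_wrt_fun (sF kn') (FT kn') (ms kn).
have muT := measurable_wrt_fun (sF kn') (FT kn') mu.
apply: le_integral_ge0.
- apply: measurable_funD; first apply: measurable_funD.
  + by apply: measurable_funM => //; exact: measurable_barrier.
  + apply: measurable_funM => //; apply: measurable_funM => //.
    by apply: measurable_funM => //; exact: measurable_barrier2.
  + apply: measurable_funM; last exact: measurable_funM.
    by apply: measurable_funM => //; exact: measurable_barrier_err.
- have mVT : measurable_fun [set: T] (V k).
    rewrite (_ : V k = v \+ s k.+1); first exact: measurable_funD.
    by apply/funext => w; exact: VS.
  apply: measurable_funM; last exact: measurable_barrier.
  by apply: measurableT_comp => //; exact: measurable_funM.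
- by move=> w; rewrite mulr_ge0 ?expR_ge0//; apply: barrier_ge0 => //; exact/Vgam/ltnW.
- move=> w; have := @barrier_step R lam gam eps C Lmax lam0 gam0 eps0 C6912 Lmax0 epslam epsgam
    (v w) (vg w) (lnV _ kn) (u w) (s k.+1 w).
  rewrite s0 s12 => /(_ isT) /(ler_wpM2l (E0 w)) hs; rewrite (VS k).
  have -> : expR (kap * (V k.+1 w + s k.+1 w)) = E w * expR (kap * s k.+1 w).
    by rewrite /E -expRD mulrDr.
  rewrite -mulrA; apply: le_trans hs.
  rewrite /b0 /b2 /b3 /Bar.
  move: (barrier lam gam eps C Lmax (u w) (v w))
    (barrier2 lam gam eps C Lmax (u w) (v w))
    (barrier_err lam gam eps C Lmax (u w) (v w)) (E w) (s k.+1 w) => B B2 B3 e t.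
  suff -> : e * B + e * (B2 / 2) * t + e * B3 * (8 * t) =
    e * (B + t * (B2 / 2) + 8 * t * B3) by [].
  by ring.
Qed.

(** The mean of [exp (kap V_k) * barrier (X_k - x) V_k] decreases with [k]; it
    starts from a constant and ends above the probability of [x < X_n]. *)
Lemma tail_le_barrier x : {ae P, forall w, V n w <= 3 * gam ^+ 2} ->
  (P [set w | (x < X n w)%R] <=
    (expR (kap * W0) * Bar (- x) W0)%:E)%E.
Proof.
move=> Vn.
have mXn : measurable_fun [set: T] (X n).
  by apply: (measurable_wrt_fun (sF (leqnn n)) (FT (leqnn n))); exact: mX.
have mA : measurable [set w | x < X n w].
  have := mXn measurableT `]x, +oo[%classic (measurable_itv _).
  by rewrite setTI set_itvoy.
have mVn : measurable_fun [set: T] (V n).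
  case: (posnP n) => [->|n0].
    rewrite (_ : V 0%N = cst W0); first exact: measurable_cst.
    by apply/funext => w; exact: V0.
  have nn : (n.-1 < n)%N by rewrite prednK.
  apply: (measurable_wrt_fun (sF (ltnW nn)) (FT (ltnW nn))).
  by have := mVk nn; rewrite prednK.
have -> : (expR (kap * W0) * Bar (- x) W0)%:E = potential x 0.
  rewrite /potential; under eq_integral do rewrite X0 V0 sub0r.
  by rewrite integral_cst//= probability_setT mule1.
have : (potential x n <= potential x 0)%E.
  have : forall k, (k <= n)%N -> (potential x k <= potential x 0)%E.
    elim => // k IH kn; apply: le_trans (IH (ltnW kn)); exact: potential_step.
  by apply.
apply: le_trans.
have -> : P [set w | x < X n w] =
    (\int[P]_w (\1_[set w | (x < X n w)%R] w)%:E)%E.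
  by rewrite integral_indic//= setIT.
apply: ae_ge0_le_integral => //.
- exact/measurable_EFinP/measurable_indic.
- move=> w _; rewrite lee_fin mulr_ge0 ?expR_ge0//; apply: barrier_ge0 => //.
  exact: Vgam.
- apply/measurable_EFinP/measurable_funM.
    by apply: measurableT_comp => //; exact: measurable_funM.
  by apply: measurable_barrier => //; exact: measurable_funB.
- apply: filterS Vn => w Vw _; rewrite lee_fin indicE.
  have Vg : gam ^+ 2 <= V n w by exact: Vgam.
  have [|_] := boolP (w \in _); last first.
    by rewrite mulr_ge0 ?expR_ge0//; exact: barrier_ge0.
  rewrite inE/= => xX; rewrite -[leLHS]mulr1.
  have e1 : 1 <= expR (kap * V n w).
    by rewrite -expR0 ler_expR mulr_ge0// (le_trans _ Vg)// sqr_ge0.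
  have b1 : 1 <= Bar (X n w - x) (V n w).
    by apply: barrier_final => //; rewrite subr_ge0 ltW.
  exact: ler_pM.
Qed.

End supermartingale.

(** * Random variables compared almost surely *)

Section almost_sure_order.
Context d (T : measurableType d) (R : realType) (P : probability T R).
Implicit Types (A : set T) (Y Z : T -> R).

Let int_fin A Y : measurable A -> integrable_rv P Y ->
  P.-integrable A (EFin \o Y) /\ (\int[P]_(w in A) (Y w)%:E)%E \is a fin_num.
Proof.
move=> mA iY; have iA : P.-integrable A (EFin \o Y) by exact: integrableS iY.
by split => //; exact: integrable_fin_num.
Qed.

Lemma integrable_rv_measurable Y : integrable_rv P Y -> measurable_fun [set: T] Y.
Proof. by move=> /measurable_int/measurable_EFinP. Qed.

Lemma integrable_rv_cst (c : R) : integrable_rv P (fun=> c).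
Proof. exact: finite_measure_integrable_cst. Qed.

Lemma integrable_rvD Y Z : integrable_rv P Y -> integrable_rv P Z ->
  integrable_rv P (fun w => Y w + Z w).
Proof. by move=> iY iZ; apply: eq_integrable (integrableD _ iY iZ). Qed.

Lemma integrable_rvZ (c : R) Y : integrable_rv P Y -> integrable_rv P (fun w => c * Y w).
Proof. by move=> iY; apply: eq_integrable (integrableZl _ c iY). Qed.

Lemma integral_rvD A Y Z : measurable A -> integrable_rv P Y -> integrable_rv P Z ->
  (\int[P]_(w in A) (Y w + Z w)%:E =
   \int[P]_(w in A) (Y w)%:E + \int[P]_(w in A) (Z w)%:E)%E.
Proof.
move=> mA iY iZ; have [iYA _] := int_fin mA iY; have [iZA _] := int_fin mA iZ.
exact: (integralD_EFin mA iYA iZA).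
Qed.

Lemma integral_rvZ A (c : R) Y : measurable A -> integrable_rv P Y ->
  (\int[P]_(w in A) (c * Y w)%:E = c%:E * \int[P]_(w in A) (Y w)%:E)%E.
Proof.
move=> mA iY; have [iYA _] := int_fin mA iY.
exact: (integralZl mA iYA).
Qed.

Lemma ae_eq_integral_rv A Y Z : measurable A ->
    measurable_fun [set: T] Y -> measurable_fun [set: T] Z ->
    {ae P, forall w, Y w = Z w} ->
  (\int[P]_(w in A) (Y w)%:E = \int[P]_(w in A) (Z w)%:E)%E.
Proof.
move=> mA mY mZ YZ; apply: ae_eq_integral => //.
- by apply: measurable_funTS; exact/measurable_EFinP.
- by apply: measurable_funTS; exact/measurable_EFinP.
- by apply: filterS YZ => w -> _.
Qed.

Lemma ae_le_integral A Y Z : measurable A -> integrable_rv P Y -> integrable_rv P Z ->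
    {ae P, forall w, Y w <= Z w} ->
  (\int[P]_(w in A) (Y w)%:E <= \int[P]_(w in A) (Z w)%:E)%E.
Proof.
move=> mA iY iZ YZ.
have [iYA fY] := int_fin mA iY; have [iZA fZ] := int_fin mA iZ.
have mY := integrable_rv_measurable iY; have mZ := integrable_rv_measurable iZ.
rewrite -sube_ge0 ?fY// -integralB_EFin//.
under eq_integral do rewrite -EFinB.
rewrite (@ae_eq_integral_rv _ _ (fun w => `|Z w - Y w|)) => //.
- exact: integral_ge0.
- exact: measurable_funB.
- by apply: measurableT_comp => //; exact: measurable_funB.
- by apply: filterS YZ => w h; rewrite ger0_norm// subr_ge0.
Qed.

(** Test on the event [Z < Y], which belongs to [G]. *)
Lemma ae_le_of_integral (G : set (set T)) Y Z :
    sigma_algebra setT G -> G `<=` measurable ->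
    measurable_wrt G Y -> measurable_wrt G Z ->
    integrable_rv P Y -> integrable_rv P Z ->
    (forall A, G A ->
      (\int[P]_(w in A) (Y w)%:E <= \int[P]_(w in A) (Z w)%:E)%E) ->
  {ae P, forall w, Y w <= Z w}.
Proof.
move=> sG GT mY mZ iY iZ YZ.
pose A := [set w | 0 < Y w - Z w].
have GA : G A.
  apply: (sub_measurable sG).
  have : measurable_wrt G (fun w => Y w - Z w) by exact: measurable_funB.
  move=> /(_ measurableT `]0, +oo[%classic (measurable_itv _)).
  by rewrite setTI set_itvoy.
have mA := GT _ GA.
have [iYA fY] := int_fin mA iY; have [iZA fZ] := int_fin mA iZ.
have mYT := integrable_rv_measurable iY; have mZT := integrable_rv_measurable iZ.
have I0 : (\int[P]_(w in A) `|(Y w - Z w)%:E| = 0)%E.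
  transitivity (\int[P]_(w in A) ((Y w)%:E - (Z w)%:E))%E.
    by apply: eq_integral => w; rewrite inE => Aw; rewrite -EFinB abse_EFin gtr0_norm.
  have := YZ _ GA; rewrite -sube_le0 -integralB_EFin// => h.
  apply/eqP; rewrite eq_le h/=; apply: integral_ge0 => w Aw.
  by rewrite -EFinB lee_fin ltW.
have mB : measurable_fun A (fun w => (Y w - Z w)%:E).
  by apply: measurable_funTS; apply/measurable_EFinP; exact: measurable_funB.
have /(ae_eq_integral_abs P mA mB) := I0.
apply: filterS => w h; rewrite leNgt; apply/negP => ZY.
have Aw : A w by rewrite /A/= subr_gt0.
by have [/eqP] := h Aw; rewrite gt_eqF.
Qed.

Lemma integrable_rv_le Y Z : measurable_fun [set: T] Y -> integrable_rv P Z ->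
  (forall w, `|Y w| <= Z w) -> integrable_rv P Y.
Proof.
move=> mY iZ YZ; apply: (le_integrable _ _ _ iZ) => //.
  exact/measurable_EFinP.
by move=> w _ /=; rewrite lee_fin (le_trans (YZ w))// ler_norm.
Qed.

Lemma integrable_rv_of_sqr Y : measurable_fun [set: T] Y ->
  integrable_rv P (fun w => Y w ^+ 2) -> integrable_rv P Y.
Proof.
move=> mY i2; apply: (integrable_rv_le mY (integrable_rvD (integrable_rv_cst 1) i2)).
move=> w; rewrite -[Y w ^+ 2]real_normK ?num_real//.
by have := sqr_ge0 (`|Y w| - 1); have := sqr_ge0 `|Y w|; lra.
Qed.

Lemma ae_forall_lt (n : nat) (Q : nat -> T -> Prop) :
  (forall i, (i < n)%N -> {ae P, forall w, Q i w}) ->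
  {ae P, forall w, forall i, (i < n)%N -> Q i w}.
Proof.
elim: n => [_|n IH h]; first by apply: aeW.
have := IH (fun i ni => h i (ltnW ni)).
apply: filterS2 (h n (ltnSn n)) => w Qn Qi i.
by rewrite ltnS leq_eqVlt => /predU1P[->|]; last exact: Qi.
Qed.

End almost_sure_order.

(** * Bounded conditional variances *)

Section martingale.
Context d (T : measurableType d) (R : realType) (P : probability T R).
Variables (n : nat) (xi : nat -> T -> R) (F : nat -> set (set T)) (eps delta : R).
Hypothesis MD : martingale_differences P n xi F.
Hypotheses (eps0 : 0 < eps) (delta0 : 0 <= delta).
Hypothesis A1 : cond_A1 P n xi F eps.
Hypothesis A2 : cond_A2 P n xi F delta.
Variable gam : R.
Hypotheses (gam0 : 0 < gam) (gamdelta : delta <= gam).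

Let S i : T -> R := cond_exp P (F i.-1) (fun v => xi i v ^+ 2).
Let W0 : R := 1 + delta ^+ 2 + gam ^+ 2.

(** The variance still to come, with each conditional variance forced into
    [[0, 12 * eps^2]] and the total kept above [gam^2].  Almost surely nothing is
    forced, since the conditional variances add up to at most
    [1 + delta^2 = W0 - gam^2]; but the barrier needs the bounds at every sample
    point. *)
Fixpoint remaining k (w : T) : R :=
  if k is k'.+1 then Num.max (gam ^+ 2)
    (remaining k' w - Num.min (Num.max (S k'.+1 w) 0) (12 * eps ^+ 2))
  else W0.

Definition spent k (w : T) : R :=
  if k is k'.+1 then remaining k' w - remaining k'.+1 w else 0.

Let clip k w := Num.min (Num.max (S k w) 0) (12 * eps ^+ 2).
Let e0 : 0 <= 12 * eps ^+ 2. Proof. by rewrite mulr_ge0// sqr_ge0. Qed.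

Let clip_ge0 k w : 0 <= clip k w.
Proof. by rewrite le_min e0 le_max lexx orbT. Qed.

Let clip_le k w : clip k w <= 12 * eps ^+ 2.
Proof. by rewrite ge_min lexx orbT. Qed.

Lemma remaining_ge k w : gam ^+ 2 <= remaining k w.
Proof.
case: k => [|k] /=; last by rewrite le_max lexx.
by rewrite /W0 lerDr addr_ge0// sqr_ge0.
Qed.

Lemma spent_ge0 k w : 0 <= spent k w.
Proof.
case: k => [//|k] /=; rewrite subr_ge0 ge_max remaining_ge/=.
by rewrite gerBl clip_ge0.
Qed.

Lemma spent_le k w : spent k w <= 12 * eps ^+ 2.
Proof.
case: k => [//|k] /=; rewrite lerBlDl; apply: le_trans (_ : _ <= remaining k.+1 w + clip k.+1 w) _.
  by rewrite -lerBlDr /= le_max lexx orbT.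
by rewrite lerD2l clip_le.
Qed.

Lemma remainingE k w : W0 - \sum_(1 <= i < k.+1) spent i w = remaining k w.
Proof.
elim: k => [|k IH]; first by rewrite big_geq// subr0.
by rewrite big_nat_recr//= opprD addrA IH subKr.
Qed.

Let sF i : (i <= n)%N -> sigma_algebra setT (F i).
Proof. exact: (md_sigma MD). Qed.

Lemma filtration_incr i j : (i <= j <= n)%N -> F i `<=` F j.
Proof.
elim: j => [|j IH /andP[ij jn]].
  by rewrite leqn0 => /andP[/eqP -> _]; exact: subset_refl.
move: ij; rewrite leq_eqVlt => /predU1P[->//|ij].
apply: subset_trans (md_incr MD jn).
by apply: IH; rewrite -ltnS ij ltnW.
Qed.

Lemma filtration_sub i : (i <= n)%N -> F i `<=` measurable.
Proof.
by move=> ni; apply: subset_trans (md_sub MD); apply: filtration_incr; rewrite ni leqnn.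
Qed.

Let wrtS i (Y : T -> R) : (i < n)%N -> measurable_wrt (F i) Y ->
  measurable_wrt (F i.+1) Y.
Proof.
move=> ni mY _ B mB; rewrite setTI.
have := mY measurableT B mB; rewrite setTI.
move=> /(sub_measurable (sF (ltnW ni))) /(md_incr MD ni) h.
by rewrite measurable_g_measurableTypeE//; exact: sF.
Qed.

Let S_exp i : (i < n)%N -> is_cond_exp P (F i) (fun v => xi i.+1 v ^+ 2) (S i.+1).
Proof.
move=> ni; apply: (cond_expP (sF (ltnW ni)) (filtration_sub (ltnW ni))).
exact: (md_sqr_int MD).
Qed.

Let mS i : (i < n)%N -> measurable_wrt (F i) (S i.+1).
Proof. by move=> ni; have [] := S_exp ni. Qed.

Let mremaining k : (k < n)%N -> measurable_wrt (F k) (remaining k.+1).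
Proof.
have step i : (i < n)%N -> measurable_wrt (F i) (remaining i) ->
    measurable_wrt (F i) (remaining i.+1).
  move=> ni mr; apply: measurable_maxr; first exact: measurable_cst.
  apply: measurable_funB => //.
  apply: measurable_minr; last exact: measurable_cst.
  by apply: measurable_maxr; [exact: mS|exact: measurable_cst].
elim: k => [n0|k IH kn]; apply: step => //; first exact: measurable_cst.
by apply: wrtS; [exact: ltnW|apply: IH; exact: ltnW].
Qed.

Lemma measurable_spent k : (k < n)%N -> measurable_wrt (F k) (spent k.+1).
Proof.
move=> kn; rewrite (_ : spent k.+1 = remaining k \- remaining k.+1)//.
apply: measurable_funB; last exact: mremaining.
case: k kn => [n0|k kn]; first exact: measurable_cst.
by apply: wrtS; [exact: ltnW|apply: mremaining; exact: ltnW].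
Qed.

Let mxi i : (i <= n)%N -> measurable_fun [set: T] (xi i).
Proof.
move=> ni; apply: (measurable_wrt_fun (sF ni) (filtration_sub ni)).
exact: (md_adapted MD).
Qed.

Lemma cond_variance_ge0 i : (i < n)%N -> {ae P, forall w, 0 <= S i.+1 w}.
Proof.
move=> ni; have [mSi iSi eSi] := S_exp ni.
apply: (ae_le_of_integral (sF (ltnW ni)) (filtration_sub (ltnW ni)) _ mSi _ iSi).
- exact: measurable_cst.
- exact: integrable_rv_cst.
- move=> A FA; rewrite eSi// integral0; apply: integral_ge0 => w _.
  by rewrite lee_fin sqr_ge0.
Qed.

(** The fourth moment condition bounds the conditional variance itself, because
    [E(xi^2)^2 <= E(xi^4) <= 12 * eps^2 * E(xi^2)]; the square is replaced by the
    tangent lines [2 * t * xi^2 <= xi^4 + t^2], here with [t = 12 * eps^2]. *)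
Lemma cond_variance_le i : (i < n)%N -> {ae P, forall w, S i.+1 w <= 12 * eps ^+ 2}.
Proof.
move=> ni; have [mSi iSi eSi] := S_exp ni.
have [sFi FTi] := (sF (ltnW ni), filtration_sub (ltnW ni)).
have [i4 b4] := A1 (isT : 3 <= 4)%N (ni : (1 <= i.+1 <= n)%N).
have [m4 ie4 e4] := cond_expP sFi FTi i4.
set t := 12 * eps ^+ 2.
have t0 : 0 < t by rewrite mulr_gt0// exprn_gt0.
suff : {ae P, forall w, 2 * t * S i.+1 w <= t * S i.+1 w + t ^+ 2}.
  by apply: filterS => w; rewrite expr2 -subr_ge0 => h; rewrite -(ler_pM2l t0); lra.
have i2 : integrable_rv P (fun v => xi i.+1 v ^+ 2) by exact: (md_sqr_int MD).
apply: (ae_le_of_integral sFi FTi).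
- by apply: measurable_funM => //; exact: measurable_cst.
- apply: measurable_funD; last exact: measurable_cst.
  by apply: measurable_funM => //; exact: measurable_cst.
- exact: integrable_rvZ.
- by apply: integrable_rvD; [exact: integrable_rvZ|exact: integrable_rv_cst].
move=> A FA; have mA := FTi _ FA.
rewrite integral_rvZ// eSi// -integral_rvZ//.
apply: (@le_trans _ _ (\int[P]_(w in A) (xi i.+1 w ^+ 4 + t ^+ 2)%:E)%E).
  apply: ae_le_integral => //; first exact: integrable_rvZ.
    by apply: integrable_rvD => //; exact: integrable_rv_cst.
  apply: aeW => w; have := sqr_ge0 (xi i.+1 w ^+ 2 - t).
  rewrite sqrrB -exprM => h; rewrite -subr_ge0; apply: le_trans h _.
  by rewrite le_eqVlt; apply/orP; left; apply/eqP; ring.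
have ict := integrable_rv_cst P (t ^+ 2).
rewrite !integral_rvD//; last exact: integrable_rvZ.
rewrite leeD2r// -e4//; apply: ae_le_integral => //; first exact: integrable_rvZ.
apply: filterS b4 => w; have -> : 2^-1 * 4`!%:R * eps ^+ (4 - 2) = t.
  by rewrite /t (_ : 4`! = 24)//= -[(4 - 2)%N]/2%N; field.
exact: le_trans (ler_norm _).
Qed.

Let regular : {ae P, forall w, [/\ forall i, (i < n)%N -> clip i.+1 w = S i.+1 w &
  `|quad_char P xi F n w - 1| <= delta ^+ 2]}.
Proof.
have h1 := ae_forall_lt cond_variance_ge0.
have h2 := ae_forall_lt cond_variance_le.
apply: filterS3 A2 h1 h2 => w a2 g1 g2; split => // i ni.
have /max_idPl h := g1 _ ni.
by rewrite /clip h; apply/min_idPl; exact: g2.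
Qed.

Let remaining_ae : {ae P, forall w, forall k, (k <= n)%N ->
  remaining k w = W0 - \sum_(1 <= i < k.+1) S i w}.
Proof.
apply: filterS regular => w [cS a2].
have tail k : (k <= n)%N ->
    gam ^+ 2 <= W0 - \sum_(1 <= i < k.+1) S i w.
  move=> kn; rewrite lerBrDl /W0 -lerBrDr addrK.
  have : \sum_(1 <= i < k.+1) S i w <= quad_char P xi F n w.
    rewrite /quad_char (@big_cat_nat _ _ _ k.+1 1 n.+1)//=.
    rewrite lerDl big_nat_cond sumr_ge0// => i /andP[/andP[ki ni] _].
    case: i ki ni => // i _ ni.
    by have := clip_ge0 i.+1 w; rewrite cS.
  by move: a2; rewrite ler_norml => /andP[_]; lra.
elim => [_|k IH kn]; first by rewrite big_geq// subr0.
rewrite /= -/(clip k.+1 w) cS// IH ?(ltnW kn)//.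
by rewrite -addrA -opprD -big_nat_recr//=; apply/max_idPr; exact: tail.
Qed.

Lemma spent_ae i : (i < n)%N -> {ae P, forall w, spent i.+1 w = S i.+1 w}.
Proof.
move=> ni; apply: filterS remaining_ae => w h.
have := remainingE i.+1 w; have := remainingE i w.
rewrite -[spent i.+1 w]/(remaining i w - remaining i.+1 w) !h// ?(ltnW ni)//.
move=> _ _; rewrite [in X in _ - X]big_nat_recr//=.
by move: (\sum_(1 <= j < i.+1) S j w) => t; ring.
Qed.

Lemma remaining_final : {ae P, forall w,
  W0 - \sum_(1 <= i < n.+1) spent i w <= 3 * gam ^+ 2}.
Proof.
apply: filterS2 regular remaining_ae => w [_ a2] h.
rewrite remainingE h// -/(quad_char P xi F n w).
have : delta ^+ 2 <= gam ^+ 2 by rewrite ler_pXn2r ?nnegrE// (ltW gam0).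
by move: a2; rewrite ler_norml /W0 => /andP[a2 _] dg; move: a2 dg; lra.
Qed.

Let ispent i : (i < n)%N -> integrable_rv P (spent i.+1).
Proof.
move=> ni; apply: (integrable_rv_le _ (integrable_rv_cst P (12 * eps ^+ 2))).
  by apply: (measurable_wrt_fun (sF (ltnW ni)) (filtration_sub (ltnW ni))); exact: measurable_spent.
by move=> w; rewrite ger0_norm ?spent_ge0// spent_le.
Qed.

Lemma spent_second_moment i A : (i < n)%N -> F i A ->
  (\int[P]_(w in A) (xi i.+1 w ^+ 2)%:E = \int[P]_(w in A) (spent i.+1 w)%:E)%E.
Proof.
move=> ni FA; have [mSi iSi <-//] := S_exp ni.
apply: ae_eq_integral_rv; first exact: (filtration_sub (ltnW ni)).
- exact: integrable_rv_measurable iSi.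
- exact: integrable_rv_measurable (ispent ni).
- by apply: filterS (spent_ae ni) => w ->.
Qed.

Lemma spent_even_moments i A j : (i < n)%N -> F i A ->
  (\int[P]_(w in A) (xi i.+1 w ^+ (2 * j).+2)%:E <=
    (2^-1 * (2 * j).+2`!%:R * eps ^+ (2 * j))%:E * \int[P]_(w in A) (spent i.+1 w)%:E)%E.
Proof.
move=> ni FA; have [sFi FTi] := (sF (ltnW ni), filtration_sub (ltnW ni)); have mA := FTi _ FA.
case: j => [|j].
  rewrite muln0 expr0 mulr1 (_ : 2`! = 2)// mulVf ?pnatr_eq0// mul1e.
  by rewrite spent_second_moment.
have [ik bk] := A1 (isT : 3 <= (2 * j.+1).+2)%N (ni : (1 <= i.+1 <= n)%N).
have [mk iek ek] := cond_expP sFi FTi ik.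
rewrite -ek// -integral_rvZ//; last exact: ispent.
apply: ae_le_integral => //; first exact/integrable_rvZ/ispent.
apply: filterS2 bk (spent_ae ni) => w h ->; apply: le_trans (ler_norm _) _.
by move: h; rewrite subn2.
Qed.

Lemma centered_parts i A : (i < n)%N -> F i A ->
  (\int[P]_(w in A) (Num.max (xi i.+1 w) 0)%:E =
   \int[P]_(w in A) (Num.max (- xi i.+1 w) 0)%:E)%E.
Proof.
move=> ni FA; have [sFi FTi] := (sF (ltnW ni), filtration_sub (ltnW ni)); have mA := FTi _ FA.
have mx := mxi ni; have i2 := md_sqr_int MD ni.
have ix := integrable_rv_of_sqr mx i2.
have [me ie ee] := cond_expP sFi FTi ix.
have iN : integrable_rv P (fun w => Num.max (- xi i.+1 w) 0).
  apply: (integrable_rv_le _ (integrable_rvD (integrable_rv_cst P 1) i2)).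
    by apply: measurable_maxr => //; exact: measurable_funN.
  move=> w; rewrite ger0_norm ?le_max ?lexx ?orbT// ge_max.
  have := sqr_ge0 (xi i.+1 w + 1); have := sqr_ge0 (xi i.+1 w).
  by move=> *; apply/andP; split; lra.
have x0 : (\int[P]_(w in A) (xi i.+1 w)%:E = 0)%E.
  rewrite -ee// (@ae_eq_integral_rv _ _ _ _ _ _ (fun=> 0))//.
  - exact: integral0.
  - exact: integrable_rv_measurable ie.
  - exact: (md_centered MD (ni : (1 <= i.+1 <= n)%N)).
rewrite -[RHS]add0e -x0 -integral_rvD//; apply: eq_integral => w _; congr EFin.
by rewrite !maxEle; case: ifPn; case: ifPn; rewrite -?ltNge; lra.
Qed.

End martingale.

(** * The tails and the starting value of the barrier *)

Section both_tails.
Context d (T : measurableType d) (R : realType) (P : probability T R).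
Variables (n : nat) (xi : nat -> T -> R) (F : nat -> set (set T)) (eps delta : R).
Hypothesis MD : martingale_differences P n xi F.
Hypotheses (eps0 : 0 < eps) (delta0 : 0 <= delta).
Hypothesis A1 : cond_A1 P n xi F eps.
Hypothesis A2 : cond_A2 P n xi F delta.
Variables (gam lam C Lmax : R).
Hypotheses (gam0 : 0 < gam) (gamdelta : delta <= gam) (lam0 : 0 <= lam).
Hypotheses (C6912 : 6912 <= C) (Lmax0 : 0 <= Lmax).
Hypotheses (epslam : lam * eps <= 16^-1) (epsgam : Kpar C * eps <= gam).
Let W0 := 1 + delta ^+ 2 + gam ^+ 2.
Hypothesis WL : ln (W0 / gam ^+ 2) <= Lmax.

Let W01 : 1 <= W0.
Proof. by rewrite /W0 -addrA lerDl addr_ge0// sqr_ge0. Qed.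

Let sF := md_sigma MD.
Let FT i : (i <= n)%N -> F i `<=` measurable.
Proof. exact: (filtration_sub MD). Qed.

Let s := spent P xi F eps delta gam.
Let bound x := (expR (4 * kpar lam eps C * W0) * barrier lam gam eps C Lmax (- x) W0)%:E.

Lemma upper_tail_le x : (P [set w | (x < mart_sum xi n w)%R] <= bound x)%E.
Proof.
apply: (@tail_le_barrier _ _ _ _ n xi s F lam gam eps C Lmax W0) => //.
- exact: (md_incr MD).
- by move=> i /andP[_]; exact: (md_adapted MD).
- by move=> i ni; exact: (measurable_spent eps delta MD gam ni).
- exact: spent_ge0.
- exact: spent_le.
- by move=> k w _; rewrite remainingE remaining_ge.
- exact: (centered_parts MD).
- exact: (spent_second_moment MD).
- exact: (spent_even_moments MD).
- exact: (remaining_final MD).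
Qed.

(** What is used of the increments, their even moments and the symmetric form of
    their centering, is invariant under a change of sign. *)
Lemma lower_tail_le x : (P [set w | (mart_sum xi n w < - x)%R] <= bound x)%E.
Proof.
pose xi' i w := - xi i w.
have -> : [set w | mart_sum xi n w < - x] = [set w | x < mart_sum xi' n w].
  by apply/funext => w /=; rewrite /mart_sum sumrN ltrNr.
apply: (@tail_le_barrier _ _ _ _ n xi' s F lam gam eps C Lmax W0) => //.
- exact: (md_incr MD).
- move=> i /andP[_] ni; apply: measurable_funN; exact: (md_adapted MD).
- by move=> i ni; exact: (measurable_spent eps delta MD gam ni).
- exact: spent_ge0.
- exact: spent_le.
- by move=> k w _; rewrite remainingE remaining_ge.
- move=> i A ni FA; rewrite /xi'; under [RHS]eq_integral do rewrite opprK.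
  exact/esym/(centered_parts MD).
- move=> i A ni FA; rewrite /xi'; under eq_integral do rewrite sqrrN.
  exact: (spent_second_moment MD).
- move=> i A j ni FA; rewrite /xi'.
  have -> : (2 * j).+2 = (2 * j.+1)%N by rewrite mulnS.
  under eq_integral do rewrite exprM sqrrN -exprM mulnS.
  by rewrite mulnS; exact: (spent_even_moments MD).
- exact: (remaining_final MD).
Qed.

End both_tails.

(** * Estimates of the starting value *)

Section start_value.
Variable R : realType.
Implicit Types (x eps delta gam : R).

(** At [u = - x] with tilt [lam = x], both kernels have the size [exp (- x^2 / 2)] of the
    normal density, up to [exp (x^2 th / 2)]: this is why the tilt is [x]. *)
Lemma barrier_start_le x gam eps C Lmax (th g f : R) : 0 <= x -> 0 <= th ->
    0 <= gco gam (apar eps C) (bpar gam) (1 + th) <= g ->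
    0 <= fco (dpar eps C) (epar x gam eps C Lmax) (1 + th) <= f ->
  barrier x gam eps C Lmax (- x) (1 + th) <=
    Phi (- x) + expR (x ^+ 2 * th / 2) * (x * th + g + f) * expR (- x ^+ 2 / 2).
Proof.
move=> x0 th0 /andP[g0 gg] /andP[f0 ff].
have W0 : 0 < 1 + th by rewrite ltr_wpDr.
have r0 := rs_gt0 W0.
have W1 : (1 + th)^-1 <= 1 by rewrite invf_le1// lerDl.
have Wi : 1 - th <= (1 + th)^-1.
  rewrite -(ler_pM2r W0) mulVf ?gt_eqF// -subr_ge0.
  rewrite (_ : 1 - (1 - th) * (1 + th) = th ^+ 2) ?sqr_ge0//.
  by ring.
have r1 : rs (1 + th) <= 1.
  rewrite -(@ler_pXn2r _ 2)// ?nnegrE ?(ltW r0)//.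
  by rewrite rs_sqr// expr1n.
have rt : 1 - th <= rs (1 + th).
  apply: le_trans Wi _; rewrite -rs_sqr// expr2 -[leRHS]mulr1.
  by rewrite ler_wpM2l// ltW.
pose E := expR (x ^+ 2 * th / 2) * expR (- x ^+ 2 / 2).
have EE : expR (- (x ^+ 2 / (2 * (1 + th)))) <= E.
  rewrite /E -expRD ler_expR.
  have := ler_wpM2l (sqr_ge0 x) Wi.
  by rewrite invfM; move: (1 + th)^-1 (x ^+ 2) => i y; lra.
have Eb : bump (- x) (1 + th) <= E.
  rewrite /bump sqrrN; apply: le_trans EE.
  by rewrite ler_piMl// expR_ge0.
have Ef : fat x (- x) (1 + th) <= E.
  apply: le_trans (fat_le_expR x W0 (- x)) _.
  apply: (@le_trans _ _ (expR (x * - x + x ^+ 2 * (1 + th) / 2))).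
    by rewrite ler_piMr// expR_ge0.
  rewrite /E -expRD ler_expR le_eqVlt; apply/orP; left; apply/eqP.
  by field.
have EP : Phi (- x * rs (1 + th)) <= Phi (- x) + x * th * E.
  have xr0 : 0 <= x * rs (1 + th) by rewrite mulr_ge0// ltW.
  have xr : x * rs (1 + th) <= x by rewrite ler_piMr.
  have := Phi_increment xr0 xr; rewrite [- x * _]mulNr !PhiN.
  have -> : - (x * rs (1 + th)) ^+ 2 / 2 = - (x ^+ 2 / (2 * (1 + th))).
    by rewrite exprMn rs_sqr//; field; rewrite gt_eqF.
  have : (x - x * rs (1 + th)) * expR (- (x ^+ 2 / (2 * (1 + th)))) <= x * th * E.
    apply: ler_pM => //; rewrite ?expR_ge0 ?subr_ge0//.
    by have := ler_wpM2l x0 rt; lra.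
  by lra.
have E0 : 0 <= E by rewrite mulr_ge0// expR_ge0.
have b0 := bump_ge0 W0 (- x).
have F0 := ltW (fat_gt0 x W0 (- x)).
have h1 := ler_pM g0 b0 gg Eb.
have h2 := ler_pM f0 F0 ff Ef.
rewrite /barrier /bar.
have -> : expR (x ^+ 2 * th / 2) * (x * th + g + f) * expR (- x ^+ 2 / 2) =
  x * th * E + g * E + f * E by rewrite /E; ring.
by rewrite !addrA; apply: lerD h2; exact: lerD.
Qed.

(** The reciprocal of the Gaussian tail, at the cost of a factor [1 + x]. *)
Lemma expR_le_tail : exists2 N : R, 1 <= N &
  forall x, 0 <= x -> expR (- x ^+ 2 / 2) <= N * (1 + x) * Phi (- x).
Proof.
have n0 := nrm_gt0 R.
have m0 : 0 < nrm R * expR (- 2) by rewrite mulr_gt0// expR_gt0.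
exists (nrm R * expR (- 2))^-1.
  rewrite invf_ge1//; apply: mulr_ile1; rewrite ?expR_ge0 ?(ltW n0) ?nrm_le1//.
move=> x x0; rewrite -mulrA -ler_pdivrMl ?invr_gt0// invrK.
exact: PhiN_ge.
Qed.

(** Trade of the polynomial losses for the two factors of the final bound, where
    [Q = x^3 eps + x^2 delta^2] and [eta = eps |ln eps| + delta]. *)
Lemma absorb_polynomials x eps delta eta :
    0 <= x -> 0 < eps <= 2^-1 -> 0 <= delta <= 2^-1 ->
    eps <= 2 * eta -> delta <= eta ->
  let Q := x ^+ 3 * eps + x ^+ 2 * delta ^+ 2 in
  [/\ x ^+ 2 * (eps ^+ 2 + delta ^+ 2) <= Q + 1,
      (1 + x) * (x * (eps ^+ 2 + delta ^+ 2)) <= 2 * Q + 5 * ((1 + x) * eta),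
      (1 + x) * (x ^+ 2 * eps) <= 2 * Q + 2 * ((1 + x) * eta) &
      (1 + x) * (x ^+ 3 * eps * eta) <= Q * ((1 + x) * eta)].
Proof.
move=> x0 /andP[e0 e2] /andP[d0 d2] ee de Q.
have eta0 : 0 <= eta by exact: le_trans de.
have x2 : x ^+ 2 <= x ^+ 3 + 1.
  have -> : x ^+ 3 = x * x ^+ 2 by rewrite exprS.
  have [x1|/ltW x1] := lerP x 1.
    have : x ^+ 2 <= 1 by rewrite expr_le1.
    by have := mulr_ge0 x0 (sqr_ge0 x); lra.
  by have := ler_wpM2r (sqr_ge0 x) x1; lra.
have e21 : eps ^+ 2 <= eps by rewrite expr2 ler_piMr ?(ltW e0)//; lra.
have d21 : delta ^+ 2 <= delta by rewrite expr2 ler_piMr//; lra.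
have x2e : x ^+ 2 * eps <= x ^+ 3 * eps + eps.
  by have := ler_wpM2r (ltW e0) x2; rewrite mulrDl mul1r.
have x2ee : x ^+ 2 * eps ^+ 2 <= x ^+ 2 * eps by rewrite ler_wpM2l ?sqr_ge0.
have xee : x * eps ^+ 2 <= x * eps by rewrite ler_wpM2l.
have xdd : x * delta ^+ 2 <= x * delta by rewrite ler_wpM2l.
have xe : x * eps <= x * (2 * eta) by rewrite ler_wpM2l.
have xd : x * delta <= x * eta by rewrite ler_wpM2l.
have x3 : 0 <= x ^+ 3 * eps by rewrite mulr_ge0 ?exprn_ge0 ?(ltW e0).
have x2d : 0 <= x ^+ 2 * delta ^+ 2 by rewrite mulr_ge0 ?sqr_ge0.
have xeta : 0 <= x * eta by exact: mulr_ge0.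
split.
- by rewrite /Q mulrDr; lra.
- have -> : (1 + x) * (x * (eps ^+ 2 + delta ^+ 2)) =
    x * eps ^+ 2 + x * delta ^+ 2 + x ^+ 2 * eps ^+ 2 + x ^+ 2 * delta ^+ 2 by ring.
  by rewrite /Q mulrDl mul1r; lra.
- have -> : (1 + x) * (x ^+ 2 * eps) = x ^+ 2 * eps + x ^+ 3 * eps by ring.
  by rewrite /Q mulrDl mul1r; lra.
- have -> : (1 + x) * (x ^+ 3 * eps * eta) = x ^+ 3 * eps * ((1 + x) * eta) by ring.
  by rewrite ler_wpM2r ?mulr_ge0 ?addr_ge0// /Q lerDl.
Qed.

Lemma ln_bounds eps : 0 < eps <= 2^-1 ->
  [/\ `|ln eps| = - ln eps, 1 <= 2 * `|ln eps| & eps * `|ln eps| <= 1].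
Proof.
move=> /andP[e0 e2].
have e1 : eps <= 1 by lra.
have l0 : ln eps <= 0 by exact: ln_le0.
have nE : `|ln eps| = - ln eps by rewrite ler0_norm.
have ei : 0 < eps^-1 by rewrite invr_gt0.
split => //.
- rewrite nE; have := expR_half_lt2 R; rewrite -ler_ln ?posrE ?expR_gt0//.
  have : ln eps <= ln 2^-1 by rewrite ler_ln ?posrE.
  by rewrite expRK lnV ?posrE//; lra.
- rewrite nE -lnV ?posrE// -ler_pdivlMl// mulr1.
  have := @le_ln1Dx R (eps^-1 - 1).
  rewrite [X in ln X]addrC subrK => h; apply: le_trans (h _) _; last by rewrite gerBl.
  by rewrite ltrBrDl subrr.
Qed.

End start_value.

(** * Constants *)

Section constants.
Variable R : realType.
Implicit Types (x eps delta eta : R).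

Lemma le_expRM_1D (a q y : R) : 1 <= a -> 0 <= q -> 0 <= y ->
  1 + a * (y + q + q * y) <= expR (a * q) * (1 + a * y).
Proof.
move=> a1 q0 y0; have a0 : 0 <= a by exact: le_trans a1.
have ay : 0 <= a * y by exact: mulr_ge0.
have qy : 0 <= q * y by exact: mulr_ge0.
apply: (@le_trans _ _ ((1 + a * q) * (1 + a * y))).
  have -> : (1 + a * q) * (1 + a * y) = 1 + a * y + a * q + a * (a * (q * y)) by ring.
  have : a * (q * y) <= a * (a * (q * y)) by rewrite ler_wpM2l// ler_peMl.
  by move: (q * y) (a * (a * _)) => z t; rewrite !mulrDr; lra.
by rewrite ler_wpM2r ?expR_ge1Dx// addr_ge0.
Qed.

(** Each correction to [Phi (- x) = p] is first multiplied by the [1 + x] that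
    [expR_le_tail] costs.  By [absorb_polynomials], it is then a combination of
    [Q = x^3 eps + x^2 delta^2], of [Y = (1 + x) eta] and of [Q Y], which
    [le_expRM_1D] factors as [exp (c Q) (1 + c Y)]. *)
Lemma start_value_bound (N B A D M1 K1 : R) : 1 <= N -> 0 <= B -> 0 <= A -> 0 <= D ->
    0 <= M1 -> 0 <= K1 ->
  exists2 c : R, 0 < c & forall x eps delta eta th g f p,
    0 <= x -> 0 < eps <= 2^-1 -> 0 <= delta <= 2^-1 ->
    eps <= 2 * eta -> delta <= eta -> 0 <= p ->
    expR (- x ^+ 2 / 2) <= N * (1 + x) * p ->
    0 <= th <= B * (eps ^+ 2 + delta ^+ 2) -> 0 <= g <= A * eta ->
    0 <= f <= D * eps + M1 * (x ^+ 2 * eps + A * (x ^+ 3 * eps * eta)) ->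
  expR (K1 * (x ^+ 3 * eps)) *
    (p + expR (x ^+ 2 * th / 2) * (x * th + g + f) * expR (- x ^+ 2 / 2)) <=
  p * (expR (c * (x ^+ 3 * eps + x ^+ 2 * delta ^+ 2)) * (1 + c * (1 + x) * eta)).
Proof.
move=> N1 B0 A0 D0 M0 K0.
pose A2 := 5 * B + A + 2 * D + M1 * (2 + A).
have A20 : 0 <= A2.
  apply: addr_ge0; last by rewrite mulr_ge0// addr_ge0.
  by rewrite !addr_ge0// mulr_ge0.
pose A3 := 1 + expR B * N * A2.
have N0 : 0 <= N by exact: le_trans N1.
have eN0 : 0 <= expR B * N by rewrite mulr_ge0// expR_ge0.
have A31 : 1 <= A3 by rewrite lerDl mulr_ge0.
have A30 : 0 <= A3 by exact: le_trans A31.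
exists (K1 + B + A3); first by rewrite ltr_wpDl// ?addr_ge0//; exact: lt_le_trans A31.
move=> x eps delta eta th g f p x0 e01 d01 ee de p0 gauss /andP[th0 thB] /andP[g0 gA]
  /andP[f0 fM].
have [e0 e2] := andP e01; have [d0 d2] := andP d01.
have eta0 : 0 <= eta by exact: le_trans de.
set q3 := x ^+ 3 * eps; set Q := q3 + x ^+ 2 * delta ^+ 2.
set Y := (1 + x) * eta.
have [h1 h2 h3 h4] := absorb_polynomials x0 e01 d01 ee de.
rewrite -/q3 -/Q -/Y in h1 h2 h3 h4.
have q30 : 0 <= q3 by rewrite mulr_ge0 ?exprn_ge0 ?(ltW e0).
have Q0 : 0 <= Q by rewrite addr_ge0// mulr_ge0 ?sqr_ge0.
have Y0 : 0 <= Y by rewrite mulr_ge0// addr_ge0.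
have QY0 : 0 <= Q * Y by exact: mulr_ge0.
have x10 : 0 <= 1 + x by rewrite addr_ge0.
have eY : (1 + x) * eps <= 2 * Y by rewrite /Y mulrCA ler_wpM2l.
have poly : (1 + x) * (x * th + g + f) <= A2 * (Y + Q + Q * Y).
  have b1 : (1 + x) * (x * th) <= B * (2 * Q + 5 * Y).
    apply: le_trans (ler_wpM2l B0 h2).
    have := ler_wpM2l x10 (ler_wpM2l x0 thB).
    by have -> : (1 + x) * (x * (B * (eps ^+ 2 + delta ^+ 2))) =
      B * ((1 + x) * (x * (eps ^+ 2 + delta ^+ 2))) by ring.
  have b2 : (1 + x) * g <= A * Y by rewrite /Y mulrCA ler_wpM2l.
  have b3 : (1 + x) * f <= D * (2 * Y) + M1 * (2 * Q + 2 * Y + A * (Q * Y)).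
    apply: (le_trans (ler_wpM2l x10 fM)).
    have -> : (1 + x) * (D * eps + M1 * (x ^+ 2 * eps + A * (x ^+ 3 * eps * eta))) =
      D * ((1 + x) * eps) + M1 * ((1 + x) * (x ^+ 2 * eps) + A * ((1 + x) * (q3 * eta))).
      by rewrite /q3; ring.
    apply: lerD; rewrite ler_wpM2l//; apply: lerD => //.
    by rewrite ler_wpM2l.
  have -> : A2 * (Y + Q + Q * Y) = B * (2 * Q + 5 * Y) + A * Y
    + (D * (2 * Y) + M1 * (2 * Q + 2 * Y + A * (Q * Y)))
    + ((3 * B + A + 2 * D + M1 * A) * Q + (M1 * A) * Y
       + (5 * B + A + 2 * D + M1 * 2) * (Q * Y)) by rewrite /A2; ring.
  rewrite 2!mulrDr; apply: le_trans (lerD (lerD b1 b2) b3) _; rewrite lerDl.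
  have MA : 0 <= M1 * A by exact: mulr_ge0.
  have M2 : 0 <= M1 * 2 by exact: mulr_ge0.
  apply: addr_ge0; first apply: addr_ge0; apply: mulr_ge0 => //.
    by rewrite !addr_ge0// mulr_ge0.
  by rewrite !addr_ge0// mulr_ge0.
have tilt : expR (x ^+ 2 * th / 2) <= expR B * expR (B * Q).
  rewrite -expRD ler_expR.
  have BQ1 : B * (x ^+ 2 * (eps ^+ 2 + delta ^+ 2)) <= B * (Q + 1) by rewrite ler_wpM2l.
  have xth : x ^+ 2 * th <= B * (x ^+ 2 * (eps ^+ 2 + delta ^+ 2)).
    by rewrite mulrCA ler_wpM2l ?sqr_ge0.
  have BQ : 0 <= B * Q by exact: mulr_ge0.
  by move: BQ1 xth BQ B0; move: (x ^+ 2 * (_ + _)) => z; rewrite [B * (Q + 1)]mulrDr mulr1; lra.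
have BQ1 : 1 <= expR (B * Q) by rewrite -expR0 ler_expR mulr_ge0.
have K1Q : expR (K1 * q3) <= expR (K1 * Q).
  by rewrite ler_expR ler_wpM2l// lerDl mulr_ge0 ?sqr_ge0.
pose Z := x * th + g + f.
have Z0 : 0 <= Z by rewrite !addr_ge0// mulr_ge0.
have inner : p + expR (x ^+ 2 * th / 2) * Z * expR (- x ^+ 2 / 2) <=
    p * (expR (B * Q) * (expR (A3 * Q) * (1 + A3 * Y))).
  apply: (@le_trans _ _ (p * (expR (B * Q) * (1 + A3 * (Y + Q + Q * Y))))); last first.
    by rewrite ler_wpM2l// ler_wpM2l ?expR_ge0// le_expRM_1D.
  have s1 : expR (x ^+ 2 * th / 2) * Z * expR (- x ^+ 2 / 2) <=
      expR B * expR (B * Q) * Z * (N * (1 + x) * p).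
    apply: ler_pM => //; rewrite ?expR_ge0//.
      by rewrite mulr_ge0// expR_ge0.
    by rewrite ler_wpM2r.
  have s2 : expR B * expR (B * Q) * Z * (N * (1 + x) * p) <=
      p * (expR (B * Q) * (expR B * N * A2 * (Y + Q + Q * Y))).
    have -> : expR B * expR (B * Q) * Z * (N * (1 + x) * p) =
      p * (expR (B * Q) * (expR B * N * ((1 + x) * Z))) by ring.
    rewrite -[in leRHS]mulrA.
    by do 2 (rewrite ler_wpM2l ?expR_ge0//); rewrite ler_wpM2l.
  have S0 : 0 <= Y + Q + Q * Y by apply: addr_ge0 => //; exact: addr_ge0.
  apply: (le_trans (lerD (lexx p) (le_trans s1 s2))).
  rewrite -[X in X + _]mulr1 -mulrDr ler_wpM2l//.
  apply: (@le_trans _ _ (expR (B * Q) * 1 + expR (B * Q) * (expR B * N * A2 * (Y + Q + Q * Y)))).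
    by rewrite mulr1 lerD2r.
  by rewrite -mulrDr ler_wpM2l ?expR_ge0// lerD2l ler_wpM2r// lerDr.
have I0 : 0 <= p + expR (x ^+ 2 * th / 2) * Z * expR (- x ^+ 2 / 2).
  by rewrite addr_ge0// !mulr_ge0 ?expR_ge0.
apply: (le_trans (ler_pM (expR_ge0 _) I0 K1Q inner)).
have -> : expR (K1 * Q) * (p * (expR (B * Q) * (expR (A3 * Q) * (1 + A3 * Y)))) =
  p * (expR (K1 * Q) * expR (B * Q) * expR (A3 * Q) * (1 + A3 * Y)) by ring.
rewrite -!expRD -!mulrDl ler_wpM2l// ler_wpM2l ?expR_ge0//.
rewrite lerD2l -mulrA -/Y ler_wpM2r// lerDr addr_ge0//.
Qed.

(** The logarithm in the final bound comes from [Lmax] alone: as [eps <= gam], it is of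
    order [|ln eps|], and it is multiplied by the coefficient [a * eps]. *)
Lemma parameter_bounds (k a : R) : 1 <= k -> 0 <= a ->
  exists A B M : R, [/\ 0 <= A, 0 <= B, 0 <= M &
  forall eps delta, 0 < eps <= 2^-1 -> 0 <= delta <= 2^-1 ->
    let eta := eps * `|ln eps| + delta in
    let gam := k * (eps + delta) in
    let th := delta ^+ 2 + gam ^+ 2 in
    let Lmax := ln ((1 + th) / gam ^+ 2) in
    [/\ 0 <= Lmax, th <= B * (eps ^+ 2 + delta ^+ 2), 1 + th <= M,
        4 * gam + a * eps * (1 + Lmax) <= A * eta &
        eps <= 2 * eta /\ delta <= eta]].
Proof.
move=> k1 a0.
have k0 : 0 <= k by exact: le_trans k1.
have kk0 : 0 <= k ^+ 2 by exact: sqr_ge0.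
pose B := 1 + 2 * k ^+ 2.
have B1 : 1 <= B by rewrite lerDl mulr_ge0.
have B0 : 0 <= B by exact: le_trans B1.
pose M := 1 + B.
have M0 : 0 <= M by rewrite addr_ge0.
exists (8 * k + a * (2 * M + 4)), B, M; split => //.
  by rewrite addr_ge0// mulr_ge0// addr_ge0// mulr_ge0.
move=> eps delta e01 d01 eta gam th Lmax.
have [e0 e2] := andP e01; have [d0 d2] := andP d01.
have [lE l1 el1] := ln_bounds e01.
have l0 : 0 <= `|ln eps| by exact: normr_ge0.
have ed0 : 0 < eps + delta by rewrite ltr_wpDr.
have gam0 : 0 < gam by rewrite mulr_gt0//; exact: lt_le_trans k1.
have eg : eps <= gam.
  rewrite /gam -[leLHS]mul1r; apply: ler_pM => //; first exact: ltW.
  by rewrite lerDl.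
have th0 : 0 <= th by rewrite addr_ge0 ?sqr_ge0.
have thB : th <= B * (eps ^+ 2 + delta ^+ 2).
  have : k ^+ 2 * (eps + delta) ^+ 2 <= k ^+ 2 * (2 * (eps ^+ 2 + delta ^+ 2)).
    by rewrite ler_wpM2l//; have := sqr_ge0 (eps - delta); lra.
  have := sqr_ge0 eps.
  rewrite /th /gam /B exprMn mulrDl mul1r => h1 h2.
  by move: h1 h2; move: (k ^+ 2) (eps ^+ 2) (delta ^+ 2) => *; lra.
have edb : eps ^+ 2 + delta ^+ 2 <= 1.
  have : eps ^+ 2 <= 2^-1 ^+ 2 by rewrite ler_pXn2r ?nnegrE ?(ltW e0).
  have : delta ^+ 2 <= 2^-1 ^+ 2 by rewrite ler_pXn2r ?nnegrE.
  by lra.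
have WM : 1 + th <= M by rewrite lerD2l (le_trans thB)// ler_piMr.
have W0 : 0 < 1 + th by rewrite ltr_wpDr.
have g20 : 0 < gam ^+ 2 by rewrite exprn_gt0.
have L0 : 0 <= Lmax.
  by rewrite ln_ge0// ler_pdivlMr// mul1r /th addrA lerDr addr_ge0// sqr_ge0.
have e_eta : eps <= 2 * (eps * `|ln eps|).
  by rewrite mulrCA ler_peMr// ltW.
have LM : 1 + Lmax <= (2 * M + 4) * `|ln eps|.
  have : Lmax <= M + 2 * `|ln eps|.
    rewrite /Lmax lnM ?posrE ?invr_gt0// lnV ?posrE// lnXn// lE.
    have h1 : ln (1 + th) <= M.
      apply: le_trans (_ : _ <= th) _; first by apply: le_ln1Dx; exact: lt_le_trans th0.
      by apply: le_trans WM; rewrite lerDr.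
    have h2 : ln eps <= ln gam by rewrite ler_ln ?posrE.
    by rewrite mulr2n; move: h1 h2; lra.
  have : M * 1 <= M * (2 * `|ln eps|) by rewrite ler_wpM2l.
  by rewrite mulr1; move: l1; lra.
have de : delta <= eta by rewrite lerDr mulr_ge0// ltW.
have ee : eps <= 2 * eta by apply: (le_trans e_eta); rewrite ler_wpM2l// lerDl.
split => //.
have b1 : 4 * gam <= 8 * k * eta.
  have : k * (eps + delta) <= k * (2 * eta).
    rewrite ler_wpM2l// [2 * eta]mulrDr; apply: lerD => //.
    by rewrite ler_peMl// ler1n.
  by rewrite /gam -mulrA; lra.
have b2 : a * eps * (1 + Lmax) <= a * (2 * M + 4) * eta.
  rewrite -!mulrA ler_wpM2l//.
  apply: (le_trans (ler_wpM2l (ltW e0) LM)).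
  rewrite mulrCA ler_wpM2l ?lerDl//.
  by rewrite addr_ge0// mulr_ge0.
by rewrite [leRHS]mulrDl; exact: lerD.
Qed.

End constants.

(** * The theorem *)

Section assembly.
Context (R : realType).
Implicit Types x eps delta : R.

(* the constant of the derivative bounds bar3_le and barww_le *)
Let c0 : R := 6912.

Let c0E : 6912 <= c0. Proof. exact: lexx. Qed.

Definition rhs_bound (c x eps delta : R) : R :=
  expR (c * (x ^+ 3 * eps + x ^+ 2 * delta ^+ 2)) *
  (1 + c * (1 + x) * (eps * `|ln eps| + delta)).

Lemma rhs_bound_ler c c' x eps delta : 0 <= c -> c <= c' -> 0 <= x ->
  0 < eps -> 0 <= delta -> rhs_bound c x eps delta <= rhs_bound c' x eps delta.
Proof.
move=> cge cc x0 e0 d0.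
have Q0 : 0 <= x ^+ 3 * eps + x ^+ 2 * delta ^+ 2.
  by rewrite addr_ge0 ?mulr_ge0 ?exprn_ge0// ltW.
have Y0 : 0 <= eps * `|ln eps| + delta by rewrite addr_ge0// mulr_ge0// ltW.
have x10 : 0 <= 1 + x by rewrite addr_ge0.
apply: ler_pM; rewrite ?expR_ge0//.
- by rewrite addr_ge0// mulr_ge0// mulr_ge0.
- by rewrite ler_expR ler_wpM2r.
- by rewrite lerD2l ler_wpM2r// ler_wpM2r.
Qed.

(** Outside the range [x * eps <= 1/16] the cubic term of the exponent exceeds
    a multiple of [x^2], so that the bound already exceeds [1 / Phi (- x)]. *)
Lemma trivial_range : exists2 c, 0 < c & forall x eps delta,
  0 <= x -> 0 < eps <= 2^-1 -> 0 <= delta -> 16^-1 < x * eps ->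
  1 <= Phi (- x) * rhs_bound c x eps delta.
Proof.
have [N N1 gauss] := expR_le_tail R.
have N0 : 0 <= N by exact: le_trans N1.
exists (144 + 1024 * N).
  by apply: ltr_wpDr; [exact: mulr_ge0 (ler0n _ _) N0|rewrite ltr0n].
move=> x eps delta x0 /andP[e0 e2] d0 xe.
have Y0 : 0 <= eps * `|ln eps| + delta by rewrite addr_ge0// mulr_ge0// ltW.
set c := 144 + 1024 * N.
have cge0 : 0 <= c := addr_ge0 (ler0n _ _) (mulr_ge0 (ler0n _ _) N0).
have x18 : 8^-1 <= x.
  by have : x * eps <= x * 2^-1 by [rewrite ler_wpM2l]; lra.
set q := x ^+ 3 * eps.
have q0 : 0 <= q by rewrite mulr_ge0 ?exprn_ge0 ?(ltW e0).
have x2q : x ^+ 2 <= 16 * q.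
  have := ler_wpM2l (sqr_ge0 x) (ltW xe).
  by rewrite mulrA -exprSr -/q; lra.
have x8 : x <= 8 * x ^+ 2 by have := ler_wpM2l x0 x18; rewrite -expr2; lra.
have x64 : 1 <= 64 * x ^+ 2.
  by have : x * 1 <= x * (8 * x) by [rewrite ler_wpM2l//; lra]; rewrite mulr1 mulrCA -expr2; lra.
have P0 := PhiN_gt0 x0.
have N_le : N <= expR (1024 * N * q).
  apply: le_trans (_ : N * (1024 * q) <= _).
    by rewrite -[leLHS]mulr1 ler_wpM2l//; lra.
  rewrite mulrA [N * _]mulrC; apply: le_trans (expR_ge1Dx _).
  by rewrite lerDr.
have x1_le : (1 + x) * expR (x ^+ 2 / 2) <= expR (144 * q).
  apply: (@le_trans _ _ (expR x * expR (x ^+ 2 / 2))).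
    by rewrite ler_wpM2r ?expR_ge0// expR_ge1Dx.
  by rewrite -expRD ler_expR; lra.
have one : 1 <= Phi (- x) * expR (c * q).
  have -> : expR (c * q) = expR (1024 * N * q) * expR (144 * q).
    by rewrite -expRD /c; congr expR; ring.
  apply: (@le_trans _ _ (Phi (- x) * (N * ((1 + x) * expR (x ^+ 2 / 2))))).
    have -> : Phi (- x) * (N * ((1 + x) * expR (x ^+ 2 / 2))) =
      N * (1 + x) * Phi (- x) * expR (x ^+ 2 / 2) by ring.
    have e1 : expR (- x ^+ 2 / 2) * expR (x ^+ 2 / 2) = 1.
      by rewrite -expRD mulNr addNr expR0.
    by rewrite -[leLHS]e1 ler_wpM2r ?expR_ge0// gauss.
  rewrite ler_wpM2l ?(ltW P0)//; apply: ler_pM => //.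
  by rewrite mulr_ge0 ?expR_ge0// addr_ge0.
apply: (le_trans one); rewrite ler_wpM2l ?(ltW P0)// /rhs_bound -[leLHS]mulr1.
apply: ler_pM; rewrite ?expR_ge0//.
  by rewrite ler_expR ler_wpM2l// lerDl mulr_ge0 ?sqr_ge0.
by rewrite lerDl mulr_ge0// mulr_ge0// addr_ge0.
Qed.

(** The tilt is [x] and [gam] is proportional to [eps + delta]; under the bound on
    [x * eps] the tilt is slow at the scale [eps] of the increments, as
    [increment_growth] requires. *)
Lemma main_range : exists2 c, 0 < c & forall d (T : measurableType d)
    (P : probability T R) n (xi : nat -> T -> R) F eps delta,
    martingale_differences P n xi F -> 0 < eps <= 2^-1 -> 0 <= delta <= 2^-1 ->
    cond_A1 P n xi F eps -> cond_A2 P n xi F delta ->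
    forall x, 0 <= x -> x * eps <= 16^-1 ->
  (P [set w | (x < mart_sum xi n w)%R] <= (Phi (- x) * rhs_bound c x eps delta)%:E)%E /\
  (P [set w | (mart_sum xi n w < - x)%R] <= (Phi (- x) * rhs_bound c x eps delta)%:E)%E.
Proof.
have [N N1 gauss] := expR_le_tail R.
have Ce0 : 0 <= Cerr c0 by apply: le_trans (Cerr_ge1 c0E).
have k1 : 1 <= Kpar c0 by apply: le_trans (Kpar_ge c0E); rewrite ler1n.
pose D := 512 * Cerr c0.
have D0 : 0 <= D := mulr_ge0 (ler0n _ 512) Ce0.
pose a := expR 8 * D.
have a0 : 0 <= a by apply: mulr_ge0 => //; exact: expR_ge0.
have [A [B [M [A0 B0 M0 par]]]] := parameter_bounds k1 a0.
pose M1 := 32 * Cerr c0 * M.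
have M10 : 0 <= M1 by apply: mulr_ge0 => //; exact: mulr_ge0.
pose K1 := 16 * Cerr c0 * M.
have K10 : 0 <= K1 by apply: mulr_ge0 => //; exact: mulr_ge0.
have [c cpos start] := start_value_bound N1 B0 A0 D0 M10 K10.
exists c => // d T P n xi F eps delta MD e01 d01 A1 A2 x x0 xe.
have [e0 e2] := andP e01; have [d0 d2] := andP d01.
have := par eps delta e01 d01; cbv zeta.
set eta := eps * `|ln eps| + delta; set gam := Kpar c0 * (eps + delta).
set th := delta ^+ 2 + gam ^+ 2; set Lmax := ln _.
move=> /= [L0 thB WM Gb [ee de]].
have gam0 : 0 < gam by rewrite mulr_gt0 ?ltr_wpDr//; exact: lt_le_trans k1.
have th0 : 0 <= th by rewrite addr_ge0 ?sqr_ge0.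
have gd : delta <= gam.
  rewrite /gam -[leLHS]mul1r; apply: ler_pM => //.
  by rewrite lerDr ltW.
have epsgam : Kpar c0 * eps <= gam.
  by rewrite ler_wpM2l ?lerDl//; exact: le_trans k1.
have W0E : 1 + delta ^+ 2 + gam ^+ 2 = 1 + th by rewrite addrA.
have WL : ln ((1 + delta ^+ 2 + gam ^+ 2) / gam ^+ 2) <= Lmax by rewrite W0E.
have aE : apar eps c0 = a * eps by rewrite /apar /dpar /a mulrA.
have DE : dpar eps c0 = D * eps by [].
have aeps0 : 0 <= a * eps by rewrite mulr_ge0// ltW.
have Gb' : bpar gam + apar eps c0 * (1 + Lmax) <= A * eta by rewrite aE.
have G0 : 0 <= bpar gam + apar eps c0 * (1 + Lmax).
  rewrite aE; apply: addr_ge0; first by apply: mulr_ge0 => //; exact: ltW.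
  by apply: mulr_ge0 => //; exact: addr_ge0.
pose g := gco gam (apar eps c0) (bpar gam) (1 + th).
have gE : g = bpar gam + apar eps c0 * Lmax by [].
have g0 : 0 <= g.
  rewrite gE aE; apply: addr_ge0; last exact: mulr_ge0.
  by apply: mulr_ge0 => //; exact: ltW.
have gA : g <= A * eta.
  by apply: le_trans Gb'; rewrite gE lerD2l aE ler_wpM2l// lerDr.
pose f := fco (dpar eps c0) (epar x gam eps c0 Lmax) (1 + th).
have x3 : 0 <= x ^+ 3 by exact: exprn_ge0.
have fE : f = D * eps + 32 * Cerr c0 * (1 + th) *
    (x ^+ 2 * eps + x ^+ 3 * eps * (bpar gam + apar eps c0 * (1 + Lmax))).
  rewrite /f /fco DE /epar.
  by move: (bpar gam + _) (Cerr c0) => G ce; ring.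
have e_ge0 := ltW e0.
have in0 : 0 <= x ^+ 2 * eps + x ^+ 3 * eps * (bpar gam + apar eps c0 * (1 + Lmax)).
  apply: addr_ge0; first exact: mulr_ge0 (sqr_ge0 _) e_ge0.
  by apply: mulr_ge0 => //; exact: mulr_ge0.
have f0 : 0 <= f.
  rewrite fE; apply: addr_ge0; first exact: mulr_ge0.
  apply: mulr_ge0 => //; apply: mulr_ge0; first exact: mulr_ge0.
  exact: addr_ge0.
have fM : f <= D * eps + M1 * (x ^+ 2 * eps + A * (x ^+ 3 * eps * eta)).
  rewrite fE lerD2l; apply: ler_pM => //.
  - by apply: mulr_ge0; [exact: mulr_ge0|exact: addr_ge0].
  - by apply: ler_wpM2l => //; exact: mulr_ge0.
  - rewrite lerD2l [leRHS]mulrCA; apply: ler_wpM2l => //.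
    exact: mulr_ge0.
have P0 := ltW (PhiN_gt0 x0).
have thb : 0 <= th <= B * (eps ^+ 2 + delta ^+ 2) by rewrite th0.
have gb : 0 <= g <= A * eta by rewrite g0.
have fb : 0 <= f <= D * eps + M1 * (x ^+ 2 * eps + A * (x ^+ 3 * eps * eta)).
  by rewrite f0.
have final := start x eps delta eta th g f (Phi (- x)) x0 e01 d01 ee de P0
  (gauss x x0) thb gb fb.
have gg : 0 <= gco gam (apar eps c0) (bpar gam) (1 + th) <= g by rewrite g0/=.
have ff : 0 <= fco (dpar eps c0) (epar x gam eps c0 Lmax) (1 + th) <= f.
  by rewrite f0/=.
have bar := barrier_start_le x0 th0 gg ff.
have B0' : 0 <= barrier x gam eps c0 Lmax (- x) (1 + th).
  apply: barrier_ge0 => //.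
  by rewrite /th addrA lerDr addr_ge0// sqr_ge0.
have kE : expR (4 * kpar x eps c0 * (1 + th)) <= expR (K1 * (x ^+ 3 * eps)).
  rewrite ler_expR.
  have -> : 4 * kpar x eps c0 * (1 + th) = 16 * Cerr c0 * (x ^+ 3 * eps) * (1 + th).
    by rewrite /kpar; move: (Cerr c0) => ce; ring.
  rewrite /K1 mulrAC; apply: ler_wpM2r; first exact: mulr_ge0.
  by apply: ler_wpM2l => //; exact: mulr_ge0.
have bound : expR (4 * kpar x eps c0 * (1 + delta ^+ 2 + gam ^+ 2)) *
    barrier x gam eps c0 Lmax (- x) (1 + delta ^+ 2 + gam ^+ 2) <=
    Phi (- x) * rhs_bound c x eps delta.
  rewrite W0E; apply: le_trans final.
  by apply: ler_pM.
split.
- apply: le_trans (upper_tail_le MD e0 d0 A1 A2 gam0 gd x0 c0E L0 xe epsgam WL x) _.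
  by rewrite lee_fin.
- apply: le_trans (lower_tail_le MD e0 d0 A1 A2 gam0 gd x0 c0E L0 xe epsgam WL x) _.
  by rewrite lee_fin.
Qed.

End assembly.

Lemma measurable_mart_sum d (T : measurableType d) (R : realType) (P : probability T R)
    n (xi : nat -> T -> R) F : martingale_differences P n xi F ->
  measurable_fun [set: T] (mart_sum xi n).
Proof.
move=> MD; suff h k : (k <= n)%N -> measurable_fun [set: T] (mart_sum xi k) by exact: h.
elim: k => [_|k IH kn].
  rewrite (_ : mart_sum xi 0 = cst 0); first exact: measurable_cst.
  by apply/funext => w; rewrite /mart_sum big_geq.
rewrite (_ : mart_sum xi k.+1 = mart_sum xi k \+ xi k.+1); last first.
  by apply/funext => w; rewrite /mart_sum big_nat_recr.
apply: measurable_funD; first exact/IH/ltnW.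
apply: (measurable_wrt_fun (md_sigma MD kn) (filtration_sub MD kn)).
exact: (md_adapted MD).
Qed.

Theorem theorem2p1 (R : realType) (alpha : R) (alpha01 : 0 < alpha < 1) :
  exists c : R, 0 < c /\
  forall (d : measure_display) (T : measurableType d) (P : probability T R)
    (n : nat) (xi : nat -> T -> R) (F : nat -> set (set T)) (eps delta : R),
    (1 <= n)%N ->
    martingale_differences P n xi F ->
    0 < eps <= 2^-1 ->
    0 <= delta <= 2^-1 ->
    cond_A1 P n xi F eps ->
    cond_A2 P n xi F delta ->
    forall x : R, 0 <= x <= alpha * eps^-1 ->
      fine (P [set w | x < mart_sum xi n w]) / (1 - Phi x) <=
        expR (c * (x ^+ 3 * eps + x ^+ 2 * delta ^+ 2)) *
        (1 + c * (1 + x) * (eps * `|ln eps| + delta))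
      /\
      fine (P [set w | mart_sum xi n w < - x]) / Phi (- x) <=
        expR (c * (x ^+ 3 * eps + x ^+ 2 * delta ^+ 2)) *
        (1 + c * (1 + x) * (eps * `|ln eps| + delta)).
Proof.
have [c1 c1_gt0 main] := main_range R.
have [c2 c2_gt0 trivial] := trivial_range R.
exists (c1 + c2); split; first exact: addr_gt0.
move=> d T P n xi F eps delta _ MD e01 d01 A1 A2 x /andP[x0 _].
have [e0 e2] := andP e01; have [d0 d2] := andP d01.
rewrite -PhiN -/(rhs_bound (c1 + c2) x eps delta).
have P0 := PhiN_gt0 x0.
have mX := measurable_mart_sum MD.
have mU : measurable [set w | x < mart_sum xi n w].
  by have := mX measurableT `]x, +oo[%classic (measurable_itv _); rewrite setTI set_itvoy.
have mL : measurable [set w | mart_sum xi n w < - x].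
  by have := mX measurableT `]-oo, (- x)[%classic (measurable_itv _); rewrite setTI set_itvNyo.
suff tail A : measurable A -> (P A <= (Phi (- x) * rhs_bound (c1 + c2) x eps delta)%:E)%E ->
    fine (P A) / Phi (- x) <= rhs_bound (c1 + c2) x eps delta.
  have [xe|xe] := lerP (x * eps) 16^-1.
    have [up low] := main d T P n xi F eps delta MD e01 d01 A1 A2 x x0 xe.
    have cc : Phi (- x) * rhs_bound c1 x eps delta <=
        Phi (- x) * rhs_bound (c1 + c2) x eps delta.
      by rewrite ler_wpM2l ?(ltW P0)// rhs_bound_ler// ?lerDl ltW.
    by split; apply: tail => //; [apply: le_trans up _|apply: le_trans low _];
      rewrite lee_fin.
  have one : 1 <= Phi (- x) * rhs_bound (c1 + c2) x eps delta.
    apply: le_trans (trivial x eps delta x0 e01 d0 xe) _.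
    by rewrite ler_wpM2l ?(ltW P0)// rhs_bound_ler// ?lerDr ltW.
  by split; apply: tail => //; apply: le_trans (probability_le1 P _) _ => //; rewrite lee_fin.
move=> mA; rewrite ler_pdivrMr// mulrC.
by rewrite -{1}[P A]fineK ?fin_num_measure// lee_fin.
Qed.
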